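(* Let $\Gamma$ be a lattice in $\mathbb{C}$, acting on $\mathbb{C}_z\times\mathbb{C}_w$ by $\chi\cdot(z,w)=(z+\chi,w)$. Let $X:=(\mathbb{C}_z\times\mathbb{C}_w)/\Gamma$ with the Kähler metric $g_X:=dz\,d\bar z+dw\,d\bar w$, and let $\varphi_X:=(1+|w|^2)^{-\delta-1}$ for a $\delta>0$. Then $\int_X\varphi_X\,\mathrm{dvol}_X<\infty$, and there exists a function $C_X:\mathbb{R}_{>0}\to\mathbb{R}_{>0}$ such that the following holds. \begin{itemize} \item If $f:X\to[0,\infty)$ is a bounded function such that $\Delta_Xf\le B\varphi_X$ as distributions for a positive number $B$, then \[ \sup_{P\in X}f(P)\le C_X(B)\Bigl(1+\int_Xf\varphi_X\,\mathrm{dvol}_X\Bigr). \] \item If moreover a bounded function $f$ satisfies the stronger condition $\Delta_Xf\le0$ on $X$, then $\Delta_Xf=0$. \end{itemize}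
   Context: $\mathrm{dvol}_X$ is the volume form of $g_X$ and $\Delta_X:=-\sqrt{-1}\Lambda\partial_X\bar\partial_X$, where $\Lambda$ is the adjoint of multiplication by the Kähler form; $\Delta_X$ is one half of the nonnegative Laplacian of the Riemannian metric. Inequalities for $\Delta_Xf$ are understood in the sense of distributions; functions are considered up to null sets and $\sup$ is the essential supremum. *)

(* Defs.v *)
From HB Require Import structures.
From mathcomp Require Import all_boot all_order all_algebra.
From mathcomp Require Import generic_quotient.
From mathcomp Require Import all_classical all_reals all_analysis.
From mathcomp Require Import measurable_realfun ess_sup_inf.
From mathcomp Require Import ring.

Set Implicit Arguments.
Unset Strict Implicit.
Unset Printing Implicit Defensive.
Import Order.TTheory GRing.Theory Num.Theory.
Import numFieldNormedType.Exports.
Local Open Scope classical_set_scope.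
Local Open Scope ring_scope.
Local Open Scope quotient_scope.

(* The complex line C is modelled by its real coordinates: (x, y) stands for
   x + i y, so that C_z * C_w is R^4 with coordinates
   ((Re z, Im z), (Re w, Im w)). *)
Notation cplane R := (R * R)%type.
Notation cplane2 R := (cplane R * cplane R)%type.

(* The same types, with the sigma-algebra that carries lebesgue_measure. *)
Notation mplane R := (measurableTypeR R * measurableTypeR R)%type.
Notation mplane2 R := (mplane R * mplane R)%type.


Definition linindep (R : realType) (u v : cplane R) : Prop :=
  forall a b : R, a *: u + b *: v = 0 -> a = 0 /\ b = 0.

Definition basis_of_lattice (R : realType) (L : set (cplane R))
    (e : cplane R * cplane R) : Prop :=
  linindep e.1 e.2 /\
  L = [set z | exists m n : int, z = e.1 *~ m + e.2 *~ n].

Record lattice (R : realType) := Lattice {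
  lattice_set : set (cplane R) ;
  lattice_ex_basis : exists e, basis_of_lattice lattice_set e }.

Section Lebesgue.
Context (R : realType).

Definition lebesgue2 : set (mplane R) -> \bar R :=
  (@lebesgue_measure R \x @lebesgue_measure R)%E.

HB.instance Definition _ := Measure.on lebesgue2.

(* The sigma-finite instance that the library declares on products is shadowed
   by the one for products of subprobabilities, so it is rebuilt here. *)
Let lebesgue2_sigma_finite : sigma_finite setT lebesgue2.
Proof.
have /sigma_finiteP[F [TF ndF Foo]] := sigma_finiteT (@lebesgue_measure R).
exists (fun n => F n `*` F n).
  rewrite -setXTT TF predeqE => -[x y]; split.
    move=> [/= [n _ Fnx] [k _ Fky]]; exists (maxn n k) => //; split.
    - by move: x Fnx; exact/subsetPset/ndF/leq_maxl.
    - by move: y Fky; exact/subsetPset/ndF/leq_maxr.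
  by move=> [n _ []/= ? ?]; split; exists n.
move=> k; have [? ?] := Foo k.
split; first exact: measurableX.
by rewrite /lebesgue2 product_measure1E// lte_mul_pinfty// ge0_fin_numE.
Qed.

HB.instance Definition _ := Measure_isSigmaFinite.Build _ _ _ lebesgue2
  lebesgue2_sigma_finite.

Definition lebesgue4 : set (mplane2 R) -> \bar R :=
  (lebesgue2 \x lebesgue2)%E.

HB.instance Definition _ := Measure.on lebesgue4.

End Lebesgue.

Section Quotient.
Context {R : realType} (L : lattice R).

Definition lattice_rel (p q : cplane2 R) : bool :=
  `[< exists2 chi, lattice_set L chi & q = (p.1 + chi, p.2) >].

Let lattice0 : lattice_set L 0.
Proof. by case: L => S [e [_ /= ->]]; exists 0, 0; rewrite !mulr0z addr0. Qed.

Let latticeN chi : lattice_set L chi -> lattice_set L (- chi).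
Proof.
case: L => S [e [_ /= ->]] [m [n ->]]; exists (- m), (- n).
by rewrite !mulrNz opprD.
Qed.

Let latticeD chi chi' :
  lattice_set L chi -> lattice_set L chi' -> lattice_set L (chi + chi').
Proof.
case: L => S [e [_ /= ->]] [m [n ->]] [m' [n' ->]]; exists (m + m'), (n + n').
by rewrite !mulrzDr addrACA.
Qed.

Lemma lattice_rel_equiv : equiv_class_of lattice_rel.
Proof.
split.
- move=> p; apply/asboolP; exists 0; first exact: lattice0.
  by rewrite addr0 -surjective_pairing.
- suff sub p q : lattice_rel p q -> lattice_rel q p.
    by move=> p q; apply/idP/idP; exact: sub.
  move=> /asboolP[chi Lchi ->]; apply/asboolP; exists (- chi) => /=.
    exact: latticeN.
  by rewrite addrK -surjective_pairing.
- move=> q p r /asboolP[chi Lchi ->] /asboolP[chi' Lchi' ->] /=.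
  apply/asboolP; exists (chi + chi'); first exact: latticeD.
  by rewrite addrA.
Qed.

Canonical lattice_equiv := EquivRelPack lattice_rel_equiv.

Definition quotX : Type := quotient_topology {eq_quot lattice_equiv}.

HB.instance Definition _ :=
  Topological.copy quotX (quotient_topology {eq_quot lattice_equiv}).

Definition piX : cplane2 R -> quotX :=
  \pi_(quotient_topology {eq_quot lattice_equiv}).

Definition reprX : quotX -> cplane2 R :=
  @repr _ (quotient_topology {eq_quot lattice_equiv}).

HB.instance Definition _ := isPointed.Build quotX (piX 0).

(* Since piX is a covering map, this final sigma-algebra is the Borel
   sigma-algebra of the quotient topology. *)
Definition measurable_quotX : set (set quotX) :=
  [set A | measurable (piX @^-1` A : set (mplane2 R))].

Let measurable_quotX0 : measurable_quotX set0.
Proof. by rewrite /measurable_quotX /= preimage_set0. Qed.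

Let measurable_quotXC A : measurable_quotX A -> measurable_quotX (~` A).
Proof. by rewrite /measurable_quotX /= preimage_setC; exact: measurableC. Qed.

Let measurable_quotX_bigcup (F : (set quotX)^nat) :
  (forall i, measurable_quotX (F i)) -> measurable_quotX (\bigcup_i F i).
Proof.
move=> mF; rewrite /measurable_quotX /= preimage_bigcup.
exact: bigcupT_measurable.
Qed.

HB.instance Definition _ := isMeasurable.Build default_measure_display quotX
  measurable_quotX0 measurable_quotXC measurable_quotX_bigcup.

Lemma measurable_piX : measurable_fun [set: mplane2 R] piX.
Proof. by move=> _ A mA; rewrite setTI. Qed.

(* An arbitrary choice: dvolX does not depend on it, since any two fundamental
   domains give the same measure on the quotient. *)
Definition lattice_basis : cplane R * cplane R :=
  projT1 (cid (lattice_ex_basis L)).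

Definition fundamental_cell : set (cplane R) :=
  [set z | exists s t : R, [/\ 0 <= s < 1, 0 <= t < 1 &
    z = s *: lattice_basis.1 + t *: lattice_basis.2]].


Let cell_coord (u : cplane R) (d : R) (z : mplane R) : R :=
  d^-1 * (z.1 * u.2 - z.2 * u.1).

Let measurable_cell_coord u d :
  measurable_fun [set: mplane R] (cell_coord u d).
Proof.
apply: measurable_funM => //;
apply: measurable_funB; apply: measurable_funM => //.
Qed.

Lemma measurable_fundamental_cell :
  measurable (fundamental_cell : set (mplane R)).
Proof.
rewrite /fundamental_cell /lattice_basis.
case: cid => -[[a b] [c d]] [/= indep _].
pose D := a * d - b * c.
have D0 : D != 0.
  apply/eqP => D0.
  have e1 : d *: ((a, b) : cplane R) + (- b) *: ((c, d) : cplane R) = 0.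
    by congr pair; rewrite /= /GRing.scale /= ?/D; [rewrite -[RHS]D0 /D|]; ring.
  have e2 : (- c) *: ((a, b) : cplane R) + a *: ((c, d) : cplane R) = 0.
    by congr pair; rewrite /= /GRing.scale /=; [|rewrite -[RHS]D0 /D]; ring.
  have [_ /eqP] := indep _ _ e1; rewrite oppr_eq0 => /eqP b0.
  have [_ a0] := indep _ _ e2.
  have e3 : 1 *: ((a, b) : cplane R) + 0 *: ((c, d) : cplane R) = 0.
    by rewrite a0 b0; congr pair; rewrite /= /GRing.scale /=; ring.
  by have [/eqP] := indep _ _ e3; rewrite oner_eq0.
have coord1 s t : cell_coord (c, d) D (s *: (a, b) + t *: (c, d)) = s.
  rewrite /cell_coord /= /GRing.scale /=.
  rewrite (_ : _ - _ = D * s); last by rewrite /D; ring.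
  by rewrite mulKf.
have coord2 s t : cell_coord (a, b) (- D) (s *: (a, b) + t *: (c, d)) = t.
  rewrite /cell_coord /= /GRing.scale /=.
  rewrite (_ : _ - _ = - D * t); last by rewrite /D; ring.
  by rewrite mulKf// oppr_eq0.
have coordK (z : cplane R) : z = cell_coord (c, d) D z *: (a, b) +
                                 cell_coord (a, b) (- D) z *: (c, d).
  case: z => x y; rewrite /cell_coord /GRing.scale /= /GRing.scale /=.
  rewrite invrN; move: D^-1 (mulVf D0) => Di DiD.
  by congr pair; rewrite /= /GRing.scale /= -[LHS]mul1r -DiD /D; ring.
rewrite [X in measurable X](_ : _ =
    (cell_coord (c, d) D @^-1` `[0, 1[) `&`
    (cell_coord (a, b) (- D) @^-1` `[0, 1[)); last first.
  apply/seteqP; split=> [z [s [t [s01 t01 ->]]]|z [/= s01 t01]].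
    by split; rewrite /preimage /= in_itv /= ?coord1 ?coord2.
  exists (cell_coord (c, d) D z), (cell_coord (a, b) (- D) z).
  by split; [rewrite in_itv in s01|rewrite in_itv in t01|exact: coordK].
apply: measurableI; rewrite -[X in measurable X]setTI;
  exact: measurable_cell_coord.
Qed.

Lemma measurable_fundamental_domain :
  measurable (fundamental_cell `*` [set: cplane R] : set (mplane2 R)).
Proof.
by apply: measurableX => //; exact: measurable_fundamental_cell.
Qed.

(* The volume form of dz dzbar + dw dwbar upstairs is Lebesgue measure on R^4;
   each orbit meets the fundamental domain exactly once. *)
Definition dvolX : set quotX -> \bar R :=
  pushforward (mrestr (@lebesgue4 R) measurable_fundamental_domain) piX.

HB.instance Definition _ := Measure.copy dvolX
  (measure_function_pushforward__canonical__measure_function_Measure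
    (mrestr (@lebesgue4 R) measurable_fundamental_domain) measurable_piX).

End Quotient.

Arguments piX {R} L.
Arguments dvolX {R} L.

Section Distributions.
Context {R : realType} (L : lattice R).
Implicit Types (f h : quotX L -> R).

Definition sqnorm (w : cplane R) : R := w.1 ^+ 2 + w.2 ^+ 2.

(* w is constant on orbits, so the chosen representative does not matter. *)
Definition phiX (delta : R) (x : quotX L) : R :=
  (1 + sqnorm (reprX x).2) `^ (- delta - 1).

Fixpoint Cn (V : normedModType R) (n : nat) (g : V -> R) : Prop :=
  continuous g /\
  if n is m.+1 then
    forall v, (forall p, derivable g p v) /\ Cn m (fun p => 'D_v g p)
  else True.

Definition smooth (V : normedModType R) (g : V -> R) : Prop :=
  forall n, Cn n g.

Definition test_fun h : Prop :=
  smooth (h \o piX L) /\ compact (closure [set x | h x != 0]).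

Definition D2 (g : cplane2 R -> R) (v p : cplane2 R) : R :=
  'D_v (fun q => 'D_v g q) p.

(* d^2 / (dz dzbar) and d^2 / (dw dwbar), in real coordinates *)
Definition dzdzbar (g : cplane2 R -> R) (p : cplane2 R) : R :=
  4^-1 * (D2 g ((1, 0), 0) p + D2 g ((0, 1), 0) p).

Definition dwdwbar (g : cplane2 R -> R) (p : cplane2 R) : R :=
  4^-1 * (D2 g (0, (1, 0)) p + D2 g (0, (0, 1)) p).

(* The Kaehler form of dz dzbar + dw dwbar is
   (i/2) (dz /\ dzbar + dw /\ dwbar), so that
   Lambda (i dz /\ dzbar) = Lambda (i dw /\ dwbar) = 2, while Lambda kills the
   mixed terms of the complex Hessian. Hence - i Lambda d dbar is the operator
   below, i.e. one half of the nonnegative Laplacian of R^4. *)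
Definition flat_lap (g : cplane2 R -> R) (p : cplane2 R) : R :=
  - (2 * dzdzbar g p + 2 * dwdwbar g p).

Definition lapX h (x : quotX L) : R := flat_lap (h \o piX L) (reprX x).

(* A distribution on X is represented by its action on real test functions.
   The operator lapX is formally self-adjoint, so it is transposed onto the
   test function without a sign. *)
Definition distr_of f (h : quotX L -> R) : R :=
  \int[dvolX L]_x (f x * h x).

Definition distr_lap f (h : quotX L -> R) : R :=
  \int[dvolX L]_x (f x * lapX h x).

Definition distr_le (S T : (quotX L -> R) -> R) : Prop :=
  forall h, test_fun h -> (forall x, 0 <= h x) -> S h <= T h.

Definition distr_eq (S T : (quotX L -> R) -> R) : Prop :=
  forall h, test_fun h -> S h = T h.

Definition ess_bounded f : Prop :=
  measurable_fun [set: quotX L] f /\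
  exists M : R, {ae dvolX L, forall x, `|f x| <= M}.

End Distributions.

Arguments phiX {R} L delta x.

(* Main.v *)
(* The plane C_w is parabolic: cutoffs in log(1 + |w|^2) have Laplacians that
   tend to 0 in L^1(X). Testing lap f <= 0 against a multiple of such a cutoff
   plus or minus a test function makes f harmonic.

   For the bound, take c in C_w and test lap f <= B phiX against the product of a
   cutoff with the positive function
     ln S_0 - 2 / S_0 - ln S_c + ln S_0(c) + 4,  S_c(w) = 1 + |w - c|^2.
   Its Laplacian is at most - 4 / S_c^2 + O(phiX) and it is O(1 + ln S_0), so the
   integral of f over {|w - c| <= 1} is O(B + int f phiX) uniformly in c. Testing
   against the periodization of a truncation of the fundamental solution
   1 / (|p - q|^2 + r^2) of R^4 turns this into a bound for the averages of f over
   all small cubes, and hence for f almost everywhere. *)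

Require Import Defs.
From HB Require Import structures.
From mathcomp Require Import all_boot all_order all_algebra.
From mathcomp Require Import all_classical all_reals all_analysis.
From mathcomp Require Import ess_sup_inf measurable_realfun generic_quotient.
From mathcomp Require Import ring lra zify.
Import Order.TTheory GRing.Theory Num.Theory.
Import numFieldNormedType.Exports.
Local Open Scope classical_set_scope.
Local Open Scope ring_scope.
Set Implicit Arguments.
Unset Strict Implicit.
Unset Printing Implicit Defensive.

(** The obstacle is uniformity: the final constant may depend neither on the bound [M] of [f] nor on
    the centre [c]. Both enter only through terms containing derivatives of the cutoff, which are
    O(1/N) in L^1 and disappear in the limit. What survives is the integral of [phiX] times a
    logarithm, finite because [delta > 0] and bounded independently of [c].

    In the local step, 1 / (|p - q|^2 + r^2) has Laplacian - 8 r^2 (|p - q|^2 + r^2)^-3, of order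
    r^-4 on the cube of radius r, whereas its integral near q stays bounded as r tends to 0. The
    factor r^-4 is the normalization of an average over the cube, so the resulting bound is
    independent of r. Truncating the kernel adds an error that is also bounded independently of r;
    it is paid for by the integral of f over {|w - c| <= 1}.

    Since [f] is only a measurable function up to null sets, it cannot be evaluated at a point. The
    passage from averages to almost every point rests on outer regularity, Tonelli and Fatou. *)

(** * Directional derivatives and the classes [Cn] *)

Section Calculus.
Context {R : realType} {V : normedModType R}.
Implicit Types (f g : V -> R) (p v : V).

(** Only a directional derivative of [g] is given, so [g] need not be differentiable as a map on
    [V]. Restricting to the line [h *: v + p] reduces the claim to the chain rule in one
    variable. *)
Lemma is_derive_compr (phi : R -> R) g p v (dphi dg : R) :
  is_derive (g p) 1 phi dphi -> is_derive p v g dg ->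
  is_derive p v (phi \o g) (dphi * dg).
Proof.
have key (l : R -> R) q : l 0 = q -> derivable l 0 1 -> derivable phi q 1 ->
    derivable (phi \o l) 0 1 /\ 'D_1 (phi \o l) 0 = 'D_1 phi q * 'D_1 l 0.
  move=> <- l1 phi1; split; last first.
    by rewrite -!derive1E; exact: (derive1_comp l1 phi1).
  apply: (derivable1_diffP _ _).2; apply: differentiable_comp.
    exact: (derivable1_diffP _ _).1 l1.
  exact: (derivable1_diffP _ _).1 phi1.
have dE (F : V -> R) : 'D_v F p = 'D_1 (fun h : R => F (h *: v + p)) 0.
  rewrite /derive; set k1 := fun h => h^-1 *: _.
  set k2 := fun h => h^-1 *: _; suff -> : k1 = k2 by [].
  by rewrite funeqE /k1 /k2 => h /=; rewrite addr0 scale0r add0r [_%:A]mulr1.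
move=> [phi1 phiE] [/derivable1P g1 gE].
have g0 : g (0 *: v + p) = g p by rewrite scale0r add0r.
have [c1 cE] := key (fun h : R => g (h *: v + p)) _ g0 g1 phi1.
by split; [exact/derivable1P|rewrite dE cE phiE -gE dE].
Qed.

Lemma Cn_continuous n g : Cn n g -> continuous g.
Proof. by case: n => [|n] []. Qed.

Lemma CnS n g : Cn n.+1 g -> Cn n g.
Proof.
elim: n g => [|n IH] g [gc gd]; first by [].
by split=> // v; have [dg cg] := gd v; split=> //; exact: IH.
Qed.

Lemma Cn_cst n (c : R) : Cn n ((fun=> c) : V -> R).
Proof.
elim: n c => [|n IH] c /=.
  by split=> // x; exact: cvg_cst.
split; first by move=> x; exact: cvg_cst.
move=> v; split; first by move=> p; exact: derivable_cst.
suff -> : (fun p => 'D_v (fun=> c) p) = (fun=> 0) :> (V -> R) by exact: IH.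
by apply/funext => p; rewrite derive_cst.
Qed.

Lemma CnD n f g : Cn n f -> Cn n g -> Cn n (fun p => f p + g p).
Proof.
elim: n f g => [|n IH] f g [cf df] [cg dg].
  by split=> // x; apply: cvgD; [exact: cf|exact: cg].
split; first by move=> x; apply: cvgD; [exact: cf|exact: cg].
move=> v; have [f1 f2] := df v; have [g1 g2] := dg v; split.
  by move=> p; exact: derivableD.
rewrite (_ : (fun p => _) = fun p => 'D_v f p + 'D_v g p); first exact: IH.
by apply/funext => p; exact: (deriveD (f1 p) (g1 p)).
Qed.

Lemma CnM n f g : Cn n f -> Cn n g -> Cn n (fun p => f p * g p).
Proof.
elim: n f g => [|n IH] f g Cf Cg.
  split=> // x; apply: cvgM; [exact: (Cn_continuous Cf)|].
  exact: (Cn_continuous Cg).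
split; first by move=> x; apply: cvgM; [exact: (Cn_continuous Cf)|
  exact: (Cn_continuous Cg)].
move=> v; have [_ df] := Cf; have [_ dg] := Cg.
have [f1 f2] := df v; have [g1 g2] := dg v; split.
  by move=> p; exact: derivableM.
rewrite (_ : (fun p => _) = fun p => f p * 'D_v g p + g p * 'D_v f p).
  by apply: CnD; apply: IH => //; exact: CnS.
by apply/funext => p; exact: (deriveM (f1 p) (g1 p)).
Qed.

Lemma CnN n g : Cn n g -> Cn n (fun p => - g p).
Proof.
move=> Cg; rewrite (_ : (fun p => _) = fun p => (-1) * g p).
  by apply: CnM => //; exact: Cn_cst.
by apply/funext => p; rewrite mulN1r.
Qed.

Lemma CnB n f g : Cn n f -> Cn n g -> Cn n (fun p => f p - g p).
Proof. by move=> Cf Cg; apply: CnD => //; exact: CnN. Qed.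

(* A family of functions of one variable, closed under differentiation on the
   set A, stays smooth after composition with a smooth g valued in A. *)
Lemma Cn_comp (I : Type) (phi : I -> R -> R) (A : set R)
    (der : I -> seq (R * I)) :
  (forall i x, A x ->
    is_derive x 1 (phi i) (\sum_(c <- der i) c.1 * phi c.2 x)) ->
  forall n g i, (forall p, A (g p)) -> Cn n g -> Cn n (phi i \o g).
Proof.
move=> dphi n g + gA; elim: n => [|n IH] i Cg.
  split=> // x; apply: continuous_comp; first exact: (Cn_continuous Cg).
  by apply/differentiable_continuous/derivable1_diffP; case: (dphi i _ (gA x)).
have gc := Cn_continuous Cg; have [_ dg] := Cg; split.
  move=> x; apply: continuous_comp; first exact: gc.
  by apply/differentiable_continuous/derivable1_diffP; case: (dphi i _ (gA x)).
move=> v; have [g1 g2] := dg v.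
have dc p : is_derive p v (phi i \o g)
    ((\sum_(c <- der i) c.1 * phi c.2 (g p)) * 'D_v g p).
  by apply: is_derive_compr; [exact: dphi|exact/derivableP].
split; first by move=> p; case: (dc p).
rewrite (_ : (fun p => _) =
    fun p => (\sum_(c <- der i) c.1 * phi c.2 (g p)) * 'D_v g p); last first.
  by apply/funext => p; case: (dc p).
apply: CnM => //; elim: (der i) => [|c s IHs].
  rewrite (_ : (fun p => _) = fun=> 0); first exact: Cn_cst.
  by apply/funext => p; rewrite big_nil.
rewrite (_ : (fun p => _) = fun p => c.1 * (phi c.2 \o g) p +
    \sum_(d <- s) d.1 * phi d.2 (g p)); last first.
  by apply/funext => p; rewrite big_cons.
apply: CnD => //; apply: CnM; first exact: Cn_cst.
by apply: IH; exact: CnS.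
Qed.

Lemma Cn_inv n g : (forall p, 0 < g p) -> Cn n g -> Cn n (fun p => (g p)^-1).
Proof.
move=> g0 Cg.
pose iv := fun x : R => x^-1.
suff H : Cn n ((iv ^+ 1 : R -> R) \o g).
  by move: H; congr Cn; apply/funext => p /=; rewrite expr1.
(* The closed family consists of the powers x^-k on x > 0: the derivative of the k-th is [- k] times
   the next. *)
apply: (@Cn_comp nat (fun k => iv ^+ k) [set x | 0 < x]
  (fun k => [:: (- k%:R, k.+1)])) => // k x /= x0.
have dv : is_derive x 1 iv (- x ^- 2).
  have := @is_deriveV R id x 1 1; rewrite /= /GRing.scale /= mulr1; apply.
  by rewrite gt_eqF.
apply: is_derive_eq (is_deriveX k dv) _.
rewrite big_seq1 /= /GRing.scale /= !fctE /iv.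
case: k => [|k]; first by rewrite mulr0n oppr0 !mul0r.
rewrite -mulr_natl exprVn !exprS /=.
have xn : x != 0 by rewrite gt_eqF.
have xk : x ^+ k != 0 by rewrite expf_neq0.
by rewrite !exprVn expr0; field; rewrite xk.
Qed.

Lemma Cn_ln n g : (forall p, 0 < g p) -> Cn n g -> Cn n (fun p => ln (g p)).
Proof.
case: n => [|n] g0 Cg.
  split=> // x; apply: continuous_comp; first exact: (Cn_continuous Cg).
  exact: continuous_ln.
split.
  move=> x; apply: continuous_comp; first exact: (Cn_continuous Cg).
  exact: continuous_ln.
have [_ dg] := Cg.
move=> v; have [g1 g2] := dg v.
have dc p : is_derive p v (@ln R \o g) ((g p)^-1 * 'D_v g p).
  by apply: is_derive_compr; [exact: is_derive1_ln|exact/derivableP].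
split; first by move=> p; case: (dc p).
rewrite (_ : (fun p => _) = fun p => (g p)^-1 * 'D_v g p); last first.
  by apply/funext => p; case: (dc p).
by apply: CnM => //; apply: Cn_inv => //; exact: CnS.
Qed.

(** Continuity and derivatives depend on the germ alone. This serves for the periodized kernel,
    which agrees with a single smooth kernel only near each point. *)
Lemma Cn_local n g :
  (forall p, exists2 f, Cn n f & \forall q \near p, f q = g q) -> Cn n g.
Proof.
elim: n g => [|n IH] g H.
  split=> // p; have [f [fc _] fg] := H p.
  have fgp : f p = g p := nbhs_singleton fg.
  rewrite /continuous_at -fgp.
  by apply: cvg_trans (fc p); exact: near_eq_cvg.
split.
  move=> p; have [f [fc _] fg] := H p.
  have fgp : f p = g p := nbhs_singleton fg.
  rewrite /continuous_at -fgp.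
  by apply: cvg_trans (fc p); exact: near_eq_cvg.
move=> v; split.
  move=> p; have [f [_ fd] fg] := H p.
  apply: near_eq_derivable; first exact: fg.
  by have [] := fd v.
apply: IH => p; have [f [_ fd] fg] := H p.
exists ('D_v f); first by have [] := fd v.
near=> q; apply: near_eq_derive.
near: q; have := nbhs_interior fg; apply: filterS => q; exact.
Unshelve. all: by end_near. Qed.

Lemma is_derive_affine (l : V -> R) p v :
  (forall (h : R) u q, l (h *: u + q) = h * l u + l q) -> is_derive p v l (l v).
Proof.
move=> lD.
suff H : (fun h => h^-1 *: ((l \o shift p) (h *: v) - l p)) @ 0^' --> l v.
  by split; [apply/cvg_ex; exists (l v)|rewrite /derive; exact: cvg_lim].
apply: (@cvg_trans _ ((fun=> l v) @ (0 : R)^')); last exact: cvg_cst.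
apply: near_eq_cvg; near=> h.
have h0 : h != 0 by near: h; exact: nbhs_dnbhs_neq.
by rewrite /= lD addrK /GRing.scale /= mulKf.
Unshelve. all: by end_near. Qed.

Lemma Cn_affine n (l : V -> R) : continuous l ->
  (forall (h : R) u q, l (h *: u + q) = h * l u + l q) -> Cn n l.
Proof.
move=> cl lD; case: n => [|n]; first by split.
split=> // v; have d p := is_derive_affine p v lD.
split; first by move=> p; case: (d p).
rewrite (_ : (fun p => _) = fun=> l v); first exact: Cn_cst.
by apply/funext => p; case: (d p).
Qed.

End Calculus.

(** * The flat functions t^-k exp(-1/t) and a smooth convex truncation *)

Section Flat.
Context {R : realType}.
Implicit Types t x : R.

(** The index [k] makes the family closed under differentiation, which is the form that [Cn_comp]
    asks for. [flat 0] is the usual smooth function vanishing on t <= 0. *)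
Definition flat (k : nat) t : R := if 0 < t then t ^- k * expR (- t^-1) else 0.

Lemma flat_ge0 k t : 0 <= flat k t.
Proof.
rewrite /flat; case: ifPn => // t0.
by rewrite mulr_ge0 ?expR_ge0 // invr_ge0 exprn_ge0 // ltW.
Qed.

Lemma flat_eq0 k t : t <= 0 -> flat k t = 0.
Proof. by move=> t0; rewrite /flat ltNge t0. Qed.

Lemma mul_flat k t : t * flat k.+1 t = flat k t.
Proof.
rewrite /flat; case: ifPn => [t0|_]; last by rewrite mulr0.
by rewrite exprS invfM !mulrA divff ?gt_eqF // mul1r.
Qed.

(** This is the k-th power of [y / k <= 1 + y / k <= expR (y / k)]. With y = 1/t it gives the
    explicit bound k^k for [flat k], the origin of most numerical constants below. *)
Lemma exprn_le_expR k (y : R) : 0 <= y -> y ^+ k <= k%:R ^+ k * expR y.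
Proof.
move=> y0; case: k => [|k].
  by rewrite !expr0 mul1r -expR0 ler_expR.
have k0 : 0 < k.+1%:R :> R by rewrite ltr0n.
have -> : y = k.+1%:R * (y / k.+1%:R) by rewrite mulrC divfK // gt_eqF.
rewrite expRM_natl exprMn ler_wpM2l ?exprn_ge0 ?ler0n //.
apply: lerXn2r.
- by rewrite nnegrE divr_ge0 ?ler0n.
- by rewrite nnegrE expR_ge0.
- by apply: le_trans (expR_ge1Dx _); rewrite lerDr.
Qed.

Lemma flat_le k t : flat k t <= k%:R ^+ k.
Proof.
rewrite /flat; case: ifPn => [t0|_]; last by rewrite exprn_ge0.
rewrite -exprVn expRN ler_pdivrMr ?expR_gt0 //.
by apply: exprn_le_expR; rewrite invr_ge0 ltW.
Qed.

Lemma flat0_le1 t : flat 0 t <= 1.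
Proof. by have := flat_le 0 t. Qed.

Lemma flat_norm_le k t : `|flat k t| <= k%:R ^+ k.
Proof. by rewrite ger0_norm ?flat_ge0 // flat_le. Qed.

Lemma is_derive_flat k t :
  is_derive t 1 (flat k) (flat k.+2 t - k%:R * flat k.+1 t).
Proof.
have [t0|t0|->] := ltgtP t 0.
- apply: (@near_eq_is_derive _ _ _ (fun=> 0)).
    near=> x; rewrite flat_eq0 ?ltW //.
    by near: x; exact: lt_nbhsl.
  rewrite !flat_eq0 ?(ltW t0) // mulr0 subr0; exact: is_derive_cst.
- pose iv := fun x : R => x^-1.
  apply: (@near_eq_is_derive _ _ _ (iv ^+ k * (expR \o (- iv)))).
    near=> x; rewrite /flat ifT; first by rewrite !fctE /iv exprVn.
    by near: x; exact: lt_nbhsr.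
  have tn : t != 0 by rewrite gt_eqF.
  have dv : is_derive t 1 iv (- t ^- 2).
    have := @is_deriveV R id t 1 1; rewrite /= /GRing.scale /= mulr1; apply.
    by rewrite gt_eqF.
  apply: is_derive_eq.
  rewrite /flat t0 /GRing.scale /= !fctE /iv.
  case: k => [|k].
    rewrite !mul0r mulr0 addr0 subr0 expr0 mul1r opprK mulrC; congr (_ * _).
  rewrite -mulr_natl !exprVn !exprS.
  have tk : t ^+ k != 0 by rewrite expf_neq0.
  by field; rewrite tk.
- rewrite !flat_eq0 // mulr0 subr0.
  suff H : (fun h => h^-1 *: ((flat k \o shift 0) (h *: 1) - flat k 0)) @ 0^'
      --> (0 : R).
    split; first by apply/cvg_ex; exists 0.
    by rewrite /derive; exact: cvg_lim.
  apply/cvgrPdist_le => e e0.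
  have K0 : 0 < k.+2%:R ^+ k.+2 :> R by rewrite exprn_gt0.
  have d0 : 0 < e / k.+2%:R ^+ k.+2 by rewrite divr_gt0.
  near=> h; rewrite sub0r normrN /= (flat_eq0 _ (lexx 0)) subr0 addr0.
  (* At the origin [flat k h] equals [h ^+ 2 * flat k.+2 h], so the difference quotient is [h] times
     a bounded factor. *)
  rewrite [h *: 1]mulr1 -mul_flat -mul_flat.
  have h0 : h != 0 by near: h; exact: nbhs_dnbhs_neq.
  rewrite /GRing.scale /= (mulKf h0).
  rewrite normrM (le_trans (ler_wpM2l _ (flat_norm_le k.+2 h))) //.
  rewrite -ler_pdivlMr //.
  near: h; apply: dnbhs0_le; exact: d0.
Unshelve. all: by end_near. Qed.

(* [Theta t = t exp(-1/t)] is convex, with derivative between 0 and 1: it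
   truncates a function from below while preserving subharmonicity. *)
Definition Theta t : R := t * flat 0 t.

Lemma is_derive_Theta t : is_derive t 1 Theta (flat 0 t + flat 1 t).
Proof.
have d := is_derive_flat 0 t.
have := @is_deriveM _ _ id (flat 0) t 1 _ _ (is_derive_id _ _) d.
move=> /is_derive_eq; apply.
by rewrite /GRing.scale /= mul0r subr0 mulr1 mul_flat addrC.
Qed.

Lemma is_derive_dTheta t :
  is_derive t 1 (fun x => flat 0 x + flat 1 x) (flat 3 t).
Proof.
have d0 := is_derive_flat 0 t; have d1 := is_derive_flat 1 t.
have := @is_deriveD _ _ _ (flat 0) (flat 1) t 1 _ _ d0 d1.
by move=> /is_derive_eq; apply; ring.
Qed.

Lemma Theta_ge0 t : 0 <= Theta t.
Proof.
rewrite /Theta /flat; case: ifPn => t0; rewrite ?mulr0 //.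
by rewrite !mulr_ge0 ?expR_ge0 ?invr_ge0 ?exprn_ge0 // ltW.
Qed.

Lemma Theta_eq0 t : t <= 0 -> Theta t = 0.
Proof. by move=> t0; rewrite /Theta flat_eq0 // mulr0. Qed.

Lemma Theta_le t : 0 <= t -> Theta t <= t.
Proof.
by move=> t0; rewrite /Theta -[leRHS]mulr1 ler_wpM2l // flat0_le1.
Qed.

Context {V : normedModType R}.

Lemma Cn_flat n k (g : V -> R) : Cn n g -> Cn n (fun p => flat k (g p)).
Proof.
move=> Cg; apply: (@Cn_comp _ _ nat flat setT
  (fun k => [:: (1, k.+2); (- k%:R, k.+1)])) => // i x _.
apply: is_derive_eq (is_derive_flat i x) _.
by rewrite big_cons big_seq1 /= mul1r mulNr.
Qed.

Lemma Cn_Theta n (g : V -> R) : Cn n g -> Cn n (fun p => Theta (g p)).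
Proof. by move=> Cg; apply: CnM => //; exact: Cn_flat. Qed.

End Flat.

(** * Gradients and Laplacians on R^4 *)

Section Laplacian.
Context {R : realType}.
Local Notation V := (cplane2 R).
Implicit Types (f g : V -> R) (p q : V).

(** Indices are natural numbers, and from 4 on the coordinate is the constant 0: continuity,
    linearity and measurability then hold for every index. *)
Definition coord4 (i : nat) p : R := nth 0 [:: p.1.1; p.1.2; p.2.1; p.2.2] i.

Definition dir4 (i : nat) : V :=
  nth 0 [:: ((1, 0), 0); ((0, 1), 0); (0, (1, 0)); (0, (0, 1))] i.

Lemma continuous_coord i : continuous (coord4 i).
Proof.
have f1 : continuous (fst : V -> cplane R) by move=> x; exact: cvg_fst.
have f2 : continuous (snd : V -> cplane R) by move=> x; exact: cvg_snd.
have g1 : continuous (fst : cplane R -> R) by move=> x; exact: cvg_fst.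
have g2 : continuous (snd : cplane R -> R) by move=> x; exact: cvg_snd.
case: i => [|[|[|[|i]]]] p.
- exact: (continuous_comp (f1 p) (g1 p.1)).
- exact: (continuous_comp (f1 p) (g2 p.1)).
- exact: (continuous_comp (f2 p) (g1 p.2)).
- exact: (continuous_comp (f2 p) (g2 p.2)).
rewrite (_ : coord4 _ = fun=> 0); first exact: cvg_cst.
by apply/funext => x; rewrite /coord4 /= nth_nil.
Qed.

Lemma coord_affine i (h : R) u q :
  coord4 i (h *: u + q) = h * coord4 i u + coord4 i q.
Proof.
rewrite /coord4; case: i => [|[|[|[|i]]]] //=.
by rewrite !nth_nil mulr0 addr0.
Qed.

Lemma coord_dir i j : (i < 4)%N -> (j < 4)%N -> coord4 i (dir4 j) = (i == j)%:R.
Proof. by case: i => [|[|[|[|i]]]] //; case: j => [|[|[|[|j]]]]. Qed.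

(* [lapd g G L]: the gradient of g is G and its Laplacian (the sum of the pure
   second derivatives) is L. *)
Definition lapd g (G : nat -> V -> R) (L : V -> R) :=
  exists H : nat -> V -> R,
  (forall i, (i < 4)%N -> forall p, is_derive p (dir4 i) g (G i p) /\
     is_derive p (dir4 i) (G i) (H i p)) /\
  forall p, L p = \sum_(i < 4) H i p.

Lemma lapd_D2 g G L i p : lapd g G L -> (i < 4)%N ->
  exists H : nat -> V -> R,
  (forall i, (i < 4)%N -> forall p, D2 g (dir4 i) p = H i p) /\
  forall p, L p = \sum_(i < 4) H i p.
Proof.
move=> [H [gG LH]] i4; exists H; split=> // j j4 q.
rewrite /D2 (_ : (fun q => 'D_(dir4 j) g q) = G j); first by have [_ []] := gG j j4 q.
by apply/funext => x; have [[]] := gG j j4 x.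
Qed.

Lemma flat_lapE g G L p : lapd g G L -> flat_lap g p = - (L p / 2).
Proof.
move=> gGL; have [H [gH ->]] := lapd_D2 p gGL (ltn0Sn 3).
rewrite !big_ord_recl big_ord0 /=.
rewrite -(gH 0%N) // -(gH 1%N) // -(gH 2%N) // -(gH 3%N) //=.
rewrite /flat_lap /dzdzbar /dwdwbar /dir4 /=.
move: (D2 g _ p) (D2 g _ p) (D2 g _ p) (D2 g _ p) => A B C D.
by rewrite addr0; field.
Qed.

Lemma eq_lapd g G L g' G' L' : lapd g G L ->
  g =1 g' -> (forall i p, (i < 4)%N -> G i p = G' i p) -> L =1 L' ->
  lapd g' G' L'.
Proof.
move=> [H [gG LH]] /funext <- GG /funext <-; exists H; split=> // i i4 p.
suff <- : G i = G' i by exact: gG.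
by apply/funext => x; exact: GG.
Qed.

Lemma lapd_cst (c : R) : lapd (fun=> c) (fun=> fun=> 0) (fun=> 0).
Proof.
exists (fun=> fun=> 0); split; last by move=> p; rewrite big1.
by move=> i _ p; split; exact: is_derive_cst.
Qed.

Lemma lapdD f F K g G L : lapd f F K -> lapd g G L ->
  lapd (fun p => f p + g p) (fun i p => F i p + G i p) (fun p => K p + L p).
Proof.
move=> [A [fA KA]] [B [gB LB]]; exists (fun i p => A i p + B i p); split.
  by move=> i i4 p; have [f1 f2] := fA i i4 p; have [g1 g2] := gB i i4 p;
    split; apply: is_deriveD.
by move=> p; rewrite KA LB big_split.
Qed.

Lemma lapdM f F K g G L : lapd f F K -> lapd g G L ->
  lapd (fun p => f p * g p) (fun i p => f p * G i p + g p * F i p)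
   (fun p => f p * L p + g p * K p + 2 * \sum_(i < 4) F i p * G i p).
Proof.
move=> [A [fA KA]] [B [gB LB]].
exists (fun i p => f p * B i p + g p * A i p + 2 * (F i p * G i p)); split.
  move=> i i4 p; have [f1 f2] := fA i i4 p; have [g1 g2] := gB i i4 p; split.
    exact: is_derive_eq (is_deriveM f1 g1) _.
  apply: is_derive_eq (is_deriveD (is_deriveM f1 g2) (is_deriveM g1 f2)) _.
  by rewrite /GRing.scale /=; ring.
move=> p; rewrite KA LB !big_split /= -!mulr_sumr //.
Qed.

Lemma lapdZ (c : R) g G L : lapd g G L ->
  lapd (fun p => c * g p) (fun i p => c * G i p) (fun p => c * L p).
Proof.
move=> gGL; apply: eq_lapd (lapdM (lapd_cst c) gGL) _ _ _ => //.
  by move=> i p i4; rewrite mulr0 addr0.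
move=> p /=; rewrite mulr0 addr0 big1 ?mulr0 ?addr0 // => i _.
by rewrite mul0r.
Qed.

(** The outer function is differentiated only at values of [g], which admits the logarithm and the
    inverse of positive functions. *)
Lemma lapd_comp (phi dphi ddphi : R -> R) g G L :
  (forall p, is_derive (g p) 1 phi (dphi (g p))) ->
  (forall p, is_derive (g p) 1 dphi (ddphi (g p))) -> lapd g G L ->
  lapd (fun p => phi (g p)) (fun i p => dphi (g p) * G i p)
   (fun p => ddphi (g p) * (\sum_(i < 4) G i p ^+ 2) + dphi (g p) * L p).
Proof.
move=> d1 d2 [H [gH LH]].
exists (fun i p => ddphi (g p) * G i p ^+ 2 + dphi (g p) * H i p); split.
  move=> i i4 p; have [g1 g2] := gH i i4 p; split.
    exact: (is_derive_compr (d1 p) g1).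
  apply: is_derive_eq (is_deriveM (is_derive_compr (d2 p) g1) g2) _.
  by rewrite /GRing.scale /=; ring.
by move=> p; rewrite LH big_split /= -!mulr_sumr.
Qed.

(** One family for both radial variables of the proof: weights 0, 0, 1, 1 with [b = 1] give 1 + |w -
    c|^2, and weights 1 with [b = e] give the regularized squared distance in R^4. *)
Definition quad (a : nat -> R) (b : R) (c p : V) : R :=
  b + \sum_(i < 4) a i * (coord4 i p - coord4 i c) ^+ 2.

Lemma is_derive_coordB i j (c : V) p : (i < 4)%N -> (j < 4)%N ->
  is_derive p (dir4 j) (fun p => coord4 i p - coord4 i c) (i == j)%:R.
Proof.
move=> i4 j4; have d : is_derive p (dir4 j) (coord4 i) (coord4 i (dir4 j)).
  exact: (is_derive_affine _ _ (coord_affine i)).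
have := is_deriveB d (is_derive_cst (coord4 i c) p (dir4 j)).
by rewrite subr0 coord_dir.
Qed.

Lemma lapd_quad a b c :
  lapd (quad a b c) (fun i p => 2 * a i * (coord4 i p - coord4 i c))
   (fun=> 2 * \sum_(i < 4) a i).
Proof.
exists (fun i => fun=> 2 * a i); split; last by move=> p; rewrite mulr_sumr.
move=> i i4 p; split; last first.
  apply: is_derive_eq (is_deriveZ (2 * a i) (is_derive_coordB c p i4 i4)) _.
  by rewrite eqxx /GRing.scale /= mulr1.
have sq (j : 'I_4) := is_deriveM (is_derive_coordB c p (ltn_ord j) i4)
  (is_derive_coordB c p (ltn_ord j) i4).
have := is_deriveD (is_derive_cst b p (dir4 i))
  (is_derive_sum (fun j => is_deriveZ (a j) (sq j))).
set F := (X in is_derive _ _ X _); set D := (X in is_derive _ _ _ X).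
have -> : F = quad a b c.
  apply/funext => x; rewrite /F /quad fctE; congr (_ + _).
  by rewrite fct_sumE; apply: eq_bigr => j _; rewrite expr2.
move=> /is_derive_eq; apply; rewrite /D add0r (bigD1 (Ordinal i4)) //= eqxx.
rewrite big1 => [|j /negbTE ji]; first by rewrite /GRing.scale /=; ring.
have -> : (j == i :> nat) = false by rewrite -[i]/(val (Ordinal i4)).
by rewrite /GRing.scale /= !mulr0 addr0 mulr0.
Qed.

Lemma smooth_quad a b c : smooth (quad a b c).
Proof.
move=> n; apply: CnD; first exact: Cn_cst.
have sq i : Cn n (fun p => a i * (coord4 i p - coord4 i c) ^+ 2).
  have cB : Cn n (fun p => coord4 i p - coord4 i c).
    apply: CnB; last exact: Cn_cst.
    by apply: Cn_affine; [exact: continuous_coord|exact: coord_affine].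
  by apply: CnM; [exact: Cn_cst|exact: CnM].
rewrite (_ : (fun p => _) = fun p => a 0 * (coord4 0 p - coord4 0 c) ^+ 2 +
  (a 1 * (coord4 1 p - coord4 1 c) ^+ 2 + (a 2 * (coord4 2 p - coord4 2 c) ^+ 2 +
    a 3 * (coord4 3 p - coord4 3 c) ^+ 2))).
  by apply: (CnD (sq 0%N)); apply: (CnD (sq 1%N)); exact: (CnD (sq 2%N) (sq 3%N)).
by apply/funext => p; rewrite !big_ord_recl big_ord0 addr0.
Qed.

End Laplacian.

(** * Real coordinates in a lattice basis *)

Section LatticeCoordinates.
Context {R : realType} (L : lattice R).
Local Notation e := (lattice_basis L).

Lemma lattice_basisP : basis_of_lattice (lattice_set L) e.
Proof. by rewrite /lattice_basis; case: cid. Qed.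

Lemma lattice_coordinates : exists s t : cplane R -> R, [/\
  forall z, z = s z *: e.1 + t z *: e.2,
  forall a b, s (a *: e.1 + b *: e.2) = a,
  forall a b, t (a *: e.1 + b *: e.2) = b &
  exists2 C, 0 < C & forall z, `|s z| <= C * `|z| /\ `|t z| <= C * `|z|].
Proof.
have [indep _] := lattice_basisP.
move: indep; case: e => -[a b] [c d] /= indep.
pose D := a * d - b * c.
have D0 : D != 0.
  (* If the determinant vanished, the rows of the adjugate matrix would be linear relations between
     the basis vectors. Independence then kills all the entries, so the first basis vector is 0. *)
  apply/eqP => D0.
  have e1 : d *: ((a, b) : cplane R) + (- b) *: ((c, d) : cplane R) = 0.
    by congr pair; rewrite /= /GRing.scale /= ?/D; [rewrite -[RHS]D0 /D|]; ring.
  have e2 : (- c) *: ((a, b) : cplane R) + a *: ((c, d) : cplane R) = 0.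
    by congr pair; rewrite /= /GRing.scale /=; [|rewrite -[RHS]D0 /D]; ring.
  have [_ /eqP] := indep _ _ e1; rewrite oppr_eq0 => /eqP b0.
  have [_ a0] := indep _ _ e2.
  have e3 : 1 *: ((a, b) : cplane R) + 0 *: ((c, d) : cplane R) = 0.
    by rewrite a0 b0; congr pair; rewrite /= /GRing.scale /=; ring.
  by have [/eqP] := indep _ _ e3; rewrite oner_eq0.
exists (fun z => (z.1 * d - z.2 * c) / D), (fun z => (z.2 * a - z.1 * b) / D).
split.
- case=> x y; congr pair; rewrite /= /GRing.scale /= /D; field;
    by move: D0; rewrite /D.
- move=> x y; rewrite /= /GRing.scale /= /D; field; by move: D0; rewrite /D.
- move=> x y; rewrite /= /GRing.scale /= /D; field; by move: D0; rewrite /D.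
exists ((`|a| + `|b| + `|c| + `|d| + 1) / `|D|).
  by rewrite divr_gt0 ?normr_gt0 // ltr_wpDl // !addr_ge0.
move=> z; have z1 : `|z.1| <= `|z| by rewrite prod_normE le_max lexx.
have z2 : `|z.2| <= `|z| by rewrite prod_normE le_max lexx orbT.
have H (u v : R) : `|u| + `|v| <= `|a| + `|b| + `|c| + `|d| + 1 ->
    forall x y : R, `|x| <= `|z| -> `|y| <= `|z| -> `|(x * u - y * v) / D| <=
      (`|a| + `|b| + `|c| + `|d| + 1) / `|D| * `|z|.
  move=> uv x y xz yz; rewrite normrM normfV mulrAC ler_pM2r ?invr_gt0 ?normr_gt0 //.
  rewrite (le_trans (ler_normB _ _)) // !normrM.
  rewrite (@le_trans _ _ ((`|u| + `|v|) * `|z|)) ?ler_wpM2r //.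
  by rewrite mulrDl lerD // mulrC ler_wpM2l.
by split; apply: H => //; have := normr_ge0 a; have := normr_ge0 b;
  have := normr_ge0 c; have := normr_ge0 d; lra.
Qed.

Lemma lattice_setP chi : lattice_set L chi <->
  exists m n : int, chi = m%:~R *: e.1 + n%:~R *: e.2.
Proof.
have [_ ->] := lattice_basisP; split=> -[m [n ->]]; exists m, n;
  by rewrite !scaler_int.
Qed.

Lemma lattice_set0 : lattice_set L 0.
Proof. by apply/lattice_setP; exists 0, 0; rewrite !scale0r addr0. Qed.

Lemma lattice_setN chi : lattice_set L chi -> lattice_set L (- chi).
Proof.
move=> /lattice_setP[m [n ->]]; apply/lattice_setP; exists (- m), (- n).
by rewrite !intrN !scaleNr opprD.
Qed.

Lemma lattice_setD chi chi' : lattice_set L chi -> lattice_set L chi' ->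
  lattice_set L (chi + chi').
Proof.
move=> /lattice_setP[m [n ->]] /lattice_setP[m' [n' ->]]; apply/lattice_setP.
by exists (m + m'), (n + n'); rewrite !intrD !scalerDl addrACA.
Qed.

(** The coordinates are bounded by [C] times the norm, so a lattice vector shorter than 1/C has
    integer coordinates of absolute value less than 1. *)
Lemma lattice_discrete : exists2 r : R, 0 < r &
  forall chi, lattice_set L chi -> `|chi| < r -> chi = 0.
Proof.
have [s [t [_ sE tE [C C0 stC]]]] := lattice_coordinates.
exists C^-1; first by rewrite invr_gt0.
move=> chi /lattice_setP[m [n ->]]; set z := (_ + _) => zr.
have [] := stC z; rewrite sE tE => sz tz.
have Cz : C * `|z| < 1 by rewrite mulrC -ltr_pdivlMr // mul1r.
have int0 (k : int) : `|k%:~R : R| < 1 -> k = 0.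
  rewrite -intr_norm (_ : 1 = 1%:~R) // ltr_int.
  by move=> k1; apply/eqP; rewrite -normr_le0 -ltzD1 add0r.
rewrite /z (int0 m) ?(le_lt_trans sz) // (int0 n) ?(le_lt_trans tz) //.
by rewrite !scale0r addr0.
Qed.

Lemma fundamental_cell_translate z :
  exists2 chi, lattice_set L chi & fundamental_cell L (z + chi).
Proof.
have [s [t [zE _ _ _]]] := lattice_coordinates.
exists ((- Num.floor (s z))%:~R *: e.1 + (- Num.floor (t z))%:~R *: e.2).
  by apply/lattice_setP; exists (- Num.floor (s z)), (- Num.floor (t z)).
exists (s z - (Num.floor (s z))%:~R), (t z - (Num.floor (t z))%:~R).
have fl (x : R) : 0 <= x - (Num.floor x)%:~R < 1.
  have /andP[] := real_floor_itv (num_real x); rewrite intrD => a b.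
  by apply/andP; split; lra.
split=> //; rewrite {1}(zE z) !intrN !scaleNr !scalerBl.
by rewrite addrACA.
Qed.

End LatticeCoordinates.

(** * The quotient X: periodic functions, compactness, test functions *)

Section QuotientTopology.
Context {R : realType} (L : lattice R).
Local Notation V := (cplane2 R).

Definition translate (chi : cplane R) (p : V) : V := (p.1 + chi, p.2).

Definition lattice_periodic (T : Type) (g : V -> T) :=
  forall chi p, lattice_set L chi -> g (translate chi p) = g p.

Lemma piX_translate chi p :
  lattice_set L chi -> piX L (translate chi p) = piX L p.
Proof.
move=> Lchi; apply/eqmodP; rewrite /=; apply/asboolP.
exists (- chi); first exact: lattice_setN.
by rewrite /translate /= addrK -surjective_pairing.
Qed.

Lemma piX_eqP p q : piX L p = piX L q ->
  exists2 chi, lattice_set L chi & q = translate chi p.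
Proof. by move=> /eqmodP /asboolP. Qed.

Lemma reprXK x : piX L (reprX x) = x.
Proof. exact: reprK. Qed.

Lemma piX_surj x : exists2 p : V, fundamental_cell L p.1 & piX L p = x.
Proof.
have [chi Lchi cellp] := fundamental_cell_translate L (reprX x).1.
exists (translate chi (reprX x)) => //.
by rewrite piX_translate // reprXK.
Qed.

(** [reprX] picks an arbitrary point of the orbit, which a periodic function cannot distinguish.
    Hence functions on X can be built as periodic functions upstairs composed with [reprX]. *)
Lemma periodic_repr T (g : V -> T) p :
  lattice_periodic g -> g (reprX (piX L p)) = g p.
Proof.
move=> pg; have [chi Lchi ->] := piX_eqP (esym (reprXK (piX L p))).
by rewrite pg.
Qed.

Lemma periodic_reprK T (g : V -> T) : lattice_periodic g -> g \o @reprX R L \o piX L = g.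
Proof. by move=> pg; apply/funext => p; exact: periodic_repr. Qed.

Lemma periodic_comp_piX T (h : quotX L -> T) : lattice_periodic (h \o piX L).
Proof. by move=> chi p Lchi /=; rewrite piX_translate. Qed.

Lemma snd_periodic T (g : cplane R -> T) : lattice_periodic (g \o snd).
Proof. by []. Qed.

Lemma repr_snd p : (reprX (piX L p)).2 = p.2.
Proof. exact: (periodic_repr p (snd_periodic id)). Qed.

Lemma derive_translate (g : V -> R) v p chi :
  'D_v g (translate chi p) = 'D_v (g \o translate chi) p.
Proof.
rewrite /derive; apply: f_equal; apply: (f_equal (fun k => fmap k _)).
apply/funext => h; rewrite /=; congr (_ *: (g _ - _)).
by rewrite /translate /=; congr pair; rewrite /= ?addrA.
Qed.

Lemma periodic_derive (g : V -> R) v : lattice_periodic g -> lattice_periodic ('D_v g).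
Proof.
move=> pg chi p Lchi; rewrite derive_translate.
rewrite (_ : g \o translate chi = g) //.
by apply/funext => q; exact: pg.
Qed.

Lemma periodic_flat_lap (g : V -> R) : lattice_periodic g -> lattice_periodic (flat_lap g).
Proof.
move=> pg chi p Lchi.
have d : D2 g ^~ (translate chi p) = D2 g ^~ p.
  by apply/funext => v; apply: periodic_derive => //; exact: periodic_derive.
exact: (f_equal (fun k : V -> R =>
  - (2 * (4^-1 * (k ((1, 0), 0) + k ((0, 1), 0))) +
     2 * (4^-1 * (k (0, (1, 0)) + k (0, (0, 1)))))) d).
Qed.

Lemma lapX_repr (g : V -> R) x : lattice_periodic g ->
  lapX (g \o @reprX R L) x = flat_lap g (reprX x).
Proof. by move=> pg; rewrite /lapX periodic_reprK. Qed.

Lemma lapX_piX (h : quotX L -> R) p :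
  lapX h (piX L p) = flat_lap (h \o piX L) p.
Proof.
rewrite /lapX; apply: (periodic_repr (g := flat_lap (h \o piX L))).
exact/periodic_flat_lap/periodic_comp_piX.
Qed.

Lemma continuous_piX : continuous (piX L).
Proof. exact: pi_continuous. Qed.

Definition wX (x : quotX L) : cplane R := (reprX x).2.

Lemma wX_piX p : wX (piX L p) = p.2. Proof. exact: repr_snd. Qed.

Lemma continuous_wX : continuous wX.
Proof.
apply/quotient_continuous.
rewrite (_ : _ \o _ = snd); first by move=> p; exact: cvg_snd.
by apply/funext => p; exact: wX_piX.
Qed.

Lemma continuous_norm_wX : continuous (fun x : quotX L => `|wX x|).
Proof.
move=> x; apply: continuous_comp; first exact: continuous_wX.
exact: norm_continuous.
Qed.

Lemma compact_cell_closure : compact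
  [set z : cplane R | exists s t : R, [/\ 0 <= s <= 1, 0 <= t <= 1 &
    z = s *: (lattice_basis L).1 + t *: (lattice_basis L).2]].
Proof.
set e := lattice_basis L.
pose l := fun st : R * R => st.1 *: e.1 + st.2 *: e.2.
have itvE (x : R) : `[0, 1]%classic x = (0 <= x <= 1) by rewrite /= in_itv.
rewrite (_ : mkset _ = l @` (`[0, 1] `*` `[0, 1])); last first.
  apply/seteqP; split=> [z [s [t [s01 t01 ->]]]|z [[s t]] /= [s01 t01] <-].
    by exists (s, t) => //; split; rewrite itvE.
  by exists s, t; split; rewrite // -itvE.
apply: continuous_compact; last by apply: compact_setX; exact: segment_compact.
apply: continuous_subspaceT => x.
apply: cvgD; apply: cvgZl; [exact: cvg_fst|exact: cvg_snd].
Qed.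

(** In the z direction X is a torus, so the set is the image of a closed parallelogram times a
    square. Support bounded in w alone is therefore compact, which is what [test_funP] exploits. *)
Lemma compact_wX_ball r : compact [set x : quotX L | `|wX x| <= r].
Proof.
set K := [set z : cplane R | exists s t : R, [/\ 0 <= s <= 1, 0 <= t <= 1 &
    z = s *: (lattice_basis L).1 + t *: (lattice_basis L).2]].
pose B : set (cplane R) := `[- r, r] `*` `[- r, r].
have itvE (x : R) : `[- r, r]%classic x = (`|x| <= r).
  by rewrite /= in_itv /= ler_norml.
have -> : [set x : quotX L | `|wX x| <= r] = piX L @` (K `*` B).
  apply/seteqP; split=> [x /= xr|_ [p [_ /= [p1 p2]] <-]].
    have [p [s [t [/andP[s0 s1] /andP[t0 t1] pE]]] xE] := piX_surj x.
    exists p => //; split; last first.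
      move: xr; rewrite -xE wX_piX prod_normE ge_max => /andP[a b].
      by split; rewrite itvE.
    by exists s, t; split; rewrite ?s0 ?t0 //= ltW.
  rewrite /= wX_piX prod_normE ge_max !ler_norml.
  by move: p1 p2; rewrite !itvE !ler_norml => -> ->.
apply: continuous_compact.
  by apply: continuous_subspaceT; exact: continuous_piX.
apply: compact_setX; first exact: compact_cell_closure.
by apply: compact_setX; exact: segment_compact.
Qed.

Lemma closed_wX_ball r : closed [set x : quotX L | `|wX x| <= r].
Proof.
have /continuous_closedP := continuous_norm_wX.
by move=> /(_ _ (@closed_le _ r)).
Qed.

Lemma test_funP (g : V -> R) r : lattice_periodic g -> smooth g ->
  (forall p, r < `|p.2| -> g p = 0) -> test_fun (g \o @reprX R L).
Proof.
move=> pg sg g0; split; first by rewrite periodic_reprK.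
apply: (subclosed_compact _ (@compact_wX_ball r)); first exact: closed_closure.
suff /closure_subset : [set x | (g \o @reprX R L) x != 0] `<=`
    [set x : quotX L | `|wX x| <= r].
  by rewrite -((closure_id _).1 (@closed_wX_ball r)).
move=> x /= /eqP gx; rewrite leNgt; apply/negP => rx.
by apply: gx; exact: g0.
Qed.

(** The continuous functions |w| and [h] are bounded on the compact support; the first bound gives
    the radius beyond which [h] vanishes. *)
Lemma test_fun_bounded (h : quotX L -> R) : test_fun h ->
  exists r M : R, (forall x, r < `|wX x| -> h x = 0) /\ forall x, `|h x| <= M.
Proof.
move=> [sh cK].
have ch : continuous h.
  by apply/quotient_continuous; have := sh 0%N; case.
have bd (F : quotX L -> R) : continuous F ->
    exists M, forall x, closure [set x | h x != 0] x -> `|F x| <= M.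
  move=> cF; have := continuous_compact _ cK.
  move=> /(_ _ F (continuous_subspaceT cF)) /compact_bounded [M [_ HM]].
  exists (M + 1) => x Kx; apply: (HM (M + 1)); first by rewrite ltrDl.
  by exists x.
have [r Hr] := bd _ continuous_norm_wX.
have [M HM] := bd h ch.
have sub x : h x != 0 -> closure [set x | h x != 0] x.
  by move=> hx; apply: subset_closure.
(* If the support is empty, [M] may be negative; the maximum with 0 covers this case. *)
exists r, (Num.max M 0); split=> x.
  move=> rx; apply/eqP; apply: contraTT rx => /sub /Hr.
  by rewrite normr_id -leNgt.
rewrite le_max; have [->|/sub/HM ->//] := eqVneq (h x) 0.
by rewrite normr0 lexx orbT.
Qed.

End QuotientTopology.

(** * Integrals against restricted and pushed-forward measures *)

Section RestrictedMeasure.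
Context d (T : measurableType d) (R : realType).
Variables (mu : {measure set T -> \bar R}) (D : set T) (mD : measurable D).
Local Open Scope ereal_scope.

(** The measure [mu] is the sum of its restrictions to [D] and to the complement. The function cut
    off to [D] vanishes almost everywhere for the second and equals [f] almost everywhere for the
    first. *)
Lemma ge0_integral_mrestr (f : T -> \bar R) : measurable_fun setT f ->
  (forall x, 0 <= f x) -> \int[mrestr mu mD]_x f x = \int[mu]_(x in D) f x.
Proof.
move=> mf f0; have mC := measurableC mD.
have mfD : measurable_fun setT (f \_ D).
  exact/(measurable_restrictT f mD).1/measurable_funTS.
have fD0 x : 0 <= (f \_ D) x by rewrite /patch; case: ifPn.
rewrite [RHS]integral_mkcond.
have -> : \int[mu]_x (f \_ D) x =
    \int[measure_add (mrestr mu mD) (mrestr mu mC)]_x (f \_ D) x.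
  apply: eq_measure_integral => A mA _.
  transitivity (mrestr mu mD A + mrestr mu mC A).
    rewrite /mrestr -measureU; [|exact: measurableI|exact: measurableI|].
      by rewrite -setIUr setUCr setIT.
    by rewrite setIACA setICr setI0.
  exact/esym/measure_addE.
rewrite ge0_integral_measure_add //.
have -> : \int[mrestr mu mC]_x (f \_ D) x = 0.
  rewrite (ge0_ae_eq_integral (g := cst 0)) ?integral0 //.
  exists D; split => //; first by rewrite /= /mrestr setICr.
  by move=> x /= /not_implyP[_]; apply: contra_notP => Dx; rewrite patchN // notin_setE.
rewrite adde0; apply: ge0_ae_eq_integral => //.
exists (~` D); split => //; first by rewrite /= /mrestr setICl.
by move=> x /= /not_implyP[_]; apply: contra_not => Dx; rewrite patchT // inE.
Qed.

Lemma ge0_integral_pushforward_mrestr d' (Y : measurableType d')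
    (phi : T -> Y) (mphi : measurable_fun setT phi)
    (nu : {measure set Y -> \bar R}) (f : Y -> \bar R) :
  (forall A, measurable A -> nu A = mu (phi @^-1` A `&` D)) ->
  measurable_fun setT f -> (forall y, 0 <= f y) ->
  \int[nu]_y f y = \int[mu]_(x in D) f (phi x).
Proof.
move=> nuE mf f0.
pose nu' := measure_function_pushforward__canonical__measure_function_Measure
  (mrestr mu mD) mphi.
transitivity (\int[nu']_y f y).
  by apply: eq_measure_integral => A mA _; rewrite nuE.
rewrite ge0_integral_pushforward // preimage_setT ge0_integral_mrestr //.
  by apply: measurableT_comp.
by move=> x; exact: f0.
Qed.

End RestrictedMeasure.

(** * Cubes in R^4 and measurability of continuous functions *)

Section Cubes.
Context {R : realType}.
Local Notation V := (cplane2 R).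

Lemma lebesgue4X (A B : set (mplane R)) : measurable A -> measurable B ->
  (@lebesgue4 R (A `*` B) = @lebesgue2 R A * @lebesgue2 R B)%E.
Proof. by move=> mA mB; rewrite /lebesgue4 product_measure1E. Qed.

Lemma lebesgue2X (A B : set (measurableTypeR R)) :
  measurable A -> measurable B ->
  (@lebesgue2 R (A `*` B) = lebesgue_measure A * lebesgue_measure B)%E.
Proof. by move=> mA mB; rewrite /lebesgue2 product_measure1E. Qed.

(** Squares and cubes are the closed balls of the norm of product types, which is the maximum norm;
    [r] is half of the side. *)
Definition square (z : cplane R) (r : R) : set (mplane R) :=
  `[z.1 - r, z.1 + r]%classic `*` `[z.2 - r, z.2 + r]%classic.

Definition cube (p : V) (r : R) : set (mplane2 R) :=
  square p.1 r `*` square p.2 r.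

Lemma measurable_square z r : measurable (square z r).
Proof. by apply: measurableX; exact: measurable_itv. Qed.

Lemma measurable_cube p r : measurable (cube p r).
Proof. by apply: measurableX; exact: measurable_square. Qed.

Lemma squareE z r (y : cplane R) : square z r y <-> `|y - z| <= r.
Proof.
have itvE (a x : R) : `[a - r, a + r]%classic x = (`|x - a| <= r).
  by rewrite /= in_itv /= ler_distl.
rewrite prod_normE ge_max.
by split=> [[]|/andP[a b]]; [rewrite !itvE => -> ->|split; rewrite itvE].
Qed.

Lemma cubeE p r (q : V) : cube p r q <-> `|q - p| <= r.
Proof.
rewrite prod_normE ge_max; split=> [[/squareE -> /squareE ->]//|].
by move=> /andP[a b]; split; apply/squareE.
Qed.

Lemma lebesgue2_square z r : 0 <= r ->
  @lebesgue2 R (square z r) = ((2 * r) ^+ 2)%:E.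
Proof.
move=> r0; rewrite lebesgue2X; [|exact: measurable_itv|exact: measurable_itv].
have itvE (a : R) : lebesgue_measure `[a - r, a + r]%classic = (2 * r)%:E.
  rewrite lebesgue_measure_itv /= lte_fin; case: ifPn => [_|].
    by rewrite -EFinB; congr EFin; ring.
  rewrite -leNgt => H; have -> : r = 0 by lra.
  by rewrite mulr0.
by rewrite !itvE -EFinM expr2.
Qed.

Lemma lebesgue4_cube p r : 0 <= r ->
  @lebesgue4 R (cube p r) = ((2 * r) ^+ 4)%:E.
Proof.
move=> r0; rewrite lebesgue4X; try exact: measurable_square.
by rewrite !lebesgue2_square // -EFinM -exprD.
Qed.

Lemma measurable_coord i : measurable_fun [set: mplane2 R] (coord4 i).
Proof.
case: i => [|[|[|[|i]]]].
- exact: (measurableT_comp measurable_fst measurable_fst).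
- exact: (measurableT_comp measurable_snd measurable_fst).
- exact: (measurableT_comp measurable_fst measurable_snd).
- exact: (measurableT_comp measurable_snd measurable_snd).
rewrite (_ : coord4 _ = cst 0) //.
by apply/funext => x; rewrite /coord4 /= nth_nil.
Qed.

(* Rounding the coordinates down to multiples of 1/n approximates a continuous
   function by functions that are constant on countably many cubes. *)
Lemma continuous_measurable_fun4 (g : V -> R) : continuous g ->
  measurable_fun [set: mplane2 R] g.
Proof.
move=> cg.
pose fl (n : nat) (x : R) : int := Num.floor (n.+1%:R * x).
pose rd (n : nat) (z : int * int * (int * int)) : V :=
  ((z.1.1%:~R / n.+1%:R, z.1.2%:~R / n.+1%:R),
   (z.2.1%:~R / n.+1%:R, z.2.2%:~R / n.+1%:R)).
pose fl4 n (p : V) : int * int * (int * int) :=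
  ((fl n p.1.1, fl n p.1.2), (fl n p.2.1, fl n p.2.2)).
have mfl n i (k : int) : measurable ([set p | fl n (coord4 i p) = k] : set (mplane2 R)).
  rewrite (_ : mkset _ = coord4 i @^-1` `[k%:~R / n.+1%:R, (k + 1)%:~R / n.+1%:R[).
    by rewrite -[X in measurable X]setTI; apply: measurable_coord.
  apply/seteqP; split=> p /=; rewrite in_itv /= ler_pdivrMr // ltr_pdivlMr // mulrC.
    by move=> <-; exact: real_floor_itv (num_real _).
  exact: floor_def.
apply: (@measurable_fun_cvg _ _ _ _ (fun n => g \o rd n \o fl4 n)).
- move=> n _ B mB; rewrite setTI.
  have -> : (g \o rd n \o fl4 n) @^-1` B =
     \bigcup_(z in [set z | B (g (rd n z))]) (fl4 n @^-1` [set z]).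
    apply/seteqP; split=> [p Bp|p [z Bz pz]]; first by exists (fl4 n p).
    by rewrite /preimage /= pz.
  rewrite bigcup_mkcond; apply: countable_bigcupT_measurable => // z.
  case: ifPn => _ //; rewrite (_ : _ @^-1` _ =
      [set p | fl n (coord4 0 p) = z.1.1] `&` [set p | fl n (coord4 1 p) = z.1.2]
      `&` ([set p | fl n (coord4 2 p) = z.2.1] `&`
           [set p | fl n (coord4 3 p) = z.2.2])).
    by apply: measurableI; apply: measurableI; exact: mfl.
  apply/seteqP; split=> [p <-//|p [[/= a b] [/= c d]]].
  by move: a b c d; rewrite /fl4; case: z => -[z1 z2] [z3 z4] /= <- <- <- <-.
move=> p _.
have flP n (x : R) : `|x - (fl n x)%:~R / n.+1%:R| <= n.+1%:R^-1.
  have n0 : (0 : R) < n.+1%:R by [].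
  rewrite /fl [n.+1%:R * x]mulrC.
  have /andP[] := real_floor_itv (num_real (x * n.+1%:R)).
  rewrite -ler_pdivrMr // -ltr_pdivlMr // intrD mulrDl mul1r => a b.
  have ni : (0 : R) < n.+1%:R^-1 by rewrite invr_gt0.
  move: a b ni; set u := _ / _; set v := _^-1 => a b ni.
  by rewrite ler_norml; apply/andP; split; lra.
apply: (cvg_comp _ _ (_ : rd n (fl4 n p) @[n --> \oo] --> p) (cg p)).
apply/cvgrPdist_le => e e0; near=> n.
apply: (@le_trans _ _ n.+1%:R^-1).
  by rewrite !prod_normE /= !ge_max !flP.
by apply/ltW; near: n; exact: near_infty_natSinv_lt (PosNum e0).
Unshelve. all: by end_near. Qed.

End Cubes.

(** * The volume of X and integrals of powers of 1 + |w|^2 *)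

Section VolumeOfX.
Context {R : realType} (L : lattice R).
Local Notation V := (cplane2 R).
Local Notation mu := (dvolX L).

Definition cellX : set (mplane2 R) := fundamental_cell L `*` [set: cplane R].

Lemma measurable_cellX : measurable cellX.
Proof. exact: measurable_fundamental_domain. Qed.

Lemma dvolXE A : mu A = @lebesgue4 R (piX L @^-1` A `&` cellX).
Proof. by []. Qed.

Lemma measurable_fun_quotX d (T : measurableType d) (f : quotX L -> T) :
  measurable_fun [set: mplane2 R] (f \o piX L) -> measurable_fun [set: quotX L] f.
Proof.
move=> mf _ B mB; rewrite setTI; have := mf measurableT B mB.
by rewrite setTI.
Qed.

Lemma ge0_integral_dvolX (f : quotX L -> \bar R) :
  measurable_fun setT f -> (forall x, 0 <= f x)%E ->
  (\int[mu]_x f x = \int[@lebesgue4 R]_(p in cellX) f (piX L p))%E.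
Proof.
move=> mf f0.
exact: (ge0_integral_pushforward_mrestr measurable_cellX (@measurable_piX R L)).
Qed.

Lemma cell_volume_fin : exists2 a : R, 0 <= a &
  @lebesgue2 R (fundamental_cell L) = a%:E.
Proof.
pose r := `|(lattice_basis L).1| + `|(lattice_basis L).2|.
have r0 : 0 <= r by rewrite addr_ge0.
have mc := measurable_fundamental_cell L.
have le : (@lebesgue2 R (fundamental_cell L) <= ((2 * r) ^+ 2)%:E)%E.
  rewrite -(lebesgue2_square 0 r0); apply: le_measure; rewrite ?inE //.
    exact: measurable_square.
  move=> z [s [t [/andP[s0 s1] /andP[t0 t1] ->]]]; apply/squareE.
  rewrite subr0 (le_trans (ler_normD _ _)) // !normrZ lerD //.
    by rewrite ler_piMl // ger0_norm // ltW.
  by rewrite ler_piMl // ger0_norm // ltW.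
exists (fine (@lebesgue2 R (fundamental_cell L))).
  by rewrite fine_ge0.
rewrite fineK // ge0_fin_numE ?measure_ge0 //.
by apply: le_lt_trans le _; rewrite ltry.
Qed.

Definition cell_volume : R := fine (@lebesgue2 R (fundamental_cell L)).

Lemma cell_volumeE : @lebesgue2 R (fundamental_cell L) = cell_volume%:E.
Proof. by rewrite /cell_volume; have [a _ ->] := cell_volume_fin. Qed.

Lemma cell_volume_ge0 : 0 <= cell_volume.
Proof. by rewrite /cell_volume fine_ge0. Qed.

Lemma measurable_wX (B : set (mplane R)) : measurable B ->
  measurable ((@wX R L) @^-1` B).
Proof.
move=> mB; rewrite /measurable /= /measurable_quotX /= -comp_preimage.
rewrite (_ : _ \o _ = snd); last by apply/funext => p; exact: wX_piX.
by have := @measurable_snd _ _ (mplane R) (mplane R) measurableT B mB; rewrite setTI.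
Qed.

Lemma dvolX_wX (B : set (mplane R)) : measurable B ->
  (mu ((@wX R L) @^-1` B) = cell_volume%:E * @lebesgue2 R B)%E.
Proof.
move=> mB; rewrite dvolXE -comp_preimage.
rewrite (_ : _ \o _ = snd); last by apply/funext => p; exact: wX_piX.
rewrite (_ : _ `&` _ = fundamental_cell L `*` B); last first.
  by apply/seteqP; split=> [p [b [a _]]|p [a b]]; split.
by rewrite lebesgue4X ?cell_volumeE //; exact: measurable_fundamental_cell.
Qed.

Definition ballX (c : cplane R) (r : R) : set (quotX L) :=
  [set x | `|wX x - c| <= r].

Lemma ballXE c r : ballX c r = (@wX R L) @^-1` square c r.
Proof. by apply/seteqP; split=> x /squareE. Qed.

Lemma measurable_ballX c r : measurable (ballX c r).
Proof. by rewrite ballXE; apply: measurable_wX; exact: measurable_square. Qed.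

Lemma dvolX_ballX c r : 0 <= r ->
  mu (ballX c r) = (cell_volume * (2 * r) ^+ 2)%:E.
Proof.
move=> r0; rewrite ballXE dvolX_wX; last exact: measurable_square.
by rewrite lebesgue2_square // -EFinM.
Qed.

(** This is S_c, built from the Euclidean norm, whereas |w| is the maximum norm; [norm_lt_sqnorm]
    passes from one to the other. *)
Definition Sq (c w : cplane R) : R := 1 + sqnorm (w - c).

Lemma sqnorm_ge0 (w : cplane R) : 0 <= sqnorm w.
Proof. by rewrite addr_ge0 ?sqr_ge0. Qed.

Lemma Sq_ge1 c w : 1 <= Sq c w.
Proof. by rewrite lerDl sqnorm_ge0. Qed.

Lemma Sq_gt0 c w : 0 < Sq c w.
Proof. exact: lt_le_trans (Sq_ge1 c w). Qed.

Lemma norm_lt_sqnorm (w : cplane R) r : 0 <= r -> sqnorm w <= r ^+ 2 -> `|w| <= r.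
Proof.
move=> r0; rewrite /sqnorm => H; rewrite prod_normE ge_max.
have := sqr_ge0 w.1; have := sqr_ge0 w.2 => w2 w1.
by apply/andP; split; rewrite -(@ler_pXn2r _ 2) ?nnegrE // real_normK ?num_real //;
  lra.
Qed.

Lemma measurable_Sq c : measurable_fun setT (fun x : quotX L => Sq c (wX x)).
Proof.
apply: measurable_fun_quotX.
rewrite (_ : _ \o _ = fun p => 1 + ((coord4 2 p - c.1) ^+ 2 +
    (coord4 3 p - c.2) ^+ 2)); last first.
  by apply/funext => p; rewrite /= wX_piX.
by apply: measurable_funD => //; apply: measurable_funD;
  apply: measurable_funX; apply: measurable_funB => //; exact: measurable_coord.
Qed.

Lemma measurable_Sq_lt N :
  measurable_fun setT (fun x : quotX L => (Sq 0 (wX x) < 4 ^+ N)%R%:R : R).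
Proof.
rewrite (_ : (fun x => _) = \1_((fun x => Sq 0 (wX x)) @^-1` `]-oo, 4 ^+ N[)).
  apply: measurable_indic; rewrite -[X in measurable X]setTI.
  by apply: measurable_Sq.
apply/funext => x; rewrite indicE; congr (_%:R); congr nat_of_bool.
by apply/idP/idP; rewrite inE /= in_itv.
Qed.

(* On 4^n <= Sq 0 w < 4^(n+1) the point lies in a square of side 4 * 2^n, whose
   preimage in X has volume 16 * 4^n * cell_volume. *)
Lemma integral_dyadic (g : R -> R) N :
  (forall x y, 1 <= x -> x <= y -> 0 <= g y <= g x) ->
  measurable_fun setT g ->
  (\int[mu]_x (g (Sq 0 (wX x)) * (Sq 0 (wX x) < 4 ^+ N)%R%:R)%:E <=
    (16 * cell_volume * \sum_(n < N) g (4 ^+ n) * 4 ^+ n)%:E)%E.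
Proof.
move=> gdec mg.
have g0 x : 1 <= x -> 0 <= g x by move=> x1; have /andP[] := gdec _ _ x1 (lexx x).
have p1 n : 1 <= 4 ^+ n :> R by rewrite exprn_ege1 // ler1n.
have exp4 n : 4 ^+ n = (2 ^+ n) ^+ 2 :> R.
  by rewrite exprAC; congr (_ ^+ _); ring.
have c0 := cell_volume_ge0.
pose A n := ballX 0 (2 ^+ n.+1).
have mA n : measurable (A n) by exact: measurable_ballX.
have -> : (16 * cell_volume * \sum_(n < N) g (4 ^+ n) * 4 ^+ n)%:E =
    (\sum_(n < N) \int[mu]_x (g (4 ^+ n) * \1_(A n) x)%:E)%E.
  rewrite mulr_sumr -sumEFin; apply: eq_bigr => n _.
  under eq_integral do rewrite EFinM.
  rewrite ge0_integralZl_EFin ?g0 //; last exact/measurable_EFinP.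
  have mAn : mu (A n) = (cell_volume * (2 * 2 ^+ n.+1) ^+ 2)%:E.
    by apply: dvolX_ballX; rewrite exprn_ge0.
  rewrite integral_indic // setIT [X in (_ * X)%E]mAn -EFinM.
  congr EFin; move: (g _) => y; rewrite exp4 [2 ^+ n.+1]exprS; ring.
rewrite -ge0_integral_sum //; last 2 first.
- by move=> n; apply/measurable_EFinP; exact: measurable_funM.
- by move=> n x _; rewrite lee_fin mulr_ge0 // g0.
apply: ge0_le_integral => //.
- by move=> x _; rewrite lee_fin mulr_ge0 // g0 // Sq_ge1.
- apply/measurable_EFinP; apply: measurable_funM.
    exact: (measurableT_comp mg (measurable_Sq 0)).
  exact: measurable_Sq_lt.
- by apply: emeasurable_sum => n; apply/measurable_EFinP; exact: measurable_funM.
move=> x _; rewrite sumEFin lee_fin.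
have [SN|_] := boolP (Sq 0 (wX x) < 4 ^+ N); last first.
  by rewrite mulr0 sumr_ge0 // => n _; rewrite mulr_ge0 // g0.
rewrite mulr1.
have [n [nN n1 n2]] : exists n, [/\ (n < N)%N, 4 ^+ n <= Sq 0 (wX x) &
    Sq 0 (wX x) < 4 ^+ n.+1].
  elim: N SN => [|N IH]; first by rewrite expr0 ltNge Sq_ge1.
  move=> SN; have [/IH[n [nN n1 n2]]|NS] := ltP (Sq 0 (wX x)) (4 ^+ N).
    by exists n; split=> //; exact: ltnW.
  by exists N.
rewrite (bigD1 (Ordinal nN)) //= ler_wpDr //.
  by rewrite sumr_ge0 // => k _; rewrite mulr_ge0 // g0.
rewrite indicE mem_set; first by rewrite mulr1; have /andP[] := gdec _ _ (p1 n) n1.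
apply: norm_lt_sqnorm; first by rewrite exprn_ge0.
rewrite -exp4.
by apply: ltW; apply: le_lt_trans n2; rewrite lerDr.
Qed.

(** The borderline exponent: every dyadic shell contributes the same amount, so the integral grows
    only linearly in N, that is, logarithmically in the radius. *)
Lemma integral_Sq_inv N :
  (\int[mu]_x ((Sq 0 (wX x))^-1 * (Sq 0 (wX x) < 4 ^+ N)%R%:R)%:E <=
    (16 * cell_volume * N%:R)%:E)%E.
Proof.
have := @integral_dyadic (fun x => x `^ (- 1)) N.
rewrite (_ : \sum_(n < N) _ = N%:R); last first.
  rewrite -[RHS]mul1r -[N in RHS]card_ord mulr_natr -sumr_const.
  apply: eq_bigr => n _.
  by rewrite powR_inv1 ?exprn_ge0 // mulVf // expf_neq0.
under eq_integral do rewrite powR_inv1 ?(ltW (Sq_gt0 _ _)) //.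
apply; last exact: measurable_powR.
move=> x y x1 xy; have x0 : 0 < x by exact: lt_le_trans x1.
have y0 : 0 < y by exact: lt_le_trans xy.
by rewrite !powR_inv1 ?(ltW x0) ?(ltW y0) // invr_ge0 (ltW y0) lef_pV2.
Qed.

(** The dyadic shells contribute a geometric series of ratio [q = 4^(1 - b) < 1], which bounds the
    truncated integrals uniformly; monotone convergence removes the truncation. *)
Lemma integral_Sq_powR b : 1 < b ->
  (\int[mu]_x (Sq 0 (wX x) `^ (- b))%:E < +oo)%E.
Proof.
move=> b1; have c0 := cell_volume_ge0.
pose q : R := 4 `^ (1 - b).
have q0 : 0 < q by rewrite powR_gt0.
have q1 : q < 1.
  rewrite /q -opprB powRN invf_lt1 ?powR_gt0 // -[ltLHS](congr1 (@^~ (b - 1)) (powR1 R)).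
  by apply: gt0_ltr_powR; rewrite ?subr_gt0 ?nnegrE // ltr1n.
pose g (x : R) := x `^ (- b).
pose f N (x : quotX L) := (g (Sq 0 (wX x)) * (Sq 0 (wX x) < 4 ^+ N)%R%:R)%:E.
have gdec (x y : R) : 1 <= x -> x <= y -> 0 <= g y <= g x.
  move=> x1 xy; have x0 : 0 < x by exact: lt_le_trans x1.
  have y0 := lt_le_trans x0 xy.
  rewrite powR_ge0 /g !powRN lef_pV2 ?posrE ?powR_gt0 //.
  by apply: ge0_ler_powR => //; rewrite ?nnegrE; apply/ltW => //;
    exact: lt_trans b1.
have mg : measurable_fun setT g by exact: measurable_powR.
have fS N : (\int[mu]_x f N x <= (16 * cell_volume / (1 - q))%:E)%E.
  apply: le_trans (integral_dyadic N gdec mg) _; rewrite lee_fin.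
  rewrite ler_wpM2l ?mulr_ge0 // ?ler0n //.
  rewrite (eq_bigr (fun n : 'I_N => q ^+ n)); last first.
    move=> n _; rewrite /g -[X in _ * X]powRr1 ?exprn_ge0 // -powRD; last first.
      by rewrite expf_neq0 ?implybT.
    by rewrite addrC -(powR_mulrn n) // powRAC powR_mulrn // powR_ge0.
  rewrite -[leRHS]mul1r ler_pdivlMr ?subr_gt0 // mulrC.
  have := subrX1 q N; rewrite -[q - 1]opprB mulNr => /eqP.
  rewrite -eqr_oppLR opprB => /eqP <-.
  by rewrite lerBlDr lerDl exprn_ge0 // ltW.
have f0 N x : (0 <= f N x)%E by rewrite lee_fin mulr_ge0 // powR_ge0.
have ndf x : nondecreasing_seq (f ^~ x).
  move=> m n mn; rewrite lee_fin ler_wpM2l ?powR_ge0 // ler_nat.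
  by case: ltP => // Sm; rewrite (lt_le_trans Sm) // ler_weXn2l // ler1n.
have mf N : measurable_fun setT (f N).
  apply/measurable_EFinP; apply: measurable_funM.
    exact: (measurableT_comp mg (measurable_Sq 0)).
  exact: measurable_Sq_lt.
have flim (z : quotX L) : limn (fun n => f n z) = (Sq 0 (wX z) `^ (- b))%:E.
  apply: cvg_lim => //.
  apply: cvg_near_cst.
  near=> N; rewrite /f (_ : Sq 0 (wX z) < 4 ^+ N) ?mulr1 //.
  apply: (@lt_le_trans _ _ N%:R).
    apply: lt_le_trans (archi_boundP (le_trans ler01 (Sq_ge1 0 (wX z)))) _.
    by rewrite ler_nat; near: N; exact: nbhs_infty_ge.
  by rewrite -natrX ler_nat ltnW // ltn_expl.
have -> : (\int[mu]_x (Sq 0 (wX x) `^ (- b))%:E =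
    \int[mu]_x (limn (fun n => f n x)))%E.
  by apply: eq_integral => y _; rewrite flim.
rewrite monotone_convergence //.
apply: le_lt_trans (ltry (16 * cell_volume / (1 - q))).
apply: lime_le; last by near=> N; exact: fS.
apply: ereal_nondecreasing_is_cvgn => m n mn; apply: ge0_le_integral => //.
by move=> y _; exact: ndf.
Unshelve. all: by end_near. Qed.

End VolumeOfX.

(** * Outer regularity of finite measures on R^4 *)

Section OuterRegularity.
Context {R : realType}.
Local Notation V := (cplane2 R).

Lemma coord4_norm i (p : V) : `|coord4 i p| <= `|p|.
Proof.
have n1 (x y : R) : `|x| <= `|(x, y)| by rewrite prod_normE le_max lexx.
have n2 (x y : R) : `|y| <= `|(x, y)| by rewrite prod_normE le_max lexx orbT.
case: p => -[a b] [c d]; rewrite /coord4 prod_normE le_max.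
case: i => [|[|[|[|i]]]] /=; rewrite ?n1 ?n2 ?orbT //.
by rewrite nth_nil normr0 normr_ge0.
Qed.

Lemma coord4B i (p q : V) : coord4 i (p - q) = coord4 i p - coord4 i q.
Proof.
have := coord_affine i (-1) q p; rewrite scaleN1r mulN1r addrC => ->.
by rewrite addrC.
Qed.

(** Openness for the maximum norm, phrased with the cubes over which averages are taken. *)
Definition cube_open (U : set (mplane2 R)) :=
  forall p, U p -> exists2 e : R, 0 < e & cube p e `<=` U.

Lemma cube_sub p (r s : R) : r <= s -> cube p r `<=` cube p s.
Proof. by move=> rs q /cubeE qr; apply/cubeE; exact: le_trans rs. Qed.

Lemma cube_open_ray i a : cube_open [set p | a < coord4 i p].
Proof.
move=> p /= ap; exists ((coord4 i p - a) / 2); first by rewrite divr_gt0 ?subr_gt0.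
move=> q /cubeE /= /(le_trans (coord4_norm i _)).
by rewrite coord4B ler_distl => /andP[+ _]; lra.
Qed.

Lemma cube_open_lray i a : cube_open [set p | coord4 i p < a].
Proof.
move=> p /= ap; exists ((a - coord4 i p) / 2); first by rewrite divr_gt0 ?subr_gt0.
move=> q /cubeE /= /(le_trans (coord4_norm i _)).
by rewrite coord4B ler_distl => /andP[_ +]; lra.
Qed.

Lemma cube_openI (A B : set (mplane2 R)) :
  cube_open A -> cube_open B -> cube_open (A `&` B).
Proof.
move=> oA oB p [/oA[e e0 eA] /oB[f f0 fB]].
exists (Num.min e f); first by rewrite lt_min e0.
move=> q pq; split; [apply: eA|apply: fB]; apply: cube_sub pq;
  by rewrite ge_min lexx ?orbT.
Qed.

Lemma cube_open_bigcap (U : (set (mplane2 R))^nat) N :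
  (forall n, cube_open (U n)) -> cube_open (\bigcap_(n < N) U n).
Proof.
move=> oU; elim: N => [|N IH].
  by move=> p _; exists 1 => // q _ k.
by rewrite bigcap_mkord big_ord_recr /= -bigcap_mkord; exact: cube_openI.
Qed.

Lemma cube_open_bigcup (U : (set (mplane2 R))^nat) :
  (forall n, cube_open (U n)) -> cube_open (\bigcup_n U n).
Proof.
move=> oU p [n _ Up]; have [e e0 eU] := oU n p Up.
by exists e => // q /eU Uq; exists n.
Qed.

Lemma measurable_ray i a : measurable ([set p | a < coord4 i p] : set (mplane2 R)).
Proof.
rewrite (_ : mkset _ = coord4 i @^-1` `]a, +oo[).
  by rewrite -[X in measurable X]setTI; apply: measurable_coord.
by apply/seteqP; split=> p; rewrite /= in_itv /= andbT.
Qed.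

Lemma measurable_lray i a : measurable ([set p | coord4 i p < a] : set (mplane2 R)).
Proof.
rewrite (_ : mkset _ = coord4 i @^-1` `]-oo, a[).
  by rewrite -[X in measurable X]setTI; apply: measurable_coord.
by apply/seteqP; split=> p; rewrite /= in_itv.
Qed.

(** An induction principle that reduces outer regularity to half-spaces. Preimages are treated first
    for one coordinate, then for a plane, then for R^4, following the construction of the product
    sigma-algebras. *)
Lemma sigma_algebra_mplane2 (S : set (set (mplane2 R))) :
  sigma_algebra setT S ->
  (forall i a, S [set p | a < coord4 i p]) -> measurable `<=` S.
Proof.
move=> [S0 SC SU] Sray.
have SD A : S A -> S (~` A) by rewrite -setTD; exact: SC.
have SI A B : S A -> S B -> S (A `&` B).
  move=> SA SB; rewrite -[A]setCK -[B]setCK -setCU; apply: (SD _).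
  rewrite -bigcup2E; apply: SU => -[|[|n]]; [exact: SD|exact: SD|exact: S0].
have Spre d (T : measurableType d) (f : mplane2 R -> T) (G : set (set T)) :
    measurable = <<s G >> -> (forall A, G A -> S (f @^-1` A)) ->
    forall A, measurable A -> S (f @^-1` A).
  move=> mG SG; rewrite mG => A; move: A.
  apply: (@smallest_sub _ _ _ [set A | S (f @^-1` A)]) => //.
  split=> /=; first by rewrite preimage_set0.
  - by move=> A SA; rewrite setTD preimage_setC; exact: SD.
  - by move=> F SF; rewrite preimage_bigcup; exact: SU.
have Scoord i (B : set (measurableTypeR R)) : measurable B ->
    S (coord4 i @^-1` B).
  apply: (Spre _ _ _ (@ocitv R)) => // _ [[a b] _ <-].
  rewrite (_ : _ @^-1` _ = [set p | a < coord4 i p] `&`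
      ~` [set p | b < coord4 i p]); first by apply: SI => //; exact: SD.
  apply/seteqP; split=> p; rewrite /= in_itv /=.
    by move=> /andP[-> pb]; split=> //; apply/negP; rewrite -leNgt.
  by move=> [-> /negP]; rewrite -leNgt.
have Splane (f : mplane2 R -> mplane R) i j :
    fst \o f = coord4 i -> snd \o f = coord4 j ->
    forall A, measurable A -> S (f @^-1` A).
  move=> fi fj; apply: Spre; first by [].
  move=> A [] [B mB <-]; rewrite setTI -comp_preimage ?fi ?fj; exact: Scoord.
have Sid : forall A, measurable A -> S (id @^-1` A).
  apply: (Spre _ _ id); first by [].
  move=> A [] [B mB <-]; rewrite setTI preimage_id.
    by apply: (@Splane fst 0%N 1%N).
  by apply: (@Splane snd 2%N 3%N).
by move=> A mA; have := Sid A mA; rewrite preimage_id.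
Qed.

Variable k : {measure set (mplane2 R) -> \bar R}.
Hypothesis kfin : (k setT < +oo)%E.

Definition outer_regular (A : set (mplane2 R)) := measurable A /\
  forall e : R, 0 < e -> exists U, [/\ measurable U, cube_open U, A `<=` U &
    (k (U `\` A) <= e%:E)%E].

Lemma outer_regular_seq (A : (set (mplane2 R))^nat) (e : R) : 0 < e ->
  (forall n, outer_regular (A n)) ->
  exists U : (set (mplane2 R))^nat, [/\ forall n, measurable (U n),
    forall n, cube_open (U n), forall n, A n `<=` U n &
    (k (\bigcup_n (U n `\` A n)) <= e%:E)%E].
Proof.
move=> e0 rA.
have e2 n : 0 < e / 2 ^+ n.+1 by rewrite divr_gt0 ?exprn_gt0.
have [U HU] := choice (fun n => (rA n).2 _ (e2 n)).
have mA n : measurable (A n) by case: (rA n).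
have mU n : measurable (U n) by case: (HU n).
exists U; split=> // [n|n|]; try by case: (HU n).
have mUA n : measurable (U n `\` A n) by exact: measurableD.
have mW : measurable (\bigcup_n (U n `\` A n)) by exact: bigcupT_measurable.
apply: le_trans (measure_sigma_subadditive k mUA mW (fun x h => h)) _.
apply: le_trans (epsilon_trick0 xpredT (ltW e0)).
by apply: lee_nneseries => // n _; case: (HU n) => _ _ _; rewrite natrX.
Qed.

Lemma outer_regular_bigcup (A : (set (mplane2 R))^nat) :
  (forall n, outer_regular (A n)) -> outer_regular (\bigcup_n A n).
Proof.
move=> rA; have mA n : measurable (A n) by case: (rA n).
split=> [|e e0]; first exact: bigcupT_measurable.
have [U [mU oU AU kU]] := outer_regular_seq e0 rA.
exists (\bigcup_n U n); split.
- exact: bigcupT_measurable.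
- exact: cube_open_bigcup.
- by move=> p [n _ /AU]; exists n.
apply: le_trans kU; apply: le_measure; rewrite ?inE.
- by apply: measurableD; exact: bigcupT_measurable.
- by apply: bigcupT_measurable => n; exact: measurableD.
by move=> p [[n _ Up] nA]; exists n => //; split=> // Ap; apply: nA; exists n.
Qed.

(** An infinite intersection of open sets need not be open. Since [k] is finite, it is continuous
    from above, so intersecting only the first N neighbourhoods costs at most [e / 2] more. *)
Lemma outer_regular_bigcap (A : (set (mplane2 R))^nat) :
  (forall n, outer_regular (A n)) -> outer_regular (\bigcap_n A n).
Proof.
move=> rA; have mA n : measurable (A n) by case: (rA n).
have mI : measurable (\bigcap_n A n) by exact: bigcapT_measurable.
split=> // e e0; have e20 : 0 < e / 2 by rewrite divr_gt0.
have [U [mU oU AU kU]] := outer_regular_seq e20 rA.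
pose B N := \bigcap_(n < N) A n.
have mB N : measurable (B N) by exact: fin_bigcap_measurable.
pose D N := B N `\` \bigcap_n A n.
have mD N : measurable (D N) by exact: measurableD.
have D0 : \bigcap_N D N = set0.
  apply/seteqP; split=> // p Dp; have [_] := Dp 0%N I; apply.
  move=> n _; have [Bp _] := Dp n.+1 I; exact: (Bp n (ltnSn n)).
have cD : k \o D @ \oo --> 0%E.
  rewrite -(measure0 k) -D0; apply: nonincreasing_cvg_mu => //.
  - apply: le_lt_trans kfin; apply: le_measure; rewrite ?inE //; exact: mD.
  - by rewrite D0.
  - move=> m n mn; apply/subsetPset => p [Bp nA]; split=> // i im.
    by apply: Bp => /=; exact: leq_trans mn.
have [N kD] : exists N, (k (D N) <= (e / 2)%:E)%E.
  move/fine_cvgP : cD => [fD /cvgrPdist_le cD].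
  have [N _ HN] := cD _ e20; have [N' _ HN'] := fD.
  exists (maxn N N').
  have := HN (maxn N N') (leq_maxl _ _); have fk := HN' (maxn N N') (leq_maxr _ _).
  rewrite sub0r normrN ger0_norm ?fine_ge0 //= => kN.
  by rewrite -[k _]/((k \o D) _) -(fineK fk) lee_fin.
exists (\bigcap_(n < N) U n); split.
- exact: fin_bigcap_measurable.
- exact: cube_open_bigcap.
- by move=> p Ap n _; apply: AU; exact: Ap.
have mW : measurable (\bigcup_n (U n `\` A n)).
  by apply: bigcupT_measurable => n; exact: measurableD.
have mUN : measurable (\bigcap_(n < N) U n) by exact: fin_bigcap_measurable.
rewrite (splitr e) EFinD.
apply: le_trans (leeD kU kD); apply: le_trans (measureU2 _ _ _) => //.
apply: le_measure; rewrite ?inE.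
- exact: measurableD.
- exact: measurableU.
move=> p [Up nA]; have [Bp|nB] := pselect (B N p); first by right.
left; move: nB => /existsNP[n /not_implyP[nN nAp]].
by exists n => //; split=> //; exact: Up.
Qed.

(** The sets that are outer regular together with their complements form a sigma-algebra. A
    half-space is open, and its complement is a countable intersection of open half-spaces. *)
Lemma measurable_outer_regular A : measurable A -> outer_regular A.
Proof.
suff H : measurable `<=` [set A | outer_regular A /\ outer_regular (~` A)].
  by move=> /H[].
apply: sigma_algebra_mplane2.
  split=> /=.
  - split; split=> //.
      by move=> e e0; exists set0; split=> //; rewrite setD0 measure0 lee_fin ltW.
    by rewrite setC0.
    move=> e e0; exists setT; split=> //; first by move=> p _; exists 1.
    by rewrite setC0 setDv measure0 lee_fin ltW.
  - by move=> B [B1 B2]; rewrite setTD setCK.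
  - move=> F HF; split; first by apply: outer_regular_bigcup => n; case: (HF n).
    rewrite setC_bigcup; apply: outer_regular_bigcap => n; by case: (HF n).
have ray i a : outer_regular [set p | a < coord4 i p].
  split=> [|e e0]; first exact: measurable_ray.
  exists [set p | a < coord4 i p]; split=> //; first exact: measurable_ray.
    exact: cube_open_ray.
  by rewrite setDv measure0 lee_fin ltW.
move=> i a /=; split=> //.
rewrite (_ : ~` _ = \bigcap_n [set p | coord4 i p < a + n.+1%:R^-1]).
  apply: outer_regular_bigcap => n; split=> [|e e0]; first exact: measurable_lray.
  exists [set p | coord4 i p < a + n.+1%:R^-1]; split=> //.
  - exact: measurable_lray.
  - exact: cube_open_lray.
  - by rewrite setDv measure0 lee_fin ltW.
apply/seteqP; split=> [p /negP|p Hp].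
  rewrite -leNgt => pa n _; apply: le_lt_trans pa _.
  by rewrite ltrDl invr_gt0.
apply/negP; rewrite -leNgt; apply/ler_addgt0Pr => e e0.
have [n _ Hn] := near_infty_natSinv_lt (PosNum e0).
apply: ltW; apply: lt_le_trans (Hp n I) _.
by rewrite lerD2l ltW //; exact: Hn (leqnn n).
Qed.

End OuterRegularity.

(** * From averages over small cubes to almost every point *)

Section CubeAverages.
Context {R : realType}.
Local Notation V := (cplane2 R).
Local Notation lam := (@lebesgue4 R).

Lemma lebesgue4_sigma_finite : sigma_finite setT lam.
Proof.
exists (fun n => cube 0 n%:R); last first.
  by move=> n; split; [exact: measurable_cube|rewrite lebesgue4_cube // ltry].
apply/seteqP; split=> // p _.
exists (Num.bound `|p|) => //; apply/cubeE; rewrite subr0 ltW //.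
exact: archi_boundP.
Qed.

HB.instance Definition _ := Measure_isSigmaFinite.Build _ _ _ lam
  lebesgue4_sigma_finite.

Definition near_diag (r : R) : set (mplane2 R * mplane2 R) :=
  [set z | cube z.1 r z.2].

Lemma cube_coord4E p r (q : V) : cube p r q <->
  forall i, (i < 4)%N -> `|coord4 i q - coord4 i p| <= r.
Proof.
have itvE (a x : R) : `[a - r, a + r]%classic x = (`|x - a| <= r).
  by rewrite /= in_itv /= ler_distl.
split=> [[[]+ +[]]|H].
  rewrite !itvE => a b c d.
  by case=> [|[|[|[|i]]]].
by split; split; rewrite itvE; [exact: (H 0%N)|exact: (H 1%N)|
  exact: (H 2%N)|exact: (H 3%N)].
Qed.

Lemma measurable_near_diag r : measurable (near_diag r).
Proof.
have mc i : measurable ((fun z : mplane2 R * mplane2 R =>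
    coord4 i z.2 - coord4 i z.1) @^-1` `[- r, r]).
  rewrite -[X in measurable X]setTI; apply: measurable_funB => //.
    by apply: measurableT_comp; [exact: measurable_coord|exact: measurable_snd].
  by apply: measurableT_comp; [exact: measurable_coord|exact: measurable_fst].
rewrite (_ : near_diag r = \bigcap_(i < 4) ((fun z : mplane2 R * mplane2 R =>
    coord4 i z.2 - coord4 i z.1) @^-1` `[- r, r])).
  by apply: fin_bigcap_measurable.
apply/seteqP; split=> -[p q].
  by move=> /cube_coord4E H i /= i4; rewrite in_itv /= -ler_norml; exact: H.
move=> H; apply/cube_coord4E => i i4.
by have := H i i4; rewrite /= in_itv /= -ler_norml.
Qed.

Lemma cube_sym (p q : V) r : cube p r q <-> cube q r p.
Proof. by rewrite !cubeE distrC. Qed.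

Variables (F : mplane2 R -> R) (D r0 : R).
Hypotheses (mF : measurable_fun setT F) (F0 : forall q, 0 <= F q).
Hypotheses (D0 : 0 <= D) (r00 : 0 < r0).
Hypothesis avgF : forall p r, 0 < r -> r < r0 ->
  (\int[lam]_(q in cube p r) (F q)%:E <= (D * (2 * r) ^+ 4)%:E)%E.

(** For q in an open [U] the small cubes at q end up inside [U], so [F q] is the limit of [fn n q],
    which is [F q] times the fraction of the cube lying in [U]. Tonelli turns the integral of [fn n]
    into averages of [F] over cubes centred in [U], each at most [D], and Fatou passes to the
    limit. *)
Lemma integral_cube_open U : measurable U -> cube_open U ->
  (\int[lam]_(q in U) (F q)%:E <= D%:E * lam U)%E.
Proof.
move=> mU oU.
(* With [n.+2] even the first radius is strictly less than [r0], as the hypothesis on averages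
   requires. *)
pose r n := r0 / n.+2%:R.
have r_gt0 n : 0 < r n by rewrite divr_gt0.
have r_lt n : r n < r0 by rewrite ltr_pdivrMr // ltr_pMr // ltr1n.
have c_gt0 n : 0 < (2 * r n) ^+ 4 by rewrite exprn_gt0 // mulr_gt0.
pose fn n q := (((2 * r n) ^+ 4)^-1%:E * ((F q)%:E * lam (U `&` cube q (r n))))%E.
pose H n (z : mplane2 R * mplane2 R) : \bar R :=
  (F z.2 * (\1_U z.1 * \1_(near_diag (r n)) z))%:E.
have mH n : measurable_fun setT (H n).
  apply/measurable_EFinP; apply: measurable_funM.
    by apply: measurableT_comp => //; exact: measurable_snd.
  apply: measurable_funM.
    by apply: measurableT_comp => //; exact: measurable_fst.
  by apply: measurable_indic; exact: measurable_near_diag.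
have H0 n z : (0 <= H n z)%E by rewrite lee_fin !mulr_ge0.
have fnE n q : fn n q =
    (((2 * r n) ^+ 4)^-1%:E * \int[lam]_p H n (p, q))%E.
  congr (_ * _)%E.
  have -> : (\int[lam]_p H n (p, q) =
      \int[lam]_p ((F q)%:E * (\1_(U `&` cube q (r n)) p)%:E))%E.
    apply: eq_integral => p _; rewrite /H /= indicI -EFinM.
    congr (_ * (_ * _))%:E; rewrite !indicE.
    by congr (_%:R); congr nat_of_bool; apply/idP/idP; rewrite !inE => /cube_sym.
  have mUq : measurable (U `&` cube q (r n)).
    by apply: measurableI => //; exact: measurable_cube.
  rewrite ge0_integralZl_EFin //; last exact/measurable_EFinP.
  by rewrite integral_indic ?setIT.
have mfn n : measurable_fun setT (fn n).
  rewrite (_ : fn n = fun q =>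
      ((((2 * r n) ^+ 4)^-1)%:E * \int[lam]_p H n (p, q))%E); last first.
    by apply/funext => q; exact: fnE.
  apply: measurable_funeM.
  exact: (measurable_fun_fubini_tonelli_G (H n) (mH n) (H0 n)).
have fn0 n q : (0 <= fn n q)%E.
  by rewrite !mule_ge0 // lee_fin ?invr_ge0 // ltW.
have intfn n : (\int[lam]_(q in U) fn n q <= D%:E * lam U)%E.
  apply: (@le_trans _ _ (\int[lam]_q fn n q)%E).
    by apply: ge0_subset_integral => //; exact: measurableT.
  rewrite (eq_integral _ _ (fun q _ => fnE n q)).
  rewrite ge0_integralZl_EFin //; last 3 first.
  - by move=> q _; exact: integral_ge0.
  - exact: (measurable_fun_fubini_tonelli_G (H n) (mH n) (H0 n)).
  - by rewrite invr_ge0 ltW.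
  rewrite -(@fubini_tonelli _ _ _ _ _ lam lam (H n)) //.
  apply: (@le_trans _ _ (((2 * r n) ^+ 4)^-1%:E *
      \int[lam]_p ((D * (2 * r n) ^+ 4)%:E * (\1_U p)%:E))%E).
    apply: lee_pmul => //.
    - by rewrite lee_fin invr_ge0 ltW.
    - by apply: integral_ge0 => p _; exact: integral_ge0.
    apply: ge0_le_integral => //.
    - by move=> p _; exact: integral_ge0.
    - exact: (measurable_fun_fubini_tonelli_F (H n) (mH n) (H0 n)).
    - by apply: measurable_funeM; exact/measurable_EFinP.
    move=> p _; rewrite /H /= indicE; case: (p \in U); last first.
      by rewrite mule0; under eq_integral do rewrite mul0r mulr0; rewrite integral0.
    rewrite mule1; apply: le_trans (avgF p (r_gt0 n) (r_lt n)).
    rewrite [leRHS]integral_mkcond; rewrite le_eqVlt; apply/orP; left; apply/eqP.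
    apply: eq_integral => q _.
    rewrite mul1r indicE patchE /=.
    rewrite (_ : (p, q) \in near_diag (r n) = (q \in cube p (r n))).
      by case: ifPn; rewrite ?mulr1 ?mulr0.
    by apply/idP/idP; rewrite !inE.
  rewrite ge0_integralZl_EFin //; last 2 first.
  - exact/measurable_EFinP.
  - by rewrite mulr_ge0 // ltW.
  rewrite integral_indic // setIT muleA -EFinM mulrCA mulVf ?mulr1 //.
  by rewrite gt_eqF.
have lim_fn q : U q -> limn_einf (fn ^~ q) = (F q)%:E.
  move=> Uq; have [e e0 eU] := oU q Uq.
  suff cv : fn ^~ q @ \oo --> (F q)%:E by rewrite (cvg_limn_einf_sup cv).1.
  apply: cvg_near_cst.
  have e1 : 0 < e / r0 by rewrite divr_gt0.
  near=> n.
  have rn : r n <= e.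
    rewrite /r mulrC -ler_pdivlMr //; apply/ltW.
    apply: (@le_lt_trans _ _ n.+1%:R^-1).
      by rewrite lef_pV2 ?posrE // ler_nat.
    by near: n; exact: near_infty_natSinv_lt (PosNum e1).
  rewrite /fn setIidr; last by apply: subset_trans eU; exact: cube_sub.
  rewrite lebesgue4_cube ?(ltW (r_gt0 n)) // -!EFinM mulrCA mulVf ?mulr1 //.
  by rewrite gt_eqF.
rewrite (eq_integral (fun q => limn_einf (fn ^~ q))); last first.
  by move=> q /set_mem Uq; rewrite lim_fn.
apply: le_trans (fatou _ mU _ _) _.
- by move=> n; exact: measurable_funTS.
- by move=> n q _.
rewrite limn_einf_lim; apply: lime_le; first exact: is_cvg_einfs.
near=> n; apply: le_trans (intfn n); apply: ereal_inf_lbound.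
by exists n => //=.
Unshelve. all: by end_near. Qed.

(** Let [F >= D + eta] on a bounded set [A k], and enclose it in an open set of almost the same
    measure. The estimate on open sets gives (D + eta) |A| <= D (|A| + small), hence |A| = 0. *)
Lemma ae_le_cube_averages : {ae lam, forall q, F q <= D}.
Proof.
pose A k := [set q | D + k.+1%:R^-1 <= F q] `&` cube 0 k%:R.
have mA k : measurable (A k).
  apply: measurableI; last exact: measurable_cube.
  rewrite (_ : mkset _ = F @^-1` `[D + k.+1%:R^-1, +oo[).
    by rewrite -[X in measurable X]setTI; exact: mF.
  by apply/seteqP; split=> q; rewrite /= in_itv /= andbT.
suff A0 k : lam (A k) = 0.
  exists (\bigcup_k A k); split; first exact: bigcupT_measurable.
    apply: measure_negligible; first exact: bigcupT_measurable.
    by apply: negligible_bigcup => k; exists (A k); split => //; exact: A0.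
  move=> q /negP; rewrite -ltNge => DF.
  have FD : 0 < F q - D by rewrite subr_gt0.
  have [n1 _ H1] := near_infty_natSinv_lt (PosNum FD).
  pose m := maxn n1 (Num.bound `|q|); exists m => //; split => /=.
    by rewrite -lerBrDl; exact/ltW/(H1 m (leq_maxl _ _)).
  apply/cubeE; rewrite subr0 ltW //.
  apply: lt_le_trans (archi_boundP (normr_ge0 q)) _.
  by rewrite ler_nat leq_maxr.
pose eta : R := k.+1%:R^-1.
have eta0 : 0 < eta by rewrite invr_gt0.
(* Regularity is proved for finite measures, so Lebesgue measure is restricted to a cube. The radius
   [k.+1] places [A k] inside the open ball [Q], where the restriction changes nothing. *)
pose c : R := k.+1%:R.
pose Q : set (mplane2 R) := [set p : V | `|p| < c].
have mQ : measurable Q.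
  rewrite (_ : Q = (fun p : V => `|p|) @^-1` `]-oo, c[).
    rewrite -[X in measurable X]setTI.
    by apply: (continuous_measurable_fun4 (@norm_continuous _ _)).
  by apply/seteqP; split=> p; rewrite /= in_itv.
have oQ : cube_open Q.
  move=> p Qp; exists ((c - `|p|) / 2); first by rewrite divr_gt0 ?subr_gt0.
  move=> q /cubeE qp; rewrite /Q /=.
  rewrite -(subrK p q) (le_lt_trans (ler_normD _ _)) //.
  by move: Qp; rewrite /Q /=; lra.
have mcc : measurable (cube (0 : V) c) by exact: measurable_cube.
have Qc : Q `<=` cube 0 c by move=> p Qp; apply/cubeE; rewrite subr0 ltW.
have AQ : A k `<=` Q.
  move=> p [_ /cubeE]; rewrite subr0 => pk; apply: le_lt_trans pk _.
  by rewrite ltr_nat.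
have kfin : (mrestr lam mcc setT < +oo)%E.
  by rewrite /mrestr setTI lebesgue4_cube ?ltry.
have [_ reg] := measurable_outer_regular kfin (mA k).
have finA : lam (A k) \is a fin_num.
  rewrite (ge0_fin_numE (measure_ge0 lam _)).
  have Ac : A k `<=` cube 0 c by exact: subset_trans AQ Qc.
  have := le_measure lam (mem_set (mA k)) (mem_set mcc) Ac.
  by move/le_lt_trans; apply; rewrite [ltLHS]lebesgue4_cube ?ltry.
apply/eqP; rewrite -(fineK finA) eqe eq_le fine_ge0 // andbT.
rewrite -(pmulr_rle0 _ eta0); apply/ler_addgt0Pr => e e0; rewrite add0r.
(* Dividing by [D + 1] and not by [D] allows [D = 0]; the excess still costs at most [e] after
   multiplication by [D]. *)
have e1 : 0 < e / (D + 1) by rewrite divr_gt0 // ltr_wpDl.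
have [U [mU oU AU kU]] := reg _ e1.
have mUQ : measurable (U `&` Q) by exact: measurableI.
have lamUQ : (lam ((U `&` Q) `\` A k) <= (e / (D + 1))%:E)%E.
  apply: le_trans kU; rewrite /= /mrestr; apply: le_measure; rewrite ?inE.
  - exact: measurableD.
  - by apply: measurableI => //; exact: measurableD.
  - by move=> p [[Up /Qc cp] nA]; split.
have := integral_cube_open mUQ (cube_openI oU oQ).
have -> : lam (U `&` Q) = (lam ((U `&` Q) `\` A k) + lam (A k))%E.
  rewrite (measureDI lam mUQ (mA k)) [X in (_ + lam X)%E = _]setIidr //.
  by move=> p Ap; split; [exact: AU|exact: AQ].
move=> H1.
have : ((D + eta)%:E * lam (A k) <= D%:E * ((e / (D + 1))%:E + lam (A k)))%E.
  apply: (@le_trans _ _ (\int[lam]_(q in U `&` Q) (F q)%:E)%E); last first.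
    apply: le_trans H1 _; apply: lee_wpmul2l; first by rewrite lee_fin.
    exact: leeD2r.
  apply: (@le_trans _ _ (\int[lam]_(q in A k) (F q)%:E)%E); last first.
    apply: ge0_subset_integral => //.
    - exact/measurable_funTS/measurable_EFinP.
    - by move=> q _; rewrite lee_fin.
    - by move=> p Ap; split; [exact: AU|exact: AQ].
  rewrite -integral_cst //; apply: ge0_le_integral => //.
  - by move=> q _; rewrite lee_fin addr_ge0 // ltW.
  - exact/measurable_funTS/measurable_EFinP.
  - by move=> q [/= + _]; rewrite lee_fin.
rewrite -(fineK finA) -EFinD -!EFinM lee_fin.
move: (fine _) => a.
have De : D * (e / (D + 1)) <= e.
  by rewrite mulrA ler_pdivrMr ?ltr_wpDl // mulrDr mulr1 mulrC lerDl ltW.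
rewrite mulrDl mulrDr => H2.
have := le_trans H2 (lerD De (lexx _)).
by rewrite addrC lerD2r.
Qed.

End CubeAverages.

(** * Radial functions of w and the logarithmic cutoffs *)

Section RadialCalculus.
Context {R : realType}.
Local Notation V := (cplane2 R).

Lemma is_derive_inv (x : R) : x != 0 -> is_derive x 1 GRing.inv (- x ^- 2).
Proof.
move=> x0; have := @is_deriveV R id x 1 1; rewrite /= /GRing.scale /= mulr1.
by apply.
Qed.

Lemma is_derive_invX (k : nat) (x : R) : x != 0 ->
  is_derive x 1 (fun y => y ^- k) (- (k%:R * x ^- k.+1)).
Proof.
move=> x0; have dv := is_derive_inv x0.
have := is_deriveX k dv.
rewrite (_ : GRing.inv ^+ k = fun y => y ^- k); last first.
  by apply/funext => y; rewrite fctE exprVn.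
move=> /is_derive_eq; apply; rewrite /GRing.scale /=.
case: k => [|k]; first by rewrite mulr0n !mul0r oppr0.
rewrite mulrN -mulrA; congr (- (_ * _)).
by rewrite /= -exprVn -exprVn -exprD addn2 exprVn.
Qed.

(** [Sq c] as a polynomial on R^4, with weight 0 on the two z-coordinates. *)
Definition SV (c : cplane R) : V -> R := quad (fun i => (2 <= i)%N%:R) 1 (0, c).

Definition gradSV (c : cplane R) (i : nat) (p : V) : R :=
  2 * (2 <= i)%N%:R * (coord4 i p - coord4 i ((0, c) : V)).

Lemma SVE c p : SV c p = Sq c p.2.
Proof.
rewrite /SV /quad !big_ord_recl big_ord0 /Sq /sqnorm /coord4 /=.
by rewrite !mul0r !mul1r !add0r addr0.
Qed.

Lemma SV_ge1 c p : 1 <= SV c p. Proof. by rewrite SVE Sq_ge1. Qed.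
Lemma SV_gt0 c p : 0 < SV c p. Proof. by rewrite SVE Sq_gt0. Qed.
Lemma SV_neq0 c p : SV c p != 0. Proof. by rewrite gt_eqF // SV_gt0. Qed.

Lemma smooth_SV c : smooth (SV c). Proof. exact: smooth_quad. Qed.

Lemma lapd_SV c : lapd (SV c) (gradSV c) (fun=> 4).
Proof.
apply: eq_lapd (lapd_quad _ _ _) _ _ _ => // p.
by rewrite !big_ord_recl big_ord0 /=; ring.
Qed.

Lemma sum_gradSV c p : \sum_(i < 4) gradSV c i p ^+ 2 = 4 * (SV c p - 1).
Proof.
rewrite /SV /quad addrC addKr mulr_sumr; apply: eq_bigr => i _.
by rewrite /gradSV; case: (2 <= i)%N => /=; ring.
Qed.

(** In the plane ln |w - c|^2 is harmonic away from c. The added 1 spreads the point mass at c into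
    the positive density 4 S_c^-2. *)
Lemma lapd_ln_SV c : lapd (fun p => ln (SV c p))
  (fun i p => (SV c p)^-1 * gradSV c i p) (fun p => 4 * SV c p ^- 2).
Proof.
have d1 p := is_derive1_ln (SV_gt0 c p).
have d2 p := is_derive_inv (SV_neq0 c p).
apply: eq_lapd (@lapd_comp _ _ _ (fun y => - y ^- 2) _ _ _ d1 d2 (lapd_SV c)) _ _ _ => // p.
by rewrite /= sum_gradSV; move: (SV c p) (SV_neq0 c p) => S S0; field.
Qed.

Lemma lapd_inv_SV c : lapd (fun p => (SV c p)^-1)
  (fun i p => - SV c p ^- 2 * gradSV c i p)
  (fun p => 4 * SV c p ^- 2 - 8 * SV c p ^- 3).
Proof.
have d1 p := is_derive_inv (SV_neq0 c p).
have d2 p : is_derive (SV c p) 1 (fun y => - y ^- 2) (2 * SV c p ^- 3).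
  have := is_deriveN (is_derive_invX 2 (SV_neq0 c p)).
  by move=> /is_derive_eq; apply; rewrite opprK.
apply: eq_lapd (@lapd_comp _ _ (fun y => - y ^- 2) (fun y => 2 * y ^- 3) _ _ _
  d1 d2 (lapd_SV c)) _ _ _ => // p.
by rewrite /= sum_gradSV; move: (SV c p) (SV_neq0 c p) => S S0; field.
Qed.

Lemma ln2_gt0 : 0 < ln 2 :> R. Proof. by rewrite ln_gt0 // ltr1n. Qed.

(* Logarithmic cutoffs: since the plane is parabolic, functions of
   log(1 + |w|^2) / N can cut off with Laplacians tending to 0 in L^1(X). *)
Definition chiarg (N : nat) (p : V) : R := 2 - (N%:R * ln 2)^-1 * ln (SV 0 p).
Definition chi (N : nat) (p : V) : R := flat 0 (chiarg N p).

Lemma chi_ge0 N p : 0 <= chi N p. Proof. exact: flat_ge0. Qed.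
Lemma chi_le1 N p : chi N p <= 1. Proof. exact: flat0_le1. Qed.

Lemma chiarg_le0 N p : (0 < N)%N -> 4 ^+ N <= SV 0 p -> chiarg N p <= 0.
Proof.
move=> N0 SN; rewrite subr_le0 mulrC ler_pdivlMr ?mulr_gt0 ?ltr0n ?ln2_gt0 //.
apply: le_trans (_ : ln (4 ^+ N) <= _); last first.
  by rewrite ler_ln ?posrE ?exprn_gt0 ?SV_gt0.
have four : 4 = 2 ^+ 2 :> R by ring.
have n2 : (0 : R) < 2 by [].
rewrite four -exprM lnXn // -[leRHS]mulr_natl natrM -mulrA.
by rewrite lexx.
Qed.

Lemma chi_eq0 N p : (0 < N)%N -> 4 ^+ N <= SV 0 p -> chi N p = 0.
Proof. by move=> N0 SN; rewrite /chi flat_eq0 // chiarg_le0. Qed.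

(** [chiarg] equals 2 at w = 0, 1 where S_0 = 2^N and 0 where S_0 = 4^N. The cutoff is never equal
    to 1, but on the inner region it is at least exp(-1), a lower bound independent of N. *)
Lemma chi_ge N p : (0 < N)%N -> SV 0 p <= 2 ^+ N -> expR (-1) <= chi N p.
Proof.
move=> N0 SN.
have t1 : 1 <= chiarg N p.
  suff : (N%:R * ln 2)^-1 * ln (SV 0 p) <= 1 by rewrite /chiarg; lra.
  rewrite mulrC ler_pdivrMr ?mulr_gt0 ?ltr0n ?ln2_gt0 // mul1r.
  have n2 : (0 : R) < 2 by [].
  by rewrite mulr_natl -lnXn // ler_ln ?posrE ?exprn_gt0 ?SV_gt0.
have t0 := lt_le_trans ltr01 t1.
rewrite /chi /flat t0 expr0 invr1 mul1r ler_expR lerN2 invf_le1 //.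
Qed.

Definition gradchi N i (p : V) : R :=
  flat 2 (chiarg N p) * (- (N%:R * ln 2)^-1 * ((SV 0 p)^-1 * gradSV 0 i p)).

Definition lapchi N (p : V) : R :=
  (flat 4 (chiarg N p) - 2 * flat 3 (chiarg N p)) *
    ((N%:R * ln 2) ^- 2 * (4 * (SV 0 p - 1) / SV 0 p ^+ 2)) -
  flat 2 (chiarg N p) * ((N%:R * ln 2)^-1 * (4 * SV 0 p ^- 2)).

Lemma lapd_chi N : lapd (chi N) (gradchi N) (lapchi N).
Proof.
have d1 p : is_derive (chiarg N p) 1 (flat 0) (flat 2 (chiarg N p)).
  apply: is_derive_eq (is_derive_flat 0 _) _; by rewrite mul0r subr0.
have d2 p := is_derive_flat 2 (chiarg N p).
have larg := lapdD (lapd_cst 2) (lapdZ (- (N%:R * ln 2)^-1) (lapd_ln_SV 0)).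
have {}larg : lapd (chiarg N)
   (fun i p => - (N%:R * ln 2)^-1 * ((SV 0 p)^-1 * gradSV 0 i p))
   (fun p => - (N%:R * ln 2)^-1 * (4 * SV 0 p ^- 2)).
  apply: eq_lapd larg _ _ _ => [p|i p _|p]; rewrite ?add0r //.
  by rewrite mulNr.
apply: eq_lapd (@lapd_comp _ _ (flat 2) (fun t => flat 4 t - 2 * flat 3 t) _ _ _
  d1 d2 larg) _ _ _ => // p.
rewrite /lapchi mulNr mulrN; congr (_ * _ - _).
have -> : \sum_(i < 4) (- (N%:R * ln 2)^-1 * ((SV 0 p)^-1 * gradSV 0 i p)) ^+ 2 =
    (N%:R * ln 2) ^- 2 * (SV 0 p ^- 2 * \sum_(i < 4) gradSV 0 i p ^+ 2).
  rewrite !mulr_sumr; apply: eq_bigr => i _.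
  by rewrite -!exprVn; ring.
rewrite sum_gradSV; congr (_ * _).
by rewrite mulrC.
Qed.

Lemma smooth_chi N : smooth (chi N).
Proof.
move=> n; apply: Cn_flat; apply: CnB; first exact: Cn_cst.
apply: CnM; first exact: Cn_cst.
by apply: Cn_ln; [exact: SV_gt0|exact: smooth_SV].
Qed.

(** 1240 = 4 * 310, where 310 = 4^4 + 2 * 3^3 bounds [flat 4 - 2 * flat 3] and 4 comes from the
    squared gradient of S_0. *)
Definition chi_const : R := 1240.

Lemma chi_const_ge0 : 0 <= chi_const. Proof. exact: ler0n. Qed.

(** The first term is the second derivative of [flat 0] against the squared gradient of ln S_0, of
    order N^-2 / S_0. The second is its first derivative, at most 2^2, against the Laplacian of ln
    S_0, of order N^-1 S_0^-2. *)
Lemma lapchi_le N p : (0 < N)%N -> `|lapchi N p| <=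
  chi_const * (N%:R * ln 2) ^- 2 * ((SV 0 p)^-1 * (SV 0 p < 4 ^+ N)%R%:R) +
  16 * (N%:R * ln 2)^-1 * SV 0 p ^- 2.
Proof.
move=> N0; have l0 : 0 < N%:R * ln 2 :> R by rewrite mulr_gt0 ?ltr0n ?ln2_gt0.
have S0 := SV_gt0 0 p; have S1 := SV_ge1 0 p.
have [SN|SN] := ltP (SV 0 p) (4 ^+ N); last first.
  rewrite /lapchi !flat_eq0 ?chiarg_le0 // mulr0 subr0 !mul0r subr0 normr0.
  by rewrite !mulr0 add0r !mulr_ge0 // ?invr_ge0 ?exprn_ge0 ?ltW.
move: l0; set l := _ * ln 2 => l0.
have li : 0 < l^-1 by rewrite invr_gt0.
have l2 : 0 < l ^- 2 by rewrite invr_gt0 exprn_gt0.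
have Si : 0 < (SV 0 p)^-1 by rewrite invr_gt0.
have S2 : 0 < SV 0 p ^- 2 by rewrite invr_gt0 exprn_gt0.
rewrite mulr1 /lapchi -/l; apply: le_trans (ler_normB _ _) _; apply: lerD.
  rewrite normrM (_ : chi_const * _ * _ = 310 * (l ^- 2 * (4 * (SV 0 p)^-1)));
    last by rewrite /chi_const; ring.
  have S3 : 0 <= (SV 0 p - 1) / SV 0 p ^+ 2 <= (SV 0 p)^-1.
    apply/andP; split; first by rewrite divr_ge0 ?subr_ge0 // exprn_ge0 // ltW.
    rewrite ler_pdivrMr ?exprn_gt0 // expr2 mulKf ?gt_eqF //; lra.
  apply: ler_pM => //.
    have := flat_le 4 (chiarg N p); have := flat_le 3 (chiarg N p).
    have := flat_ge0 4 (chiarg N p); have := flat_ge0 3 (chiarg N p).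
    rewrite (_ : 4%:R ^+ 4 = 256 :> R); last by ring.
    rewrite (_ : 3%:R ^+ 3 = 27 :> R); last by ring.
    by rewrite ler_norml => *; apply/andP; split; lra.
  move: S3 => /andP[S3 S3'].
  rewrite -[4 * _ / _]mulrA ger0_norm; last first.
    exact: mulr_ge0 (ltW l2) (mulr_ge0 (ler0n _ 4) S3).
  exact: (ler_wpM2l (ltW l2) (ler_wpM2l (ler0n _ 4) S3')).
rewrite ger0_norm; last by rewrite !mulr_ge0 ?flat_ge0 // ltW.
rewrite (_ : 16 * _ * _ = 4 * (l^-1 * (4 * SV 0 p ^- 2))); last by ring.
apply: ler_wpM2r; first by rewrite !mulr_ge0 // ltW.
by have := flat_le 2 (chiarg N p); rewrite (_ : 2%:R ^+ 2 = 4 :> R) //; ring.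
Qed.

End RadialCalculus.

(** * Test functions, integrability and linearity of the pairing *)

Section TestFunctions.
Context {R : realType} (L : lattice R).
Local Notation V := (cplane2 R).
Local Notation mu := (dvolX L).
Implicit Types (f h : quotX L -> R).

Lemma smooth_lapd (g : V -> R) : smooth g ->
  lapd g (fun i => 'D_(dir4 i) g) (fun p => \sum_(i < 4) D2 g (dir4 i) p).
Proof.
move=> sg; exists (fun i => D2 g (dir4 i)); split=> // i _ p.
have [_ /(_ (dir4 i)) [d1 [_ /(_ (dir4 i)) [d2 _]]]] := sg 2%N.
by split; exact/derivableP.
Qed.

Lemma continuous_flat_lap (g : V -> R) : smooth g -> continuous (flat_lap g).
Proof.
move=> sg.
have -> : flat_lap g = fun p => - ((\sum_(i < 4) D2 g (dir4 i) p) / 2).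
  by apply/funext => p; exact: flat_lapE (smooth_lapd sg).
have c i : continuous (D2 g (dir4 i)).
  by have [_ /(_ (dir4 i)) [_ [_ /(_ (dir4 i)) [_ []]]]] := sg 2%N.
move=> p; apply: cvgN; apply: cvgMl; under eq_cvg do rewrite !big_ord_recl big_ord0.
by rewrite !big_ord_recl big_ord0; do !apply: cvgD; try exact: c; exact: cvg_cst.
Qed.

Lemma flat_lap_near0 (g : V -> R) p : (\forall q \near p, g q = 0) ->
  flat_lap g p = 0.
Proof.
move=> g0.
have D20 v : D2 g v p = 0.
  rewrite /D2 (near_eq_derive (g := fun=> 0)) ?derive_cst //.
  have := nbhs_interior g0; apply: filterS => q qg.
  by rewrite (near_eq_derive (g := fun=> 0)) ?derive_cst.
rewrite /flat_lap /dzdzbar /dwdwbar (D20 ((1, 0), 0)) (D20 ((0, 1), 0)).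
by rewrite (D20 (0, (1, 0))) (D20 (0, (0, 1))) !addr0 !mulr0 addr0 oppr0.
Qed.

Lemma continuous_lapX h : smooth (h \o piX L) -> continuous (lapX h).
Proof.
move=> sh; apply/quotient_continuous.
rewrite (_ : _ \o _ = flat_lap (h \o piX L)); first exact: continuous_flat_lap.
by apply/funext => p; exact: lapX_piX.
Qed.

Lemma continuous_measurable_quotX f : continuous f -> measurable_fun setT f.
Proof.
move=> cf; apply: measurable_fun_quotX; apply: continuous_measurable_fun4.
by apply/quotient_continuous.
Qed.

Lemma test_fun_measurable h : test_fun h -> measurable_fun setT h.
Proof.
move=> [sh _]; apply: continuous_measurable_quotX.
by apply/quotient_continuous; have [] := sh 0%N.
Qed.

Lemma lapX_measurable h : test_fun h -> measurable_fun setT (lapX h).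
Proof.
by move=> [sh _]; apply: continuous_measurable_quotX; exact: continuous_lapX.
Qed.

(** Domination by a multiple of the indicator of a set of finite volume: the form of compact support
    from which integrability follows at once. *)
Definition ball_bounded h := exists r C, forall x,
  `|h x| <= C * \1_(@ballX R L 0 r) x.

Lemma ball_boundedP h r M : (forall x, r < `|wX x| -> h x = 0) ->
  (forall x, `|wX x| <= r -> `|h x| <= M) -> ball_bounded h.
Proof.
move=> h0 hM; exists r, M => x; rewrite indicE.
have [xr|xr] := leP (`|wX x|) r.
  by rewrite mem_set ?mulr1 ?hM // /ballX /= subr0.
rewrite memNset ?mulr0 ?h0 ?normr0 // /ballX /= subr0.
by apply/negP; rewrite -ltNge.
Qed.

Lemma test_fun_ball_bounded h : test_fun h -> ball_bounded h.
Proof.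
by move=> /test_fun_bounded [r [M [h0 hM]]]; exact: ball_boundedP h0 (fun x _ => hM x).
Qed.

Lemma lapX_ball_bounded h : test_fun h -> ball_bounded (lapX h).
Proof.
move=> th; have [r [M [h0 _]]] := test_fun_bounded th; have [sh _] := th.
have cK := continuous_compact (continuous_subspaceT (continuous_lapX sh))
  (@compact_wX_ball R L r).
have [C [_ HC]] := compact_bounded cK.
apply: (@ball_boundedP _ r (C + 1)) => x xr; last first.
  by apply: (HC (C + 1)); [rewrite ltrDl|exists x].
rewrite -(reprXK x) lapX_piX; apply: flat_lap_near0.
have cn : continuous (fun p : V => `|p.2|).
  move=> p; apply: continuous_comp; first exact: cvg_snd.
  exact: norm_continuous.
(* Since this set is open, [h] vanishes on a whole neighbourhood of each of its points, and so does
   its Laplacian at the point. *)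
have op : open [set q : V | r < `|q.2|].
  have /continuousP := cn; move=> /(_ [set y | r < y]); apply; exact: open_gt.
have := op; rewrite openE => /(_ (reprX x) xr).
by apply: filterS => q rq; rewrite /= h0 // wX_piX.
Qed.

Lemma ball_bounded_integrable f : measurable_fun setT f -> ball_bounded f ->
  mu.-integrable setT (EFin \o f).
Proof.
move=> mf [r [C fC]].
apply: (@le_integrable _ _ _ mu _ measurableT _ (EFin \o (fun x => C * \1_(@ballX R L 0 r) x))).
- exact/measurable_EFinP.
- move=> x _; rewrite /= lee_fin; apply: le_trans (fC x) (ler_norm _).
rewrite (_ : _ \o _ = fun x => C%:E * (\1_(@ballX R L 0 r) x)%:E)%E //.
apply: integrableZl => //; apply/integrableP; split.
  by apply/measurable_EFinP; apply: measurable_indic; exact: measurable_ballX.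
under eq_integral do rewrite gee0_abs ?lee_fin //.
rewrite integral_indic ?setIT; [|exact: measurableT|exact: measurable_ballX].
(* The volume formula needs a nonnegative radius, while [r] may be negative. *)
apply: (@le_lt_trans _ _ (mu (@ballX R L 0 `|r|))).
  apply: le_measure; rewrite ?inE; try exact: measurable_ballX.
  by move=> x /le_trans; apply; exact: ler_norm.
by rewrite dvolX_ballX // ltry.
Qed.

Lemma ball_boundedM f g M : (forall x, `|f x| <= M) -> ball_bounded g ->
  ball_bounded (fun x => f x * g x).
Proof.
move=> fM [r [C gC]]; exists r, (M * C) => x.
by rewrite normrM -mulrA; apply: ler_pM.
Qed.

Lemma test_funD h1 h2 : test_fun h1 -> test_fun h2 ->
  test_fun (fun x => h1 x + h2 x).
Proof.
move=> t1 t2; have [s1 _] := t1; have [s2 _] := t2.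
have [r1 [_ [z1 _]]] := test_fun_bounded t1.
have [r2 [_ [z2 _]]] := test_fun_bounded t2.
rewrite (_ : (fun x => _) = (fun x => h1 x + h2 x) \o piX L \o @reprX R L).
  apply: (@test_funP _ _ _ (Num.max r1 r2)).
  - exact: periodic_comp_piX.
  - by move=> n; apply: CnD; [exact: s1|exact: s2].
  - move=> p; rewrite gt_max => /andP[a b] /=.
    by rewrite z1 ?z2 ?addr0 // wX_piX.
by apply/funext => x; rewrite /= !reprXK.
Qed.

Lemma test_funZ (c : R) h : test_fun h -> test_fun (fun x => c * h x).
Proof.
move=> t1; have [s1 _] := t1; have [r1 [_ [z1 _]]] := test_fun_bounded t1.
rewrite (_ : (fun x => _) = (fun x => c * h x) \o piX L \o @reprX R L).
  apply: (@test_funP _ _ _ r1).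
  - exact: periodic_comp_piX.
  - by move=> n; apply: CnM; [exact: Cn_cst|exact: s1].
  - by move=> p a /=; rewrite z1 ?mulr0 // wX_piX.
by apply/funext => x; rewrite /= !reprXK.
Qed.

Lemma lapXD h1 h2 x : test_fun h1 -> test_fun h2 ->
  lapX (fun x => h1 x + h2 x) x = lapX h1 x + lapX h2 x.
Proof.
move=> [s1 _] [s2 _]; have l1 := smooth_lapd s1; have l2 := smooth_lapd s2.
apply: etrans (flat_lapE _ (lapdD l1 l2)) _.
by rewrite /lapX (flat_lapE _ l1) (flat_lapE _ l2) mulrDl opprD.
Qed.

Lemma lapXZ (c : R) h x : test_fun h -> lapX (fun x => c * h x) x = c * lapX h x.
Proof.
move=> [s1 _]; have l1 := smooth_lapd s1.
by rewrite /lapX (flat_lapE _ l1) (flat_lapE _ (lapdZ c l1)); ring.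
Qed.

Lemma integrable_lap f h M : measurable_fun setT f -> (forall x, `|f x| <= M) ->
  test_fun h -> mu.-integrable setT (EFin \o (fun x => f x * lapX h x)).
Proof.
move=> mf fM th; apply: ball_bounded_integrable.
  by apply: measurable_funM => //; exact: lapX_measurable.
exact: ball_boundedM fM (lapX_ball_bounded th).
Qed.

Lemma distr_lapD f h1 h2 M : measurable_fun setT f -> (forall x, `|f x| <= M) ->
  test_fun h1 -> test_fun h2 ->
  distr_lap f (fun x => h1 x + h2 x) = distr_lap f h1 + distr_lap f h2.
Proof.
move=> mf fM t1 t2; rewrite /distr_lap -RintegralD //;
  try exact: integrable_lap fM _.
by apply: eq_Rintegral => x _; rewrite lapXD // mulrDr.
Qed.

Lemma distr_lapZ f (c : R) h M : measurable_fun setT f -> (forall x, `|f x| <= M) ->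
  test_fun h -> distr_lap f (fun x => c * h x) = c * distr_lap f h.
Proof.
move=> mf fM th; rewrite /distr_lap -RintegralZl //; last exact: integrable_lap fM _.
by apply: eq_Rintegral => x _; rewrite lapXZ // mulrCA.
Qed.

Lemma Rintegral_aeM f f' g : measurable_fun setT f -> measurable_fun setT f' ->
  measurable_fun setT g -> {ae mu, forall x, f x = f' x} ->
  \int[mu]_x (f x * g x) = \int[mu]_x (f' x * g x).
Proof.
move=> mf mf' mg ff'; rewrite /Rintegral; congr fine.
apply: ae_eq_integral => //.
- by apply/measurable_EFinP; exact: measurable_funM.
- by apply/measurable_EFinP; exact: measurable_funM.
by apply: filterS ff' => x -> _.
Qed.

(** Changes an essentially bounded function only on a null set and makes its bounds hold
    everywhere. *)
Definition clip (a b : R) f (x : quotX L) : R := Num.max a (Num.min b (f x)).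

Lemma clip_itv a b f x : a <= b -> a <= clip a b f x <= b.
Proof. by move=> ab; rewrite /clip le_max lexx ge_max ab ge_min lexx. Qed.

Lemma clip_id a b f x : a <= f x -> f x <= b -> clip a b f x = f x.
Proof. by move=> af fb; rewrite /clip min_r // max_r. Qed.

Lemma measurable_clip a b f : measurable_fun setT f ->
  measurable_fun setT (clip a b f).
Proof.
by move=> mf; apply: measurable_maxr => //; exact: measurable_minr.
Qed.

Lemma le_Rintegral_bound (F : quotX L -> R) c : measurable_fun setT F ->
  (forall x, 0 <= F x) -> (\int[mu]_x (F x)%:E <= c%:E)%E ->
  mu.-integrable setT (EFin \o F) /\ \int[mu]_x F x <= c.
Proof.
move=> mF F0 Fc.
have fin : (\int[mu]_x (F x)%:E < +oo)%E by exact: le_lt_trans Fc (ltry _).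
split.
  apply/integrableP; split; first exact/measurable_EFinP.
  by under eq_integral do rewrite /= ger0_norm //.
have F0' : (0 <= \int[mu]_x (F x)%:E)%E.
  by apply: integral_ge0 => x _; rewrite lee_fin.
by rewrite /Rintegral -lee_fin fineK // ge0_fin_numE.
Qed.

End TestFunctions.

(** * Parabolicity and the Liouville property *)

Section Liouville.
Context {R : realType} (L : lattice R).
Local Notation V := (cplane2 R).
Local Notation mu := (dvolX L).

Lemma SV_repr (c : cplane R) (x : quotX L) : SV c (reprX x) = Sq c (wX x).
Proof. by rewrite SVE. Qed.

Lemma periodic_snd (T : Type) (g : V -> T) :
  (forall p q : V, p.2 = q.2 -> g p = g q) -> lattice_periodic L g.
Proof. by move=> gE chi p _; exact: gE. Qed.

Lemma SV_snd (c : cplane R) (p q : V) : p.2 = q.2 -> SV c p = SV c q.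
Proof. by move=> pq; rewrite !SVE pq. Qed.

Lemma periodic_chi N : lattice_periodic L (chi N).
Proof. by apply: periodic_snd => p q pq; rewrite /chi /chiarg (SV_snd 0 pq). Qed.

Definition chiX N : quotX L -> R := chi N \o @reprX R L.

Lemma SV_large N (p : V) : 2 ^+ N < `|p.2| -> 4 ^+ N <= SV 0 p.
Proof.
move=> pN; rewrite leNgt; apply/negP => SN; move: pN; apply/negP; rewrite -leNgt.
apply: norm_lt_sqnorm; first by rewrite exprn_ge0.
have four : 4 = 2 ^+ 2 :> R by ring.
rewrite exprAC -four; apply: ltW; apply: le_lt_trans SN.
by rewrite SVE /Sq subr0 lerDr.
Qed.

Lemma test_chiX N : (0 < N)%N -> test_fun (chiX N).
Proof.
move=> N0; apply: (@test_funP _ _ _ (2 ^+ N)).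
- exact: periodic_chi.
- exact: smooth_chi.
- by move=> p pN; apply: chi_eq0 => //; exact: SV_large.
Qed.

Lemma lapX_chiX N x : lapX (chiX N) x = - (lapchi N (reprX x) / 2).
Proof.
by rewrite lapX_repr; [exact: flat_lapE (lapd_chi N)|exact: periodic_chi].
Qed.

Definition cut_error N (x : quotX L) : R :=
  chi_const * (N%:R * ln 2) ^- 2 * ((Sq 0 (wX x))^-1 * (Sq 0 (wX x) < 4 ^+ N)%R%:R) +
  16 * (N%:R * ln 2)^-1 * Sq 0 (wX x) `^ (- 2).

Lemma cut_error_ge0 N x : 0 <= cut_error N x.
Proof.
have l0 : 0 <= N%:R * ln 2 :> R by rewrite mulr_ge0 // ltW // ln2_gt0.
have S0 := ltW (Sq_gt0 0 (wX x)).
by rewrite addr_ge0 // !mulr_ge0 ?powR_ge0 ?chi_const_ge0 // ?invr_ge0 // exprn_ge0.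
Qed.

Lemma lapX_chiX_le N x : (0 < N)%N -> `|lapX (chiX N) x| <= cut_error N x.
Proof.
move=> N0; rewrite lapX_chiX normrN normrM normfV (@ger0_norm _ 2) //.
have := lapchi_le (reprX x) N0; rewrite !SV_repr => H.
rewrite ler_pdivrMr //; apply: (@le_trans _ _ (cut_error N x)).
  by rewrite /cut_error powR_invn // ltW // Sq_gt0.
by rewrite mulr_natr mulr2n lerDl cut_error_ge0.
Qed.

Lemma measurable_Sq_powR b :
  measurable_fun setT (fun x : quotX L => Sq 0 (wX x) `^ b).
Proof. exact: (measurableT_comp (measurable_powR b) (measurable_Sq 0)). Qed.

Lemma measurable_cut_error N : measurable_fun setT (cut_error N).
Proof.
apply: measurable_funD; apply: measurable_funM => //; last exact: measurable_Sq_powR.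
apply: measurable_funM; last exact: measurable_Sq_lt.
rewrite (_ : (fun x => _) = fun x : quotX L => Sq 0 (wX x) `^ (- 1)).
  exact: measurable_Sq_powR.
by apply/funext => x; rewrite powR_inv1 // ltW // Sq_gt0.
Qed.

Lemma Sq_powR_fin b : 1 < b -> exists2 K : R, 0 <= K &
  (\int[mu]_x (Sq 0 (wX x) `^ (- b))%:E <= K%:E)%E.
Proof.
move=> b1; have := @integral_Sq_powR _ L _ b1.
have I0 : (0 <= \int[mu]_x (Sq 0 (wX x) `^ (- b))%:E)%E.
  by apply: integral_ge0 => x _; rewrite lee_fin powR_ge0.
move: I0; case: integral => [K|//|//] K0 _.
by exists K; rewrite -?lee_fin.
Qed.

(** Parabolicity in quantitative form: the coefficient N^-2 meets an integral that grows like N, and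
    the coefficient N^-1 meets a convergent one. *)
Lemma integral_cut_error : exists2 Z : R, 0 <= Z & forall N, (0 < N)%N ->
  mu.-integrable setT (EFin \o cut_error N) /\
  \int[mu]_x cut_error N x <= Z / N%:R.
Proof.
have two1 : (1 : R) < 2 by rewrite ltr1n.
have [K K0 HK] := Sq_powR_fin two1.
have l2 := @ln2_gt0 R; have a0 := cell_volume_ge0 L.
exists (chi_const * 16 * cell_volume L / ln 2 ^+ 2 + 16 * K / ln 2).
  by rewrite addr_ge0 // !mulr_ge0 ?chi_const_ge0 // ?invr_ge0 ?exprn_ge0 // ltW.
move=> N N0; apply: le_Rintegral_bound.
- exact: measurable_cut_error.
- exact: cut_error_ge0.
have nN : (0 : R) < N%:R by rewrite ltr0n.
have l0 : 0 < N%:R * ln 2 :> R by rewrite mulr_gt0.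
set l := N%:R * ln 2 in l0 *.
have mA : measurable_fun setT (fun x : quotX L =>
    (Sq 0 (wX x))^-1 * (Sq 0 (wX x) < 4 ^+ N)%R%:R).
  apply: measurable_funM; last exact: measurable_Sq_lt.
  rewrite (_ : (fun x => _) = fun x : quotX L => Sq 0 (wX x) `^ (- 1)).
    exact: measurable_Sq_powR.
  by apply/funext => x; rewrite powR_inv1 // ltW // Sq_gt0.
have c1 : 0 <= chi_const * l ^- 2 by rewrite mulr_ge0 ?chi_const_ge0 // invr_ge0 exprn_ge0 // ltW.
have c2 : 0 <= 16 * l^-1 by rewrite mulr_ge0 // invr_ge0 ltW.
have A0 x : 0 <= (Sq 0 (wX x : cplane R))^-1 * (Sq 0 (wX x) < 4 ^+ N)%R%:R.
  by rewrite mulr_ge0 // invr_ge0 ltW // Sq_gt0.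
rewrite /cut_error -/l.
under eq_integral do rewrite EFinD.
rewrite ge0_integralD //; last 4 first.
- by move=> x _; rewrite lee_fin mulr_ge0.
- by apply/measurable_EFinP; apply: measurable_funM.
- by move=> x _; rewrite lee_fin mulr_ge0 // powR_ge0.
- by apply/measurable_EFinP; apply: measurable_funM => //; exact: measurable_Sq_powR.
under eq_integral do rewrite EFinM.
under [X in (_ + X)%E]eq_integral do rewrite EFinM.
rewrite !ge0_integralZl_EFin //; last 4 first.
- by move=> x _; rewrite lee_fin powR_ge0.
- by apply/measurable_EFinP; exact: measurable_Sq_powR.
- by move=> x _; rewrite lee_fin.
- exact/measurable_EFinP.
apply: (@le_trans _ _ ((chi_const * l ^- 2)%:E * (16 * cell_volume L * N%:R)%:E +
    (16 * l^-1)%:E * K%:E)%E).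
  apply: leeD; apply: lee_wpmul2l; rewrite ?lee_fin //.
  exact: integral_Sq_inv.
rewrite -!EFinM -EFinD lee_fin le_eqVlt; apply/orP; left; apply/eqP.
rewrite /l; field; by rewrite !gt_eqF.
Qed.

(** On the ball |w| <= r that supports [h], S_0 is at most 1 + 2 r^2, hence at most 2^N for large N.
    There the cutoff is at least exp(-1), so [A = M * expR 1] works for all such N. *)
Lemma chiX_dominates (h : quotX L -> R) : test_fun h ->
  exists A : R, 0 <= A /\ exists N0, forall N, (N0 <= N)%N -> (0 < N)%N ->
  forall x, `|h x| <= A * chiX N x.
Proof.
move=> th; have [r [M [h0 hM]]] := test_fun_bounded th.
have M0 : 0 <= M by apply: le_trans (hM (piX L 0)).
exists (M * expR 1); split; first by rewrite mulr_ge0 // expR_ge0.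
exists (Num.bound (1 + 2 * r ^+ 2)) => N N0N Npos x.
have c0 : 0 <= chiX N x by exact: chi_ge0.
have [xr|xr] := leP (`|wX x|) r; last first.
  by rewrite h0 // normr0 !mulr_ge0 // expR_ge0.
apply: le_trans (hM x) _; rewrite -mulrA ler_peMr //.
rewrite mulrC -ler_pdivrMr ?expR_gt0 // mul1r -expRN.
apply: chi_ge => //; rewrite SV_repr /Sq subr0 /sqnorm.
have r0 : 0 <= r by apply: le_trans xr.
have sq (y : R) : `|y| <= r -> y ^+ 2 <= r ^+ 2.
  by move=> yr; rewrite -[y ^+ 2]real_normK ?num_real // ler_pXn2r ?nnegrE.
have w1 : `|(wX x).1| <= r by apply: le_trans xr; rewrite prod_normE le_max lexx.
have w2 : `|(wX x).2| <= r.
  by apply: le_trans xr; rewrite prod_normE le_max lexx orbT.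
apply: (@le_trans _ _ (1 + 2 * r ^+ 2)).
  by have := sq _ w1; have := sq _ w2; lra.
apply: ltW; have B0 : 0 <= 1 + 2 * r ^+ 2 by rewrite addr_ge0 // mulr_ge0 // sqr_ge0.
apply: lt_le_trans (archi_boundP B0) _.
by rewrite -natrX ler_nat; apply: leq_trans N0N (ltnW (ltn_expl _ _)).
Qed.

Lemma distr_lap_chiX_le (f : quotX L -> R) (M : R) N : measurable_fun setT f ->
  (forall x, `|f x| <= M) ->
  (0 < N)%N -> mu.-integrable setT (EFin \o cut_error N) ->
  `|distr_lap f (chiX N)| <= M * \int[mu]_x cut_error N x.
Proof.
move=> mf fM N0 iE; rewrite /distr_lap.
have il := integrable_lap mf fM (test_chiX N0).
apply: le_trans (le_normr_Rintegral measurableT il) _.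
rewrite -RintegralZl //; apply: le_Rintegral => //.
- have := integrable_norm il; by apply: eq_integrable.
- by have := integrableZl measurableT M iE; apply: eq_integrable.
by move=> x _; rewrite normrM; apply: ler_pM => //; exact: lapX_chiX_le.
Qed.

Lemma distr_lap_sub0 (f : quotX L -> R) : ess_bounded f -> distr_le (distr_lap f) (fun=> 0) ->
  distr_eq (distr_lap f) (fun=> 0).
Proof.
move=> [mf [M0 fM0]] fle h th.
pose M := Num.max M0 0.
have M_ge0 : 0 <= M by rewrite le_max lexx orbT.
pose f' := clip (- M) M f.
have mf' : measurable_fun setT f' by exact: measurable_clip.
have NM : - M <= M by rewrite (le_trans _ M_ge0) // oppr_le0.
have fM x : `|f' x| <= M by rewrite ler_norml; exact: clip_itv.
have ff' : {ae mu, forall x, f x = f' x}.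
  apply: filterS fM0 => x fx; rewrite /f' clip_id //.
    by rewrite lerNl (le_trans (ler_norm _)) // normrN (le_trans fx) // le_max lexx.
  by rewrite (le_trans (ler_norm _)) // (le_trans fx) // le_max lexx.
have lapE k : test_fun k -> distr_lap f k = distr_lap f' k.
  by move=> tk; apply: Rintegral_aeM => //; exact: lapX_measurable.
rewrite lapE //.
have [A [A0 [N0 hA]]] := chiX_dominates th.
have [Z Z0 HZ] := integral_cut_error.
(* [A] and [M] do not depend on N, so the right-hand side tends to 0. The two signs of [s] below
   bound the pairing from above and from below. *)
have key N : (N0 <= N)%N -> (0 < N)%N -> `|distr_lap f' h| <= A * (M * (Z / N%:R)).
  move=> N0N Npos; have tc := test_chiX Npos.
  have tA := test_funZ A tc.
  have [iE IE] := HZ N Npos.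
  have le1 := distr_lap_chiX_le mf' fM Npos iE.
  have le2 : A * `|distr_lap f' (chiX N)| <= A * (M * (Z / N%:R)).
    by apply: ler_wpM2l => //; apply: le_trans le1 _; exact: ler_wpM2l.
  have pos s : `|s| = 1 -> s * distr_lap f' h <= A * `|distr_lap f' (chiX N)|.
    move=> s1; have tk := test_funD tA (test_funZ s th).
    have := fle _ tk; rewrite lapE // (distr_lapD mf' fM) //; last exact: test_funZ.
    rewrite (distr_lapZ _ mf' fM) // (distr_lapZ _ mf' fM) // => H.
    have : A * distr_lap f' (chiX N) + s * distr_lap f' h <= 0.
      apply: H => x; have := hA N N0N Npos x.
      have := ler_norm (- (s * h x)); rewrite normrN normrM s1 mul1r; lra.
    have : - (A * distr_lap f' (chiX N)) <= A * `|distr_lap f' (chiX N)|.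
      by rewrite -mulrN ler_wpM2l // -normrN ler_norm.
    move=> H2 H1; apply: le_trans H2.
    by rewrite -subr_le0 opprK addrC.
  apply: le_trans le2; rewrite ler_norml; apply/andP; split.
    by have := pos (-1); rewrite normrN1 mulN1r lerNl => /(_ erefl).
  by have := pos 1; rewrite normr1 mul1r => /(_ erefl).
apply/eqP; rewrite -normr_le0; apply/ler_addgt0Pr => e e0; rewrite add0r.
pose n := maxn N0 (Num.bound (A * (M * Z) / e)).+1.
have n0 : (0 < n)%N by rewrite /n leq_max orbT.
apply: le_trans (key n (leq_maxl _ _) n0) _.
have -> : A * (M * (Z / n%:R)) = A * (M * Z) / n%:R by rewrite !mulrA.
rewrite ler_pdivrMr ?ltr0n // [e * _]mulrC -ler_pdivrMr //.
have B0 : 0 <= A * (M * Z) / e by rewrite !mulr_ge0 // invr_ge0 ltW.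
apply: ltW; apply: lt_le_trans (archi_boundP B0) _.
by rewrite ler_nat /n (leq_trans (leqnSn _)) // leq_maxr.
Qed.

End Liouville.

(** * The positive function [hdual] centred at c *)

Section DualFunction.
Context {R : realType} (c : cplane R).
Local Notation V := (cplane2 R).
Local Notation s := (SV 0).
Local Notation t := (SV c).
Local Notation k := (Sq 0 c).

(** Peetre's inequality: the difference of the two sides is 1 + |a + b|^2 + 2 |a|^2 |b|^2. *)
Lemma Sq_sub (a b : cplane R) : Sq 0 (a - b) <= 2 * Sq 0 a * Sq 0 b.
Proof.
case: a b => [a1 a2] [b1 b2]; rewrite /Sq !subr0 /sqnorm /= -subr_ge0.
set z := (X in 0 <= X); have -> : z = 1 + (a1 + b1) ^+ 2 + (a2 + b2) ^+ 2 +
    2 * (a1 ^+ 2 + a2 ^+ 2) * (b1 ^+ 2 + b2 ^+ 2) by rewrite /z; ring.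
apply: addr_ge0; first by rewrite !addr_ge0 ?sqr_ge0.
by apply: mulr_ge0; [apply: mulr_ge0 => //|]; rewrite addr_ge0 ?sqr_ge0.
Qed.

Lemma SqE (w : cplane R) : Sq c w = Sq 0 (w - c).
Proof. by rewrite /Sq subr0. Qed.

Lemma SqN (w : cplane R) : Sq 0 (- w) = Sq 0 w.
Proof. by rewrite /Sq !subr0 /sqnorm /= !sqrrN. Qed.

Lemma t_le p : t p <= 2 * s p * k.
Proof. by rewrite !SVE SqE; exact: Sq_sub. Qed.

Lemma k_le p : k <= 2 * s p * t p.
Proof. by rewrite !SVE SqE -[X in Sq 0 X <= _](subKr p.2); exact: Sq_sub. Qed.

Lemma s_le p : s p <= 2 * t p * k.
Proof.
by rewrite !SVE SqE -{1}[p.2](subrK c) -[c in _ + c]opprK -(SqN c); exact: Sq_sub.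
Qed.

Lemma ln2_le1 : ln 2 <= 1 :> R.
Proof.
have N1 : -1 < 1 :> R by rewrite (lt_trans (ltrN10 R)) // ltr01.
by have := le_ln1Dx N1.
Qed.

Lemma ln_le_mul (x y z : R) : 0 < x -> 0 < y -> 0 < z -> x <= 2 * y * z ->
  ln x <= 1 + ln y + ln z.
Proof.
move=> x0 y0 z0 xyz.
have n2 : (0 : R) < 2 by [].
have : ln x <= ln (2 * y * z) by rewrite ler_ln ?posrE ?mulr_gt0.
rewrite !lnM ?posrE ?mulr_gt0 // => H; apply: le_trans H _.
by rewrite !lerD2r ln2_le1.
Qed.

(* The term - ln t has Laplacian - 4 / t^2, negative near w = c; ln s cancels its
   growth at infinity, and with - 2 / s the Laplacian of the other terms is
   4 (4 - s) s^-3, positive only where s < 4 and hence dominated by phiX. *)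
Definition hdual (p : V) : R := ln (s p) - 2 * (s p)^-1 - ln (t p) + (ln k + 4).

(** The three bounds come from the three Peetre comparisons of [s], [t] and [k]; the added 4
    outweighs the losses 1 and 2. The first upper bound is uniform in c and is integrated against
    [phiX]. The second is uniform in p and multiplies the cutoff error, so its dependence on c is
    harmless. *)
Lemma hdual_bounds p : [/\ 0 <= hdual p, hdual p <= 2 * ln (s p) + 5 &
  hdual p <= 2 * ln k + 5].
Proof.
have s0 := SV_gt0 0 p; have t0 := SV_gt0 c p; have k0 : 0 < k by exact: Sq_gt0.
have h1 := ln_le_mul t0 s0 k0 (t_le p).
have h2 := ln_le_mul k0 s0 t0 (k_le p).
have h3 := ln_le_mul s0 t0 k0 (s_le p).
have si : 0 < (s p)^-1 by rewrite invr_gt0.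
have si1 : (s p)^-1 <= 1 by rewrite invf_le1 // SV_ge1.
rewrite /hdual; move: (ln (s p)) (ln (t p)) (ln k) (s p)^-1 h1 h2 h3 si si1.
by move=> a b d e h1 h2 h3 si si1; split; lra.
Qed.

Lemma smooth_hdual : smooth hdual.
Proof.
have Cs n : Cn n s := smooth_SV 0 n.
have Ct n : Cn n t := smooth_SV c n.
move=> n; apply: CnD; last exact: Cn_cst.
apply: CnB; last by apply: Cn_ln => //; exact: SV_gt0.
apply: CnB; first by apply: Cn_ln => //; exact: SV_gt0.
by apply: CnM; [exact: Cn_cst|apply: Cn_inv => //; exact: SV_gt0].
Qed.

Definition gradh (i : nat) (p : V) : R :=
  (s p)^-1 * gradSV 0 i p + 2 * (s p ^- 2 * gradSV 0 i p) - (t p)^-1 * gradSV c i p.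

Lemma lapd_hdual : lapd hdual gradh
  (fun p => 16 * s p ^- 3 - 4 * s p ^- 2 - 4 * t p ^- 2).
Proof.
have l1 := lapd_ln_SV (0 : cplane R).
have l2 := lapdZ (- 2) (lapd_inv_SV (0 : cplane R)).
have l3 := lapdZ (- 1) (lapd_ln_SV c).
have := lapdD (lapdD (lapdD l1 l2) l3) (lapd_cst (ln k + 4)).
move=> /eq_lapd; apply.
- by move=> p; rewrite /hdual mulNr mulN1r.
- by move=> i p _; rewrite /gradh mulNr mulN1r; ring.
by move=> p; ring.
Qed.

(** The first summand bounds the difference of the two logarithmic gradients, the 4 the gradient of
    - 2 / S_0. *)
Definition grad_const : R :=
  2 * (3 * (`|c.1| + `|c.2|) + sqnorm c) * (2 * k) + 4.

Lemma grad_const_ge0 : 0 <= grad_const.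
Proof.
have k0 : 0 <= k by exact: ltW (Sq_gt0 0 c).
by rewrite addr_ge0 // !mulr_ge0 // addr_ge0 ?sqnorm_ge0 // mulr_ge0 // addr_ge0.
Qed.

Lemma norm_mul_le (x y S : R) : x ^+ 2 + y ^+ 2 <= 2 * S -> `|x * y| <= S.
Proof.
by move=> xy; rewrite ler_norml; apply/andP; split;
  [have := sqr_ge0 (x + y)|have := sqr_ge0 (x - y)]; rewrite ?sqrrD ?sqrrB; lra.
Qed.

(** Each logarithmic gradient decays only like s^(-1/2). Against the gradient of the cutoff this
    would give N^-1 / s, whose integral does not tend to 0. The leading parts cancel in the
    difference, and the gain of s^(-1/2) makes the cross term integrable, with a constant that
    depends on c. *)
Lemma gradh_le i p : (i < 4)%N -> `|gradh i p| <= grad_const / s p.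
Proof.
have s0 := SV_gt0 0 p; have s1 := SV_ge1 0 p; have t0 := SV_gt0 c p.
have k0 : 0 < k by exact: Sq_gt0.
have sE : s p = 1 + (p.2.1 ^+ 2 + p.2.2 ^+ 2) by rewrite SVE /Sq subr0.
have tE : t p = 1 + ((p.2.1 - c.1) ^+ 2 + (p.2.2 - c.2) ^+ 2) by rewrite SVE.
have ti : (t p)^-1 <= 2 * k / s p.
  rewrite ler_pdivlMr // mulrC ler_pdivrMr //.
  by apply: le_trans (s_le p) _; rewrite mulrAC.
have key (x a : R) : `|x * p.2.1| <= s p -> `|x * p.2.2| <= s p -> `|x| <= s p ->
    `|a| <= `|c.1| + `|c.2| ->
    `|(s p)^-1 * (2 * x) + 2 * (s p ^- 2 * (2 * x)) - (t p)^-1 * (2 * (x - a))|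
     <= grad_const / s p.
  move=> x1 x2 x0 am.
  (* Over the common denominator [s p * t p] the logarithmic part has numerator
     [x * t p - (x - a) * s p], in which [x * s p] cancels because [t p - s p] is affine in w. *)
  have -> : (s p)^-1 * (2 * x) + 2 * (s p ^- 2 * (2 * x)) -
      (t p)^-1 * (2 * (x - a)) =
      2 * ((sqnorm c * x - 2 * (c.1 * (x * p.2.1) + c.2 * (x * p.2.2)) + a * s p)
        / s p * (t p)^-1) + 4 * (x / s p) * (s p)^-1.
    have ts : t p = s p + sqnorm c - 2 * (c.1 * p.2.1 + c.2 * p.2.2).
      by rewrite tE sE /sqnorm; ring.
    have -> : sqnorm c * x - 2 * (c.1 * (x * p.2.1) + c.2 * (x * p.2.2)) + a * s p
       = x * t p - (x - a) * s p by rewrite ts; ring.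
    by field; rewrite !gt_eqF.
  rewrite /grad_const [leRHS]mulrDl; apply: le_trans (ler_normD _ _) _; apply: lerD.
    set Z := 3 * _ + _.
    have -> : 2 * Z * (2 * k) / s p = 2 * (Z * (2 * k / s p)) by rewrite !mulrA.
    rewrite normrM (@ger0_norm _ 2) // ler_wpM2l // normrM; apply: ler_pM => //.
    - rewrite normrM normfV (ger0_norm (ltW s0)) ler_pdivrMr // /Z.
      apply: le_trans (ler_normD _ _) _.
      apply: (@le_trans _ _ ((sqnorm c * s p + 2 * (`|c.1| * s p + `|c.2| * s p)) +
          (`|c.1| + `|c.2|) * s p)).
        apply: lerD; last by rewrite normrM (ger0_norm (ltW s0)) ler_wpM2r // ltW.
        apply: le_trans (ler_normB _ _) _; apply: lerD.
          by rewrite normrM ger0_norm ?sqnorm_ge0 // ler_wpM2l ?sqnorm_ge0.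
        rewrite normrM ger0_norm // ler_wpM2l //.
        apply: le_trans (ler_normD _ _) _.
        by rewrite (normrM c.1) (normrM c.2); apply: lerD; exact: ler_wpM2l.
      by rewrite le_eqVlt; apply/orP; left; apply/eqP; ring.
    - by rewrite normfV (ger0_norm (ltW t0)).
  rewrite normrM normfV (ger0_norm (ltW s0)) ler_wpM2r ?invr_ge0 ?(ltW s0) //.
  rewrite normrM (@ger0_norm _ 4) // ler_piMr // normrM normfV (ger0_norm (ltW s0)).
  by rewrite ler_pdivrMr // mul1r.
have nle (x : R) : x ^+ 2 <= s p - 1 -> `|x| <= s p.
  move=> xs; rewrite -[x]mulr1; apply: norm_mul_le; rewrite expr1n; lra.
have q1 := sqr_ge0 p.2.1; have q2 := sqr_ge0 p.2.2.
case: i => [|[|[|[|i]]]] // _; rewrite /gradh /gradSV /=.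
- rewrite !mulr0 !mul0r !mulr0 addr0 subr0 normr0 divr_ge0 ?grad_const_ge0 //.
  exact: ltW.
- rewrite !mulr0 !mul0r !mulr0 addr0 subr0 normr0 divr_ge0 ?grad_const_ge0 //.
  exact: ltW.
- rewrite !mulr1 /coord4 /= subr0; apply: key.
  + by apply: norm_mul_le; rewrite sE; lra.
  + by apply: norm_mul_le; rewrite sE; lra.
  + by apply: nle; rewrite sE; lra.
  + by rewrite lerDl.
- rewrite !mulr1 /coord4 /= subr0; apply: key.
  + by apply: norm_mul_le; rewrite sE; lra.
  + by apply: norm_mul_le; rewrite sE; lra.
  + by apply: nle; rewrite sE; lra.
  + by rewrite lerDr.
Qed.

End DualFunction.

(** * Bound for the integral of f over {|w - c| <= 1}, uniform in c *)

Section GlobalEstimate.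
Context {R : realType} (L : lattice R) (delta : R) (delta0 : 0 < delta).
Local Notation V := (cplane2 R).
Local Notation mu := (dvolX L).
Local Notation phi := (phiX L delta).

Lemma phiXE x : phi x = Sq 0 (wX x) `^ (- (1 + delta)).
Proof. by rewrite /phiX /Sq subr0; congr (_ `^ _); ring. Qed.

Lemma phiX_ge0 x : 0 <= phi x. Proof. exact: powR_ge0. Qed.

Lemma phiX_le1 x : phi x <= 1.
Proof.
rewrite phiXE powRN invf_le1 ?powR_gt0 ?Sq_gt0 //.
rewrite -[leLHS](congr1 (@^~ (1 + delta)) (powR1 R)).
have d0 : 0 <= 1 + delta by rewrite addr_ge0 // ltW.
by apply: ge0_ler_powR; rewrite ?nnegrE ?Sq_ge1 // ltW // Sq_gt0.
Qed.

Lemma measurable_phiX : measurable_fun setT phi.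
Proof.
rewrite (_ : phi = fun x => Sq 0 (wX x) `^ (- (1 + delta))).
  exact: measurable_Sq_powR.
by apply/funext => x; exact: phiXE.
Qed.

Lemma integral_phiX_fin : (\int[mu]_x (phi x)%:E < +oo)%E.
Proof.
under eq_integral do rewrite phiXE.
by apply: integral_Sq_powR; rewrite ltrDl.
Qed.

Lemma integrable_phiX : mu.-integrable setT (EFin \o phi).
Proof.
apply/integrableP; split; first by apply/measurable_EFinP; exact: measurable_phiX.
under eq_integral do rewrite /= ger0_norm ?phiX_ge0 //.
exact: integral_phiX_fin.
Qed.

Lemma integrable_Mphi (f : quotX L -> R) (M : R) : measurable_fun setT f ->
  (forall x, `|f x| <= M) -> mu.-integrable setT (EFin \o (fun x => f x * phi x)).
Proof.
move=> mf fM; apply: (@le_integrable _ _ _ mu _ measurableT _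
    (fun x => M%:E * (phi x)%:E)%E).
- by apply/measurable_EFinP; apply: measurable_funM => //; exact: measurable_phiX.
- move=> x _; rewrite /= lee_fin !normrM ler_pM //.
  by apply: le_trans (fM x) _; exact: ler_norm.
- exact: integrableZl integrable_phiX.
Qed.

Section Center.
Variable c : cplane R.

Definition hcut N (p : V) : R := hdual c p * chi N p.
Definition hcutX N : quotX L -> R := hcut N \o @reprX R L.

Lemma periodic_hcut N : lattice_periodic L (hcut N).
Proof.
apply: periodic_snd => p q pq; rewrite /hcut /hdual /chi /chiarg.
by rewrite (SV_snd 0 pq) (SV_snd c pq).
Qed.

Lemma test_hcutX N : (0 < N)%N -> test_fun (hcutX N).
Proof.
move=> N0; apply: (@test_funP _ _ _ (2 ^+ N)).
- exact: periodic_hcut.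
- by move=> n; apply: CnM; [exact: smooth_hdual|exact: smooth_chi].
- by move=> p pN; rewrite /hcut chi_eq0 ?mulr0 //; exact: SV_large.
Qed.

Lemma hcutX_ge0 N x : 0 <= hcutX N x.
Proof. by apply: mulr_ge0; [case: (hdual_bounds c (reprX x))|exact: chi_ge0]. Qed.

Lemma lapX_hcutX N x : let p := reprX x in lapX (hcutX N) x =
  - (2^-1 * (hdual c p * lapchi N p)) +
  chi N p * (2 * SV c p ^- 2 + (2 * SV 0 p ^- 2 - 8 * SV 0 p ^- 3)) -
  \sum_(i < 4) gradh c i p * gradchi N i p.
Proof.
move=> p; rewrite lapX_repr; last exact: periodic_hcut.
rewrite (flat_lapE _ (lapdM (lapd_hdual c) (lapd_chi N))) -/p.
by move: (\sum_(i < 4) _) => S; field; rewrite !SV_neq0.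
Qed.

(** 32 = 4 * 4 * 2: four directions, the bound 4 for [flat 2], and the 2 in the gradient of S_0. The
    exponent adds -1 from [gradh] to -1 + 1/2 from [gradchi]. *)
Definition cross_error N (x : quotX L) : R :=
  32 * grad_const c * (N%:R * ln 2)^-1 * Sq 0 (wX x) `^ (- (3 / 2)).

Lemma gradSV_le i (p : V) : (i < 4)%N -> `|gradSV 0 i p| <= 2 * SV 0 p `^ 2^-1.
Proof.
move=> i4; rewrite powR12_sqrt ?(ltW (SV_gt0 _ _)) // /gradSV.
have S0 := ltW (SV_gt0 0 p).
case: (leqP 2 i) => [i2|i2]; last first.
  by rewrite mulr0 mul0r normr0 mulr_ge0 ?sqrtr_ge0.
rewrite mulr1 normrM ger0_norm // ler_wpM2l // -sqrtr_sqr ler_wsqrtr //.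
rewrite SVE /Sq subr0 /sqnorm; have q1 := sqr_ge0 p.2.1; have q2 := sqr_ge0 p.2.2.
case: i i4 i2 => [|[|[|[|i]]]] // _ _.
- by rewrite /coord4 /= subr0; lra.
- by rewrite /coord4 /= subr0; lra.
Qed.

Lemma cross_error_le N x : (0 < N)%N ->
  `|\sum_(i < 4) gradh c i (reprX x) * gradchi N i (reprX x)| <= cross_error N x.
Proof.
move=> N0; set p := reprX x.
have s0 := SV_gt0 0 p; have g0 := grad_const_ge0 c.
have l0 : 0 < N%:R * ln 2 :> R by rewrite mulr_gt0 ?ltr0n ?ln2_gt0.
have bd (i : 'I_4) : `|gradh c i p * gradchi N i p| <=
    8 * grad_const c * (N%:R * ln 2)^-1 * SV 0 p `^ (- (3 / 2)).
  have -> : SV 0 p `^ (- (3 / 2)) = (SV 0 p)^-1 * ((SV 0 p)^-1 * SV 0 p `^ 2^-1).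
    rewrite -(powR_inv1 (ltW s0)) -!powRD ?SV_neq0 ?implybT //.
    by congr powR; field.
  have -> : 8 * grad_const c * (N%:R * ln 2)^-1 *
      ((SV 0 p)^-1 * ((SV 0 p)^-1 * SV 0 p `^ 2^-1)) =
    (grad_const c / SV 0 p) * (4 * ((N%:R * ln 2)^-1 *
      ((SV 0 p)^-1 * (2 * SV 0 p `^ 2^-1)))) by ring.
  rewrite normrM; apply: ler_pM => //; first exact: gradh_le.
  rewrite /gradchi normrM; apply: ler_pM => //.
    rewrite ger0_norm ?flat_ge0 //; apply: le_trans (flat_le _ _) _.
    by rewrite (_ : 2%:R ^+ 2 = 4 :> R) //; ring.
  rewrite normrM normrN (ger0_norm (_ : 0 <= (N%:R * ln 2)^-1)) ?invr_ge0 ?(ltW l0) //.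
  apply: ler_wpM2l; first by rewrite invr_ge0 ltW.
  rewrite normrM normfV (ger0_norm (ltW s0)); apply: ler_wpM2l.
    by rewrite invr_ge0 ltW.
  exact: gradSV_le.
apply: le_trans (ler_norm_sum _ _ _) _.
apply: (@le_trans _ _ (\sum_(i < 4)
    8 * grad_const c * (N%:R * ln 2)^-1 * SV 0 p `^ (- (3 / 2)))).
  by apply: ler_sum => i _; exact: bd.
rewrite !big_ord_recl big_ord0 /cross_error -(SV_repr 0) -/p le_eqVlt.
by apply/orP; left; apply/eqP; ring.
Qed.

(** Where S_0 < 4 the left side is at most 8 and [phiX] is at least 4^-(1 + delta); elsewhere the
    left side is at most 0. *)
Lemma phi_dominates x : 8 * SV 0 (reprX x) ^- 3 - 2 * SV 0 (reprX x) ^- 2 <=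
  8 * 4 `^ (1 + delta) * phi x.
Proof.
rewrite phiXE -(SV_repr 0); set s := SV 0 _.
have s0 : 0 < s by exact: SV_gt0.
have s1 : 1 <= s by exact: SV_ge1.
have [s4|s4] := ltP s 4; last first.
  apply: (@le_trans _ _ 0); last by rewrite !mulr_ge0 ?powR_ge0.
  rewrite subr_le0 [s ^+ 3]exprS invfM mulrA ler_wpM2r ?invr_ge0 ?exprn_ge0 ?(ltW s0) //.
  by rewrite ler_pdivrMr //; lra.
apply: (@le_trans _ _ 8).
  have : s ^- 3 <= 1 by rewrite invf_le1 ?exprn_gt0 // exprn_ege1.
  have : 0 <= s ^- 2 by rewrite invr_ge0 exprn_ge0 // ltW.
  by move: (s ^- 2) (s ^- 3) => a b a0 b0; lra.
rewrite -mulrA ler_peMr // powRN ler_pdivlMr ?powR_gt0 // mul1r.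
have d0 : 0 <= 1 + delta by rewrite addr_ge0 // ltW.
by apply: ge0_ler_powR; rewrite ?nnegrE // ltW.
Qed.

Definition dual_error N (x : quotX L) : R :=
  (2 * ln (Sq 0 c) + 5) * cut_error N x + cross_error N x.

Lemma ball_SV_le (x : quotX L) : ballX c 1 x -> SV c (reprX x) <= 3.
Proof.
rewrite /ballX /= SV_repr /Sq /sqnorm prod_normE ge_max => /andP[a b].
have sq (y : R) : `|y| <= 1 -> y ^+ 2 <= 1.
  by move=> yr; rewrite -[y ^+ 2]real_normK ?num_real // exprn_ile1.
by have := sq _ a; have := sq _ b; lra.
Qed.

(** On the ball S_c <= 3, whence 2 S_c^-2 >= 2/9. By Peetre's inequality S_0 <= 2 * 3 * [Sq 0 c]
    there, so the condition on N puts the ball in the region where the cutoff is at least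
    exp(-1). *)
Lemma lapX_hcutX_ge N x : (0 < N)%N -> 6 * Sq 0 c <= 2 ^+ N ->
  2 / 9 * expR (-1) * \1_(ballX c 1) x - 8 * 4 `^ (1 + delta) * phi x -
   dual_error N x <= lapX (hcutX N) x.
Proof.
move=> N0 kN; rewrite lapX_hcutX /=.
have [h0 _ h1] := hdual_bounds c (reprX x).
have cr := cross_error_le x N0.
have lc : `|lapchi N (reprX x)| <= 2 * cut_error N x.
  have := lapX_chiX_le x N0; rewrite lapX_chiX normrN normrM normfV (@ger0_norm _ 2) //.
  by rewrite ler_pdivrMr // mulrC.
have e1 : 2^-1 * (hdual c (reprX x) * lapchi N (reprX x)) <=
    (2 * ln (Sq 0 c) + 5) * cut_error N x.
  rewrite mulrCA; apply: (@le_trans _ _ (hdual c (reprX x) * cut_error N x)).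
    rewrite ler_wpM2l //; have := le_trans (ler_norm _) lc.
    by move: (lapchi N _) (cut_error N x) => a b ab; lra.
  by rewrite ler_wpM2r // cut_error_ge0.
have e2 : - cross_error N x <=
    - \sum_(i < 4) gradh c i (reprX x) * gradchi N i (reprX x).
  by rewrite lerN2; exact: le_trans (ler_norm _) cr.
have c0 := chi_ge0 N (reprX x); have c1 := chi_le1 N (reprX x).
have pd := phi_dominates x.
have K0 : 0 <= 8 * 4 `^ (1 + delta) * phi x by rewrite !mulr_ge0 ?powR_ge0.
have e3 : - (8 * 4 `^ (1 + delta) * phi x) <= chi N (reprX x) *
    (2 * SV 0 (reprX x) ^- 2 - 8 * SV 0 (reprX x) ^- 3).
  move: pd K0 c0 c1; move: (chi N _) (_ * phi x) (SV 0 _ ^- 2) (SV 0 _ ^- 3).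
  move=> a b d g pd K0 c0 c1.
  apply: (@le_trans _ _ (a * - b)); first by rewrite mulrN lerN2 ler_piMl.
  by rewrite ler_wpM2l //; lra.
have t0 := SV_gt0 c (reprX x).
have e4 : 2 / 9 * expR (-1) * \1_(ballX c 1) x <=
    chi N (reprX x) * (2 * SV c (reprX x) ^- 2).
  rewrite indicE; have [xb|xb] := boolP (x \in _); last first.
    by rewrite mulr0 !mulr_ge0 // invr_ge0 exprn_ge0 // ltW.
  have tx := ball_SV_le (set_mem xb).
  rewrite mulr1 mulrC; apply: ler_pM; rewrite ?expR_ge0 //.
    apply: chi_ge => //; apply: le_trans kN.
    apply: le_trans (s_le c (reprX x)) _; rewrite ler_wpM2r ?(ltW (Sq_gt0 _ _)) //.
    by move: (SV c _) tx => y tx; lra.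
  rewrite ler_wpM2l // lef_pV2 ?posrE ?exprn_gt0 //.
  have -> : 9 = 3 ^+ 2 :> R by ring.
  by apply: lerXn2r; rewrite ?nnegrE // ltW.
rewrite /dual_error [chi N _ * (_ + _)]mulrDr.
move: e1 e2 e3 e4; set A := _ * (hdual _ _ * _); set C := _ * cut_error N x.
set D := cross_error N x; set S := \sum_(i < 4) _; set P := _ * phi x.
set E := _ * \1_ _ _; set F := _ * (2 * SV c _ ^- 2); set G := chi N _ * (_ - _).
by move: A C D S P E F G => *; lra.
Qed.

Lemma integral_dual_error : exists2 Z : R, 0 <= Z & forall N, (0 < N)%N ->
  mu.-integrable setT (EFin \o dual_error N) /\
  \int[mu]_x dual_error N x <= Z / N%:R.
Proof.
have [Z Z0 HZ] := integral_cut_error L.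
have b1 : 1 < 3 / 2 :> R by lra.
have [K K0 HK] := Sq_powR_fin L b1.
have l2 := @ln2_gt0 R; have g0 := grad_const_ge0 c.
have k0 : 0 <= 2 * ln (Sq 0 c) + 5.
  by rewrite addr_ge0 // mulr_ge0 // ln_ge0 // Sq_ge1.
exists ((2 * ln (Sq 0 c) + 5) * Z + 32 * grad_const c / ln 2 * K).
  by rewrite addr_ge0 // !mulr_ge0 // invr_ge0 ltW.
move=> N N0; have [iE IE] := HZ N N0.
have nN : (0 : R) < N%:R by rewrite ltr0n.
have l0 : 0 < N%:R * ln 2 :> R by rewrite mulr_gt0.
have [iP IP] := le_Rintegral_bound (@measurable_Sq_powR R L (- (3 / 2)))
  (fun x => powR_ge0 _ _) HK.
pose a := 2 * ln (Sq 0 c) + 5.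
pose b := 32 * grad_const c * (N%:R * ln 2)^-1.
have i1 : mu.-integrable setT (EFin \o (fun x => a * cut_error N x)).
  by apply: eq_integrable (integrableZl measurableT a iE).
have i2 : mu.-integrable setT (EFin \o (fun x => b * Sq 0 (wX x) `^ (- (3 / 2)))).
  by apply: eq_integrable (integrableZl measurableT b iP).
split; first by apply: eq_integrable (integrableD measurableT i1 i2).
rewrite /dual_error /cross_error RintegralD // !RintegralZl //.
rewrite [leRHS]mulrDl; apply: lerD.
  by rewrite -mulrA ler_wpM2l.
have -> : 32 * grad_const c / ln 2 * K / N%:R = b * K.
  by rewrite /b; field; rewrite !gt_eqF.
by rewrite ler_wpM2l // /b !mulr_ge0 // invr_ge0 ltW.
Qed.

(** The logarithm in the first upper bound of [hdual] is absorbed by half of [delta]: ln s <= (2 /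
    delta) s^(delta / 2). The result is integrable and contains neither c nor N. *)
Lemma phi_hcutX_le N x : phi x * hcutX N x <=
  (4 / delta + 5) * Sq 0 (wX x) `^ (- (1 + delta / 2)).
Proof.
have s0 := Sq_gt0 0 (wX x); have s1 := Sq_ge1 0 (wX x).
have d2 : 0 < delta / 2 by rewrite divr_gt0.
have h : hcutX N x <= (4 / delta + 5) * Sq 0 (wX x) `^ (delta / 2).
  have [h0 h1 _] := hdual_bounds c (reprX x).
  apply: (@le_trans _ _ (hdual c (reprX x))).
    by rewrite /hcutX /= /hcut ler_piMr // chi_le1.
  apply: le_trans h1 _; rewrite SV_repr.
  have p1 : 1 <= Sq 0 (wX x) `^ (delta / 2).
    rewrite -[leLHS](congr1 (@^~ (delta / 2)) (powR1 R)).
    by apply: ge0_ler_powR; rewrite ?nnegrE // ltW.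
  have : ln (Sq 0 (wX x)) <= Sq 0 (wX x) `^ (delta / 2) / (delta / 2).
    rewrite ler_pdivlMr // mulrC -ln_powR; apply: ltW.
    exact: ln_sublinear (lt_le_trans ltr01 p1).
  move: p1; move: (_ `^ _) (ln _) => y z y1 zy.
  rewrite [leRHS]mulrDl; apply: lerD; last by rewrite ler_peMr.
  have -> : 4 / delta * y = 2 * (y / (delta / 2)) by field; rewrite gt_eqF.
  by rewrite ler_wpM2l.
have := ler_wpM2l (phiX_ge0 x) h; move/le_trans; apply.
rewrite phiXE mulrCA -powRD; last by rewrite (gt_eqF s0) implybT.
by rewrite (_ : - (1 + delta) + delta / 2 = - (1 + delta / 2)) //; field.
Qed.

End Center.

(** [K1] comes from the part of the Laplacian dominated by [phiX], and [K4] from pairing [hdual]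
    with [B * phiX]; both are independent of c. The bound [M] multiplies only the dual error, which
    vanishes as N grows. *)
Lemma global_estimate : exists2 K : R, 0 <= K &
  forall (f : quotX L -> R) (M B : R) (c : cplane R), measurable_fun setT f ->
  (forall x, 0 <= f x <= M) -> 0 < B ->
  distr_le (distr_lap f) (distr_of (fun x => B * phi x)) ->
  \int[mu]_x (f x * \1_(ballX c 1) x) <= K * (B + \int[mu]_x (f x * phi x)).
Proof.
have b1 : 1 < 1 + delta / 2 by rewrite ltrDl divr_gt0.
have [K3 K30 HK3] := Sq_powR_fin L b1.
have [iP IP] := le_Rintegral_bound (@measurable_Sq_powR R L (- (1 + delta / 2)))
  (fun x => powR_ge0 _ _) HK3.
pose e9 : R := 2 / 9 * expR (-1).
have e90 : 0 < e9 by rewrite /e9 mulr_gt0 ?expR_gt0.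
pose K1 : R := 8 * 4 `^ (1 + delta).
have K10 : 0 <= K1 by rewrite /K1 mulr_ge0 // powR_ge0.
pose K4 : R := (4 / delta + 5) * K3.
have d5 : 0 <= 4 / delta + 5 by rewrite addr_ge0 // divr_ge0 // ltW.
have K40 : 0 <= K4 by rewrite mulr_ge0.
exists ((K1 + K4) / e9); first by rewrite divr_ge0 ?addr_ge0 // ltW.
move=> f M B c mf fM B0 fle.
have fabs x : `|f x| <= M by have /andP[a b] := fM x; rewrite ger0_norm.
have M0 : 0 <= M by apply: le_trans (fabs (piX L 0)).
have [Z Z0 HZ] := integral_dual_error c.
set I := \int[mu]_x (f x * phi x); set J := \int[mu]_x (f x * _).
have I0 : 0 <= I.
  by apply: Rintegral_ge0 => x _; have /andP[a _] := fM x; rewrite mulr_ge0 ?phiX_ge0.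
have mb : measurable (ballX c 1 : set (quotX L)) by exact: measurable_ballX.
have i1 : mu.-integrable setT (EFin \o (fun x => f x * \1_(ballX c 1) x)).
  apply: ball_bounded_integrable; first exact: measurable_funM.
  apply: ball_boundedM fabs _; apply: (@ball_boundedP _ _ _ (1 + `|c|) 1).
    move=> x xr; rewrite indicE memNset // /ballX /= => xc.
    move: xr; apply/negP; rewrite -leNgt -[wX x](subrK c).
    by rewrite (le_trans (ler_normD _ _)) // lerD2r.
  by move=> x _; rewrite indicE ger0_norm //; case: (x \in _).
have i2 := integrable_Mphi mf fabs.
have key N : (0 < N)%N -> 6 * Sq 0 c <= 2 ^+ N ->
    e9 * J <= K1 * I + B * K4 + M * Z / N%:R.
  move=> N0 kN; have [iE IE] := HZ N N0.
  have tH := test_hcutX c N0.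
  have := fle _ tH (hcutX_ge0 c N) => Tle.
  have T1 : e9 * J - K1 * I - M * \int[mu]_x dual_error c N x <=
      distr_lap f (hcutX c N).
    have j1 : mu.-integrable setT (EFin \o (fun x => e9 * (f x * \1_(ballX c 1) x))).
      by apply: eq_integrable (integrableZl measurableT e9 i1).
    have j2 : mu.-integrable setT (EFin \o (fun x => K1 * (f x * phi x))).
      by apply: eq_integrable (integrableZl measurableT K1 i2).
    have j3 : mu.-integrable setT (EFin \o (fun x => M * dual_error c N x)).
      by apply: eq_integrable (integrableZl measurableT M iE).
    have j12 : mu.-integrable setT (EFin \o (fun x =>
        e9 * (f x * \1_(ballX c 1) x) - K1 * (f x * phi x))).
      by apply: eq_integrable (integrableB measurableT j1 j2).
    rewrite -!RintegralZl // -!RintegralB // /distr_lap; apply: le_Rintegral => //.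
    - by apply: eq_integrable (integrableB measurableT j12 j3).
    - exact: integrable_lap fabs tH.
    move=> x _; have /andP[f0 fx] := fM x.
    apply: le_trans (ler_wpM2l f0 (lapX_hcutX_ge x N0 kN)).
    rewrite -/e9 -/K1 !mulrBr mulrCA [f x * (K1 * _)]mulrCA lerB //.
    have d0 : 0 <= dual_error c N x.
      rewrite addr_ge0 // !mulr_ge0 ?cut_error_ge0 ?powR_ge0 ?grad_const_ge0 //.
        by rewrite addr_ge0 // mulr_ge0 // ln_ge0 // Sq_ge1.
      by rewrite invr_ge0 mulr_ge0 // ltW // ln2_gt0.
    exact: ler_wpM2r.
  have T2 : distr_of (fun x => B * phi x) (hcutX c N) <= B * K4.
    rewrite /distr_of; apply: (@le_trans _ _ (\int[mu]_x
        (B * (4 / delta + 5) * Sq 0 (wX x) `^ (- (1 + delta / 2))))).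
      apply: le_Rintegral => //.
      - have tb := test_fun_ball_bounded tH.
        apply: ball_bounded_integrable.
          apply: measurable_funM; last exact: test_fun_measurable.
          by apply: measurable_funM => //; exact: measurable_phiX.
        apply: ball_boundedM (_ : forall x, `|_| <= B) tb => x.
        by rewrite ger0_norm ?mulr_ge0 ?phiX_ge0 ?ler_piMr ?phiX_le1 // ltW.
      - by apply: eq_integrable (integrableZl measurableT _ iP).
      by move=> x _; rewrite -!mulrA ler_wpM2l ?phi_hcutX_le // ltW.
    by rewrite RintegralZl // -mulrA !ler_wpM2l // ltW.
  have T3 : M * \int[mu]_x dual_error c N x <= M * Z / N%:R.
    by rewrite -mulrA ler_wpM2l.
  move: (le_trans T1 (le_trans Tle T2)) T3.
  move: (e9 * J) (K1 * I) (M * _) (B * K4) (M * Z / _) => *; lra.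
have fin : e9 * J <= K1 * I + B * K4.
  apply/ler_addgt0Pr => e e0.
  (* Large enough for both [6 * Sq 0 c <= 2 ^+ n] and [M * Z / n <= e]; the successor makes [n]
     positive. *)
  pose n := maxn (Num.bound (6 * Sq 0 c)) (Num.bound (M * Z / e)).+1.
  have n0 : (0 < n)%N by rewrite leq_max orbT.
  apply: le_trans (key n n0 _) _.
    have B1 : 0 <= 6 * Sq 0 c by rewrite mulr_ge0 // ltW // Sq_gt0.
    apply: ltW; apply: lt_le_trans (archi_boundP B1) _.
    rewrite -natrX ler_nat; apply: leq_trans (ltnW (ltn_expl n _)) => //.
    exact: leq_maxl.
  rewrite lerD2l ler_pdivrMr ?ltr0n // [e * _]mulrC -ler_pdivrMr //.
  have B1 : 0 <= M * Z / e by rewrite !mulr_ge0 // invr_ge0 ltW.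
  apply: ltW; apply: lt_le_trans (archi_boundP B1) _.
  by rewrite ler_nat (leq_trans (leqnSn _)) // leq_maxr.
rewrite mulrAC ler_pdivlMr // mulrC; apply: le_trans fin _.
rewrite mulrDl !mulrDr [B * K4]mulrC.
have := mulr_ge0 K10 (ltW B0); have := mulr_ge0 K40 I0.
by move: (K1 * I) (K4 * B) (K1 * B) (K4 * I) => *; lra.
Qed.

End GlobalEstimate.

(** * The truncated fundamental solution of R^4 *)

Section Kernel.
Context {R : realType}.
Local Notation V := (cplane2 R).
Variables (q : V) (e T : R).
Hypotheses (e0 : 0 < e) (T1 : 1 <= T).

Definition sig : V -> R := quad (fun=> 1) e q.

Definition gradsig (i : nat) (p : V) : R := 2 * (coord4 i p - coord4 i q).

Lemma sig_ge p : e <= sig p.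
Proof.
by rewrite /sig /quad lerDl sumr_ge0 // => i _; rewrite mul1r sqr_ge0.
Qed.

Lemma sig_gt0 p : 0 < sig p. Proof. exact: lt_le_trans (sig_ge p). Qed.
Lemma sig_neq0 p : sig p != 0. Proof. by rewrite gt_eqF // sig_gt0. Qed.

Lemma lapd_sig : lapd sig gradsig (fun=> 8).
Proof.
apply: eq_lapd (lapd_quad _ _ _) _ _ _ => [//|i p _|p].
  by rewrite mulr1.
by rewrite !big_ord_recl big_ord0 /=; ring.
Qed.

Lemma sum_gradsig p : \sum_(i < 4) gradsig i p ^+ 2 = 4 * (sig p - e).
Proof.
rewrite /sig /quad addrC addKr mulr_sumr; apply: eq_bigr => i _.
by rewrite /gradsig; ring.
Qed.

Lemma coord_sig i p : (i < 4)%N -> (coord4 i p - coord4 i q) ^+ 2 <= sig p - e.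
Proof.
move=> i4; rewrite /sig /quad [leRHS]addrC addKr (bigD1 (Ordinal i4)) //= mul1r lerDl.
by rewrite sumr_ge0 // => j _; rewrite mul1r sqr_ge0.
Qed.

(** Subtracting [T] and applying [Theta] cuts the kernel off at height [T]: it vanishes unless
    [sig p < T^-1], that is, within distance [rho] of [q] once [T = rho ^- 2]. *)
Definition kerarg (p : V) : R := (sig p)^-1 - T.
Definition ker (p : V) : R := Theta (kerarg p).

Definition lapker (p : V) : R :=
  flat 3 (kerarg p) * (4 * (sig p - e) * sig p ^- 4) -
  (flat 0 (kerarg p) + flat 1 (kerarg p)) * (8 * e * sig p ^- 3).

(** In dimension 4 the two terms of order sig^-2 cancel, because 1/|p|^2 is harmonic off the origin.
    What is left is the point mass smeared out at scale sqrt(e). *)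
Lemma lapd_kerarg : lapd kerarg (fun i p => - sig p ^- 2 * gradsig i p)
  (fun p => - (8 * e * sig p ^- 3)).
Proof.
have d1 p := is_derive_inv (sig_neq0 p).
have d2 p : is_derive (sig p) 1 (fun y => - y ^- 2) (2 * sig p ^- 3).
  have := is_deriveN (is_derive_invX 2 (sig_neq0 p)).
  by move=> /is_derive_eq; apply; rewrite opprK.
have l1 := @lapd_comp _ _ (fun y => - y ^- 2) (fun y => 2 * y ^- 3) _ _ _ d1 d2
  lapd_sig.
apply: eq_lapd (lapdD l1 (lapd_cst (- T))) _ _ _ => [//|i p _|p].
  by rewrite addr0.
by rewrite /= sum_gradsig addr0; move: (sig p) (sig_neq0 p) => S S0; field.
Qed.

Lemma lapd_ker : exists G, lapd ker G lapker.
Proof.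
have d1 p := is_derive_Theta (kerarg p).
have d2 p := is_derive_dTheta (kerarg p).
have l1 := @lapd_comp _ _ (fun t => flat 0 t + flat 1 t) (flat 3) _ _ _ d1 d2
  lapd_kerarg.
eexists; apply: eq_lapd l1 _ _ _ => [//|//|p].
rewrite /= /lapker mulrN; congr (_ * _ - _).
have -> : \sum_(i < 4) (- sig p ^- 2 * gradsig i p) ^+ 2 =
    sig p ^- 4 * \sum_(i < 4) gradsig i p ^+ 2.
  rewrite mulr_sumr; apply: eq_bigr => i _.
  by move: (sig p) (sig_neq0 p) => S S0; field.
by rewrite sum_gradsig mulrC.
Qed.

Lemma smooth_ker : smooth ker.
Proof.
move=> n; apply: Cn_Theta; apply: CnB; last exact: Cn_cst.
by apply: Cn_inv; [exact: sig_gt0|exact: smooth_quad].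
Qed.

Lemma ker_ge0 p : 0 <= ker p. Proof. exact: Theta_ge0. Qed.

Lemma kerarg_le0 p : T^-1 <= sig p -> kerarg p <= 0.
Proof.
have T0 := lt_le_trans ltr01 T1.
by move=> TS; rewrite subr_le0 -[leRHS]invrK lef_pV2 ?posrE ?invr_gt0 // sig_gt0.
Qed.

Lemma ker_eq0 p : T^-1 <= sig p -> ker p = 0.
Proof. by move=> TS; rewrite /ker Theta_eq0 // kerarg_le0. Qed.

Lemma lapker_eq0 p : T^-1 <= sig p -> lapker p = 0.
Proof.
by move=> TS; rewrite /lapker !flat_eq0 ?kerarg_le0 // addr0 !mul0r subr0.
Qed.

Lemma ker_le p : ker p <= (sig p)^-1.
Proof.
have T0 := lt_le_trans ltr01 T1.
have [TS|TS] := leP T^-1 (sig p).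
  by rewrite ker_eq0 // invr_ge0 ltW // sig_gt0.
have a0 : 0 <= kerarg p.
  by rewrite subr_ge0 -[leLHS]invrK lef_pV2 ?posrE ?invr_gt0 ?sig_gt0 // ltW.
by apply: le_trans (Theta_le a0) _; rewrite /kerarg gerBl ltW.
Qed.

(* With x = sig / (1 - T sig) one has 1/kerarg = x and (kerarg * sig)^-1 =
   1 + T x, so the product is (1 + T x)^3 exp(-x). *)
Lemma flat3_sig p : flat 3 (kerarg p) * sig p ^- 3 <= 27 * expR 1 * T ^+ 3.
Proof.
have T0 := lt_le_trans ltr01 T1; have S0 := sig_gt0 p.
have rhs0 : 0 <= 27 * expR 1 * T ^+ 3.
  by rewrite !mulr_ge0 ?expR_ge0 ?exprn_ge0 // ltW.
have [TS|TS] := leP T^-1 (sig p).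
  by rewrite flat_eq0 ?kerarg_le0 // mul0r.
have a0 : 0 < kerarg p.
  by rewrite subr_gt0 -[ltLHS]invrK ltf_pV2 ?posrE ?invr_gt0.
rewrite /flat a0; set x := (kerarg p)^-1.
have x0 : 0 < x by rewrite invr_gt0.
have -> : kerarg p ^- 3 * expR (- x) * sig p ^- 3 =
    ((1 + T * x) ^+ 3) * expR (- x).
  rewrite mulrAC; congr (_ * _); rewrite -!exprVn -exprMn; congr (_ ^+ _).
  have : kerarg p * x = 1 by rewrite divff // gt_eqF.
  rewrite -/x {1}/kerarg mulrBl => /eqP; rewrite subr_eq => /eqP <-.
  by rewrite mulrC.
rewrite expRN ler_pdivrMr ?expR_gt0 //.
apply: (@le_trans _ _ (T ^+ 3 * (1 + x) ^+ 3)).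
  rewrite -exprMn; apply: lerXn2r; rewrite ?nnegrE.
  - by rewrite addr_ge0 // mulr_ge0 // ltW.
  - by rewrite mulr_ge0 ?addr_ge0 // ltW.
  by rewrite mulrDr mulr1 lerD2r.
have y0 : 0 <= 1 + x by rewrite addr_ge0 // ltW.
have := exprn_le_expR 3 y0; rewrite expRD.
have -> : 3%:R ^+ 3 = 27 :> R by ring.
move=> /(ler_wpM2l (exprn_ge0 3 (ltW T0))) /le_trans; apply.
by rewrite le_eqVlt; apply/orP; left; apply/eqP; ring.
Qed.

Definition ker_const : R := 54 * expR 1 * T ^+ 3.

Lemma ker_const_ge0 : 0 <= ker_const.
Proof.
have T0 : 0 <= T by exact: le_trans T1.
by rewrite /ker_const !mulr_ge0 ?expR_ge0 ?exprn_ge0.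
Qed.

(** The only positive part of the Laplacian, created by the curvature of [Theta]. Bounding
    [sig p - e] by [sig p] reduces it to [flat3_sig], so it is controlled by [T] alone, uniformly in
    [e]. *)
Lemma lapker_flat3 p :
  2^-1 * (flat 3 (kerarg p) * (4 * (sig p - e) * sig p ^- 4)) <= ker_const.
Proof.
have S0 := sig_gt0 p.
apply: (@le_trans _ _ (2 * (flat 3 (kerarg p) * sig p ^- 3))); last first.
  rewrite (_ : ker_const = 2 * (27 * expR 1 * T ^+ 3)); last first.
    by rewrite /ker_const; ring.
  by rewrite ler_wpM2l // flat3_sig.
have -> : 2^-1 * (flat 3 (kerarg p) * (4 * (sig p - e) * sig p ^- 4)) =
  2 * (flat 3 (kerarg p) * ((sig p - e) * sig p ^- 4)).
  by field; rewrite sig_neq0.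
rewrite ler_wpM2l // ler_wpM2l ?flat_ge0 //.
have -> : sig p ^- 3 = sig p * sig p ^- 4 by field; rewrite sig_neq0.
by rewrite ler_wpM2r ?invr_ge0 ?exprn_ge0 ?(ltW S0) // gerBl ltW.
Qed.

Lemma lapker_le p : lapker p / 2 <= ker_const.
Proof.
rewrite /lapker mulrC mulrBr; apply: le_trans (lapker_flat3 p).
rewrite gerBl !mulr_ge0 ?addr_ge0 ?flat_ge0 ?(ltW e0) //.
by rewrite invr_ge0 exprn_ge0 // ltW // sig_gt0.
Qed.

(** These hypotheses give [kerarg p >= 1], where the derivative of [Theta] is at least exp(-1). The
    smeared mass, halved, is 4 e sig^-3 >= 4 e / (5 e)^3 = (4 / 125) e^-2. *)
Lemma lapker_le_near p : sig p <= 5 * e -> 5 * e <= (1 + T)^-1 ->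
  4 / 125 * expR (-1) * e ^- 2 - ker_const <= - (lapker p / 2).
Proof.
move=> Se eT; have T0 := lt_le_trans ltr01 T1; have S0 := sig_gt0 p.
have TT : 0 < 1 + T by rewrite addr_gt0.
have a1 : 1 <= kerarg p.
  rewrite /kerarg -lerBlDr opprK.
  by rewrite -[leLHS]invrK lef_pV2 ?posrE ?invr_gt0 // (le_trans Se).
have a0 := lt_le_trans ltr01 a1.
have f0 : expR (-1) <= flat 0 (kerarg p) + flat 1 (kerarg p).
  rewrite -[leLHS]addr0; apply: lerD; last exact: flat_ge0.
  by rewrite /flat a0 expr0 invr1 mul1r ler_expR lerN2 invf_le1.
have fl := lapker_flat3 p.
rewrite /lapker [leRHS](_ : _ = 2^-1 * ((flat 0 (kerarg p) + flat 1 (kerarg p)) *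
  (8 * e * sig p ^- 3)) - 2^-1 * (flat 3 (kerarg p) * (4 * (sig p - e) * sig p ^- 4)));
  last by ring.
apply: lerD; last by rewrite lerN2.
rewrite (_ : 4 / 125 * expR (-1) * e ^- 2 =
    expR (-1) * (4 * e * (5 * e) ^- 3)); last by field; rewrite gt_eqF.
have -> : 2^-1 * ((flat 0 (kerarg p) + flat 1 (kerarg p)) * (8 * e * sig p ^- 3)) =
    (flat 0 (kerarg p) + flat 1 (kerarg p)) * (4 * e * sig p ^- 3).
  by field; rewrite sig_neq0.
have e5 : 0 < 5 * e by rewrite mulr_gt0.
apply: ler_pM; [exact: expR_ge0| |exact: f0|].
  by rewrite !mulr_ge0 ?(ltW e0) // invr_ge0 exprn_ge0 // ltW.
rewrite ler_wpM2l ?mulr_ge0 ?(ltW e0) // lef_pV2 ?posrE ?exprn_gt0 //.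
by apply: lerXn2r => //; rewrite nnegrE ltW.
Qed.

(** The kernel is at most 1/sig, hence at most 4^(n+1) where 4^-(n+1) <= sig < 4^-n, a region inside
    a cube of volume 16 * 16^-n. The shells contribute 64 * 4^-n, and the geometric sum is at most
    2. Since sig >= e, finitely many shells suffice, but the bound is independent of [e]. *)
Lemma integral_ker : (\int[@lebesgue4 R]_p (ker p)%:E <= 128%:E)%E.
Proof.
have T0 := lt_le_trans ltr01 T1.
have [N eN] : exists N : nat, 4 ^- N <= e.
  exists (Num.bound e^-1); rewrite -[leRHS]invrK lef_pV2 ?posrE ?invr_gt0 ?exprn_gt0 //.
  apply: ltW; apply: lt_le_trans (archi_boundP _) _; first by rewrite invr_ge0 ltW.
  by rewrite -natrX ler_nat ltnW // ltn_expl.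
pose b (n : nat) (p : mplane2 R) : R := 4 ^+ n.+1 * \1_(cube q (2 ^- n)) p.
have mb n : measurable_fun setT (b n).
  by apply: measurable_funM => //; apply: measurable_indic; exact: measurable_cube.
have b0 n p : 0 <= b n p by rewrite mulr_ge0 // exprn_ge0.
have kb p : ker p <= \sum_(n < N) b n p.
  have [TS|TS] := leP T^-1 (sig p).
    by rewrite ker_eq0 //; apply: sumr_ge0.
  have S0 := sig_gt0 p.
  have [n [nN n1 n2]] : exists n, [/\ (n < N)%N, 4 ^- n.+1 <= sig p & sig p < 4 ^- n].
    have : 4 ^- N <= sig p by apply: le_trans eN (sig_ge p).
    elim: (N) => [|m IH] m1.
      exfalso; move: m1; rewrite expr0 invr1 leNgt => /negP; apply.
      by apply: lt_le_trans TS _; rewrite invf_le1.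
    have [/IH[n [nm n1 n2]]|mS] := leP (4 ^- m) (sig p).
      by exists n; split=> //; exact: ltnW.
    by exists m.
  rewrite (bigD1 (Ordinal nN)) //= ler_wpDr //; first by apply: sumr_ge0.
  apply: le_trans (ker_le p) _; rewrite /b indicE mem_set ?mulr1.
    by rewrite -[leRHS]invrK lef_pV2 ?posrE // invr_gt0 exprn_gt0.
  apply/cube_coord4E => i i4.
  have i0 : 0 <= 2 ^- n :> R by rewrite invr_ge0 exprn_ge0.
  rewrite -(@ler_pXn2r _ 2) ?nnegrE // real_normK ?num_real //.
  apply: le_trans (coord_sig p i4) _.
  have -> : 2 ^- n ^+ 2 = 4 ^- n :> R.
    by rewrite exprVn exprAC; congr ((_ ^+ _)^-1); ring.
  by apply: ltW; apply: lt_trans n2; rewrite gtrBl.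
have mker : measurable_fun [set: mplane2 R] ker.
  by apply: continuous_measurable_fun4; have [] := smooth_ker 0%N.
apply: (@le_trans _ _ (\int[@lebesgue4 R]_p (\sum_(n < N) (b n p)%:E))%E).
  apply: ge0_le_integral => //.
  - by move=> p _; rewrite lee_fin ker_ge0.
  - exact/measurable_EFinP.
  - by apply: emeasurable_sum => n; exact/measurable_EFinP.
  by move=> p _; rewrite sumEFin lee_fin.
rewrite ge0_integral_sum //; last 2 first.
- by move=> n; exact/measurable_EFinP.
- by move=> n p _; rewrite lee_fin.
have -> : (\sum_(n < N) \int[@lebesgue4 R]_p (b n p)%:E)%E =
    (\sum_(n < N) 64 * 4 ^- n)%:E.
  rewrite -sumEFin; apply: eq_bigr => n _.
  have mc : measurable (cube q (2 ^- n)) by exact: measurable_cube.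
  under eq_integral do rewrite EFinM.
  rewrite ge0_integralZl_EFin //; last exact/measurable_EFinP.
  rewrite integral_indic // setIT [X in (_ * X)%E]lebesgue4_cube; last first.
    by rewrite invr_ge0 exprn_ge0.
  rewrite -EFinM; congr EFin; rewrite exprS.
  have -> : 4 ^+ n = (2 ^+ n) ^+ 2 :> R by rewrite exprAC; congr (_ ^+ _); ring.
  have n0 : 2 ^+ n != 0 :> R by rewrite expf_neq0.
  by field.
rewrite lee_fin -mulr_sumr.
have geo : \sum_(n < N) 4 ^- n <= 2 - 2 * 4 ^- N :> R.
  elim: (N) => [|m IH]; first by rewrite big_ord0 expr0 invr1; lra.
  rewrite big_ord_recr /=.
  have : 4 ^- m.+1 = 4^-1 * 4 ^- m :> R by rewrite exprS invfM.
  have : 0 < 4 ^- m :> R by rewrite invr_gt0 exprn_gt0.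
  by move: IH; move: (\sum_(i < m) _) (4 ^- m) (4 ^- m.+1) => *; lra.
have : 0 < 4 ^- N :> R by rewrite invr_gt0 exprn_gt0.
by move: geo; move: (\sum_(i < N) _) (4 ^- N) => *; lra.
Qed.

End Kernel.

(** * Periodizing the kernel over the lattice *)

Section Periodization.
Context {R : realType} (L : lattice R).
Local Notation V := (cplane2 R).
Local Notation mu := (dvolX L).

Lemma flat_lap_near (g g' : V -> R) p : (\forall q \near p, g q = g' q) ->
  flat_lap g p = flat_lap g' p.
Proof.
move=> gg; have D2E : D2 g ^~ p = D2 g' ^~ p.
  apply/funext => v; rewrite /D2; apply: near_eq_derive.
  by have := nbhs_interior gg; apply: filterS => q; exact: near_eq_derive.
exact: (f_equal (fun k : V -> R =>
  - (2 * (4^-1 * (k ((1, 0), 0) + k ((0, 1), 0))) +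
     2 * (4^-1 * (k (0, (1, 0)) + k (0, (0, 1)))))) D2E).
Qed.

Variables (q : V) (e rho : R).
Hypotheses (e0 : 0 < e) (rho0 : 0 < rho) (rho1 : rho <= 1).
Hypothesis rhoL : forall chi, lattice_set L chi -> `|chi| < 4 * rho -> chi = 0.

Local Notation T := (rho ^- 2).
Local Notation kr c := (ker (translate c q) e T).

Lemma T_ge1 : 1 <= T.
Proof. by rewrite invf_ge1 ?exprn_gt0 // exprn_ile1 // ltW. Qed.

Lemma ker_translate chi p : ker q e T (translate chi p) = kr (- chi) p.
Proof.
rewrite /ker /kerarg (_ : sig q e (translate chi p) =
  sig (translate (- chi) q) e p) //.
rewrite /sig /quad; congr (_ + _).
apply: eq_bigr => -[[|[|[|[|i]]]] i4] _ //; rewrite /coord4 /translate /=; ring.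
Qed.

Lemma sig_lt_norm (c p : V) : sig c e p < rho ^+ 2 -> `|p - c| <= rho.
Proof.
move=> S; apply/cubeE/cube_coord4E => i i4.
rewrite -(@ler_pXn2r _ 2) ?nnegrE ?(ltW rho0) // real_normK ?num_real //.
apply: le_trans (coord_sig c e p i4) _.
by apply/ltW; apply: lt_trans S; rewrite gtrBl.
Qed.

Lemma ker_far (c p : V) : rho < `|p - c| -> rho ^+ 2 <= sig c e p.
Proof.
move=> pc; rewrite leNgt; apply/negP => /sig_lt_norm.
by apply/negP; rewrite -ltNge.
Qed.

(** The radius is twice that of the support. The margin makes the choice of translate stable near p,
    while [4 * rho] in [rhoL] still forces uniqueness. *)
Definition close (p : V) chi :=
  lattice_set L chi /\ `|p.1 + chi - q.1| < 2 * rho.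

(* By rhoL at most one lattice translate of p lies in the support of the
   kernel, so this is the sum of the kernel over the orbit. *)
Definition perker (p : V) : R :=
  if pselect (exists chi, close p chi) is left H
  then ker q e T (translate (projT1 (cid H)) p) else 0.

Lemma close_uniq p chi chi' : close p chi -> close p chi' -> chi = chi'.
Proof.
move=> [Lc c2] [Lc' c2']; apply/eqP; rewrite -subr_eq0; apply/eqP; apply: rhoL.
  by apply: lattice_setD => //; exact: lattice_setN.
have -> : chi - chi' = (p.1 + chi - q.1) - (p.1 + chi' - q.1).
  rewrite opprB addrA subrK opprD addrA [p.1 + chi]addrC addrK //.
apply: le_lt_trans (ler_normB _ _) _; lra.
Qed.

Lemma perker_close p chi : close p chi -> perker p = kr (- chi) p.
Proof.
move=> pc; rewrite -ker_translate /perker; case: pselect => [H|[]]; last by exists chi.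
by case: (cid H) => chi' /= pc'; rewrite (close_uniq pc pc').
Qed.

Lemma perker_far p :
  (forall chi, lattice_set L chi -> rho < `|p.1 + chi - q.1|) -> perker p = 0.
Proof.
move=> far; rewrite /perker; case: pselect => // H; case: (cid H) => chi [Lc _] /=.
rewrite (ker_eq0 e0 T_ge1) // invrK; apply: ker_far.
apply: lt_le_trans (far chi Lc) _.
by rewrite prod_normE le_max /translate /= lexx.
Qed.

Lemma close_near p chi : close p chi ->
  \forall p' \near p, perker p' = kr (- chi) p'.
Proof.
move=> pc; have [Lc c2] := pc.
have d0 : 0 < 2 * rho - `|p.1 + chi - q.1| by rewrite subr_gt0.
near=> p'; apply: perker_close; split => //.
have -> : p'.1 + chi - q.1 = (p'.1 - p.1) + (p.1 + chi - q.1).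
  by rewrite !addrA subrK.
apply: le_lt_trans (ler_normD _ _) _; rewrite -ltrBrDr.
apply: (@le_lt_trans _ _ `|p - p'|).
  by rewrite distrC [leRHS]prod_normE le_max lexx.
near: p'; have := @nbhsx_ballx _ _ p _ d0.
by apply: filterS => p'; rewrite -ball_normE.
Unshelve. all: by end_near. Qed.

(** If no translate is within [2 * rho] at p, then none is within [rho] at nearby points. Smoothness
    and the Laplacian of the periodization thus reduce to those of a single kernel or of 0. *)
Lemma perker_local p :
  (exists2 chi, close p chi & \forall p' \near p, perker p' = kr (- chi) p') \/
  (\forall p' \near p, perker p' = 0).
Proof.
have [[chi pc]|nc] := pselect (exists chi, close p chi).
  by left; exists chi => //; exact: close_near.
right; near=> p'; apply: perker_far => chi Lc; rewrite ltNge; apply/negP => pc.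
apply: nc; exists chi; split => //.
have -> : p.1 + chi - q.1 = (p.1 - p'.1) + (p'.1 + chi - q.1).
  by rewrite !addrA subrK.
apply: le_lt_trans (ler_normD _ _) _; rewrite (_ : 2 * rho = rho + rho); last by ring.
apply: ltr_leD => //; apply: (@le_lt_trans _ _ `|p - p'|).
  by rewrite prod_normE le_max lexx.
near: p'; have := @nbhsx_ballx _ _ p _ rho0.
by apply: filterS => p'; rewrite -ball_normE.
Unshelve. all: by end_near. Qed.

Lemma smooth_perker : smooth perker.
Proof.
move=> n; apply: Cn_local => p; have [[chi _ H]|H] := perker_local p.
  exists (kr (- chi)); first exact: smooth_ker.
  by apply: filterS H => p' ->.
exists (fun=> 0); first exact: Cn_cst.
by apply: filterS H => p' ->.
Qed.

Lemma periodic_perker : lattice_periodic L perker.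
Proof.
move=> chi' p Lchi'.
have tr chi : translate chi (translate chi' p) = translate (chi' + chi) p.
  by rewrite /translate /= addrA.
have [[chi pc]|nc] := pselect (exists chi, close p chi).
  rewrite (perker_close pc).
  have pc' : close (translate chi' p) (chi - chi').
    have [Lc c2] := pc; split.
      by apply: lattice_setD => //; exact: lattice_setN.
    by rewrite /translate /= addrA [p.1 + chi' + chi]addrAC addrK.
  rewrite (perker_close pc') -!ker_translate tr.
  by rewrite addrC subrK.
rewrite /perker; case: pselect => [[chi [Lc c2]]|_].
  exfalso; apply: nc; exists (chi' + chi); split.
    exact: lattice_setD.
  by rewrite addrA.
by case: pselect.
Qed.

Lemma perker_ge0 p : 0 <= perker p.
Proof. by rewrite /perker; case: pselect => // H; exact: ker_ge0. Qed.

Lemma perker_far2 p : rho < `|p.2 - q.2| -> perker p = 0.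
Proof.
move=> far; rewrite /perker; case: pselect => // H.
rewrite (ker_eq0 e0 T_ge1) // invrK; apply: ker_far.
apply: lt_le_trans far _.
by rewrite prod_normE le_max /translate /= lexx orbT.
Qed.

Definition perkerX : quotX L -> R := perker \o @reprX R L.

Lemma test_perkerX : test_fun perkerX.
Proof.
apply: (@test_funP _ _ _ (`|q.2| + rho)).
- exact: periodic_perker.
- exact: smooth_perker.
move=> p pq; apply: perker_far2.
rewrite -(ltrD2l `|q.2|); apply: lt_le_trans pq _.
by rewrite -[p.2 in leLHS](subrK q.2) addrC ler_normD.
Qed.

Lemma flat_lap_ker c p : flat_lap (kr c) p = - (lapker (translate c q) e T p / 2).
Proof.
have [G lk] := @lapd_ker R (translate c q) e T e0.
exact: flat_lapE lk.
Qed.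

Lemma lapX_perkerX p : lapX perkerX (piX L p) = flat_lap perker p.
Proof. by rewrite lapX_piX /perkerX periodic_reprK //; exact: periodic_perker. Qed.

(** As [rho <= 1], the truncation error lives over |w - q.2| <= 1. Paired with [f], it costs a
    multiple of the very integral bounded by [global_estimate]. *)
Lemma perker_lap_ge p : - (ker_const T * \1_(ballX q.2 1) (piX L p)) <=
  flat_lap perker p.
Proof.
have kc0 := ker_const_ge0 T_ge1.
have i0 : - (ker_const T * \1_(ballX q.2 1) (piX L p)) <= 0.
  by rewrite oppr_le0 mulr_ge0.
have [[chi pc H]|H] := perker_local p; last by rewrite (flat_lap_near0 H).
rewrite (flat_lap_near H) flat_lap_ker.
have [pb|pb] := leP `|p.2 - q.2| 1.
  rewrite indicE mem_set ?mulr1; first by rewrite lerN2 lapker_le // T_ge1.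
  by rewrite /ballX /= wX_piX.
rewrite (lapker_eq0 e0 T_ge1) ?mul0r ?oppr0 // invrK.
apply: ker_far; apply: le_lt_trans rho1 _.
apply: lt_le_trans pb _.
by rewrite prod_normE le_max /translate /= lexx orbT.
Qed.

Lemma perker_lap_near p r : e = r ^+ 2 -> 0 < r -> r < rho ->
  5 * e <= (1 + T)^-1 -> cube q r p ->
  4 / 125 * expR (-1) * r ^- 4 - ker_const T <= flat_lap perker p.
Proof.
move=> er r0 rr eT pq.
have pc : close p 0.
  split; first exact: lattice_set0.
  rewrite addr0; apply: (@le_lt_trans _ _ r).
    have : `|p - q| <= r by exact/cubeE.
    by rewrite prod_normE ge_max => /andP[].
  by apply: lt_trans rr _; rewrite ltr_pMl // ltr1n.
rewrite (flat_lap_near (close_near pc)) flat_lap_ker oppr0.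
have -> : translate 0 q = q by rewrite /translate addr0 -surjective_pairing.
have -> : r ^- 4 = e ^- 2 by rewrite er -exprM.
apply: lapker_le_near => //; first exact: T_ge1.
(* On the cube each of the four squared coordinates is at most [r ^+ 2 = e], whence
   [sig <= 5 * e]. *)
rewrite /sig /quad (_ : 5 * e = e + \sum_(i < 4) e); last first.
  by rewrite !big_ord_recl big_ord0; ring.
rewrite lerD2l; apply: ler_sum => i _; rewrite mul1r er.
rewrite -real_normK ?num_real // lerXn2r ?nnegrE ?(ltW r0) //.
by move/cube_coord4E: pq; exact.
Qed.

(** Over one cell only the translates listed in [c] can be active, and each contributes at most the
    integral of the kernel over all of R^4. *)
Lemma integral_perker (I : finType) (c : I -> cplane R) :
  (forall p chi, fundamental_cell L p.1 -> close p chi -> exists i, chi = c i) ->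
  (\int[@lebesgue4 R]_(p in cellX L) (perker p)%:E <= (128 *+ #|I|)%:E)%E.
Proof.
move=> cP.
have pk p : cellX L p -> perker p <= \sum_i kr (- c i) p.
  move=> cp; have s0 : 0 <= \sum_i kr (- c i) p.
    by apply: sumr_ge0 => i _; exact: ker_ge0.
  rewrite {1}/perker; case: pselect => // H; case: (cid H) => chi /= pc.
  have [i ->] := cP _ _ cp.1 pc.
  rewrite ker_translate (bigD1 i) //= lerDl.
  by apply: sumr_ge0 => j _; exact: ker_ge0.
have mk (x : V) : measurable_fun [set: mplane2 R] (ker x e T).
  by apply: continuous_measurable_fun4; have [] := smooth_ker x T e0 0%N.
have mpk : measurable_fun [set: mplane2 R] perker.
  by apply: continuous_measurable_fun4; have [] := smooth_perker 0%N.
have mc := @measurable_cellX R L.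
apply: (@le_trans _ _ (\int[@lebesgue4 R]_(p in cellX L) (\sum_i (kr (- c i) p)%:E))%E).
  apply: ge0_le_integral => //.
  - by move=> p _; rewrite lee_fin perker_ge0.
  - by apply/measurable_EFinP; exact: measurable_funS mpk.
  - apply: emeasurable_sum => i; apply/measurable_EFinP.
    exact: measurable_funS (mk _).
  by move=> p cp; rewrite sumEFin lee_fin pk.
rewrite ge0_integral_sum //; last 2 first.
- by move=> i; apply/measurable_EFinP; exact: measurable_funS (mk _).
- by move=> i p _; rewrite lee_fin ker_ge0.
rewrite -sumr_const -sumEFin; apply: lee_sum => i _.
apply: le_trans (integral_ker (translate (- c i) q) e0 T_ge1).
apply: ge0_subset_integral => //.
- by apply/measurable_EFinP; exact: mk.
- by move=> p _; rewrite lee_fin ker_ge0.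
Qed.

End Periodization.

(** Close to a given q, each of the two integer coordinates of the translation takes at most two
    values. The resulting count of four is independent of q, which keeps the integral of the
    periodized kernel uniform. *)
Lemma lattice_translates {R : realType} (L : lattice R) :
  exists2 d : R, 0 < d & forall q : cplane R,
    exists c : 'I_2 * 'I_2 -> cplane R, forall z chi, fundamental_cell L z ->
      lattice_set L chi -> `|z + chi - q| < d -> exists i, chi = c i.
Proof.
have [s [t [stE sE tE [C C0 stC]]]] := lattice_coordinates L.
(* The hypotheses place [m] strictly between x - 3/2 and x + 1/2, an open interval of length 2. *)
have int_range (x a : R) (m : int) : 0 <= a < 1 -> `|a + m%:~R - x| < 2^-1 ->
    exists i : 'I_2, m = Num.floor (x - 3 / 2) + 1 + i%:Z.
  move=> /andP[a0 a1]; rewrite ltr_norml => /andP[m1 m2].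
  have /andP[f1 f2] := real_floor_itv (num_real (x - 3 / 2)).
  move: f1 f2; set k := Num.floor _ => f1 f2; rewrite intrD in f2.
  have k1 : k < m by rewrite -(ltr_int R); lra.
  have k2 : m < k + 3 by rewrite -(ltr_int R) intrD; lra.
  have [->|mk] := eqVneq m (k + 1); first by exists ord0; rewrite addr0.
  by exists (@Ordinal 2 1 isT) => /=; lia.
exists (C^-1 / 2); first by rewrite divr_gt0 // invr_gt0.
move=> q.
exists (fun i : 'I_2 * 'I_2 => (Num.floor (s q - 3 / 2) + 1 + i.1%:Z)%:~R *: (lattice_basis L).1 +
  (Num.floor (t q - 3 / 2) + 1 + i.2%:Z)%:~R *: (lattice_basis L).2).
move=> z chi [a [b [a01 b01 ->]]] /lattice_setP[m [n ->]].
set y := (_ - q) => yd.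
have yE : y = (a + m%:~R - s q) *: (lattice_basis L).1 +
    (b + n%:~R - t q) *: (lattice_basis L).2.
  rewrite /y [in LHS](stE q) !scalerBl !scalerDl [in LHS]addrACA [in LHS]opprD.
  by rewrite [LHS]addrACA.
have Cy : C * `|y| < 2^-1.
  by rewrite mulrC -ltr_pdivlMr // [ltRHS]mulrC.
have [] := stC y; rewrite {1 3}yE sE tE => sy ty.
have [i ->] := int_range _ _ _ a01 (le_lt_trans sy Cy).
have [j ->] := int_range _ _ _ b01 (le_lt_trans ty Cy).
by exists (i, j).
Qed.

(** * Bound for the averages of f over small cubes *)

Section LocalEstimate.
Context {R : realType} (L : lattice R).
Local Notation V := (cplane2 R).
Local Notation mu := (dvolX L).

Lemma integral_perkerX (q : V) e rho (I : finType) (c : I -> cplane R) :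
  0 < e -> 0 < rho -> rho <= 1 ->
  (forall chi, lattice_set L chi -> `|chi| < 4 * rho -> chi = 0) ->
  (forall z chi, fundamental_cell L z -> lattice_set L chi ->
     `|z + chi - q.1| < 2 * rho -> exists i, chi = c i) ->
  mu.-integrable setT (EFin \o @perkerX R L q e rho) /\
  \int[mu]_x (@perkerX R L q e rho x) <= 128 *+ #|I|.
Proof.
move=> e0 rho0 rho1 rhoL cP.
have th := test_perkerX q e0 rho0 rho1 rhoL.
have mh := test_fun_measurable th.
have h0 x : 0 <= @perkerX R L q e rho x by exact: perker_ge0.
apply: le_Rintegral_bound => //.
rewrite ge0_integral_dvolX //; last first.
- exact/measurable_EFinP.
under eq_integral => p _.
  rewrite -[perkerX _ _ _ _]/((perker L q e rho \o @reprX R L \o piX L) p).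
  rewrite periodic_reprK; last exact: periodic_perker.
  over.
by apply: integral_perker => // p chi cp [Lc c2]; exact: cP c2.
Qed.

(* On the cube of radius r the kernel with e = r^2 has Laplacian of order
   - r^-4 and its integral is bounded independently of r: testing against it
   bounds the averages of f over small cubes. *)
Lemma local_estimate (delta : R) : 0 < delta ->
  exists2 K, 0 <= K & exists2 r0, 0 < r0 &
  forall (f : quotX L -> R) M B (q : V) r, measurable_fun setT f ->
    (forall x, 0 <= f x <= M) -> 0 < B ->
    distr_le (distr_lap f) (distr_of (fun x => B * phiX L delta x)) ->
    0 < r -> r < r0 ->
    (\int[@lebesgue4 R]_(p in cube q r) (f (piX L p) * \1_(cellX L) p)%:E <=
     (K * (B + \int[mu]_x (f x * \1_(ballX q.2 1) x)) * (2 * r) ^+ 4)%:E)%E.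
Proof.
move=> delta0.
have [r1 r10 Ldisc] := lattice_discrete L.
have [d d0 Lcell] := lattice_translates L.
(* The bound 1 keeps the kernel over {|w - q.2| <= 1}, [r1 / 4] makes the close translate unique,
   and [d / 2] limits the number of translates reaching the cell. *)
pose rho := Num.min 1 (Num.min (r1 / 4) (d / 2)).
have rho0 : 0 < rho by rewrite /rho !lt_min ltr01 !divr_gt0.
have rho1 : rho <= 1 by rewrite /rho ge_min lexx.
have rhor : 4 * rho <= r1.
  by rewrite mulrC -ler_pdivlMr // /rho !ge_min lexx orbT.
have rhod : 2 * rho <= d.
  by rewrite mulrC -ler_pdivlMr // /rho !ge_min lexx !orbT.
have rhoL chi : lattice_set L chi -> `|chi| < 4 * rho -> chi = 0.
  by move=> Lc c4; apply: Ldisc => //; exact: lt_le_trans rhor.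
have T1 := T_ge1 rho0 rho1.
set T := rho ^- 2 in T1; pose k := ker_const T; have k0 : 0 <= k := ker_const_ge0 T1.
have [N N0 NE] : exists2 N : R, 0 <= N & N = 128 *+ (2 * 2) by exists (128 *+ (2 * 2)).
pose e4 : R := 4 / 125 * expR (-1).
have e40 : 0 < e4 by rewrite /e4 mulr_gt0 ?expR_gt0.
have TT : 0 < 1 + T by rewrite addr_gt0 // (lt_le_trans _ T1).
(* [N] bounds the integral of the kernel, [k] its truncation error, and [e4 * r ^- 4] is its gain on
   the cube; 16 turns r^4 into (2 r)^4. *)
exists ((N + k) / (e4 * 16)).
  by rewrite divr_ge0 ?addr_ge0 // ?mulr_ge0 // ltW.
(* As [r < rho <= 1], the second bound gives 5 r^2 <= 5 r <= (1 + T)^-1, the smallness that the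
   kernel estimate near [q] requires. *)
exists (Num.min rho (5 * (1 + T))^-1).
  by rewrite lt_min rho0 invr_gt0 mulr_gt0.
move=> f M B q r mf fM B0 fle r0; rewrite lt_min => /andP[rr rT].
have fabs x : `|f x| <= M by have /andP[a b] := fM x; rewrite ger0_norm.
have [c cP] := Lcell q.1.
have e0 : 0 < r ^+ 2 by rewrite exprn_gt0.
have eT : 5 * r ^+ 2 <= (1 + T)^-1.
  apply: (@le_trans _ _ (5 * r)).
    by rewrite ler_pM2l // expr2 ler_piMr ?(ltW r0) // ltW // (lt_le_trans rr).
  by rewrite mulrC -ler_pdivlMr // -invfM [_ * 5]mulrC ltW.
pose h := @perkerX R L q (r ^+ 2) rho.
have th : test_fun h := test_perkerX q e0 rho0 rho1 rhoL.
have h0 x : 0 <= h x by exact: perker_ge0.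
have [ih Ih] : mu.-integrable setT (EFin \o h) /\
    \int[mu]_x h x <= 128 *+ #|{: 'I_2 * 'I_2}|.
  apply: (@integral_perkerX _ _ _ _ c) => // z chi cz Lc c2.
  by apply: cP Lc _; [exact: cz|exact: lt_le_trans rhod].
rewrite card_prod card_ord -NE in Ih.
set b : quotX L -> R := \1_(ballX q.2 1).
have mb : measurable (ballX q.2 1 : set (quotX L)) by exact: measurable_ballX.
have mbb : measurable_fun setT b by exact: measurable_indic.
have b0 x : 0 <= b x by rewrite /b.
set J := \int[mu]_x _.
have ib : mu.-integrable setT (EFin \o (fun x => f x * b x)).
  apply: ball_bounded_integrable; first exact: measurable_funM.
  apply: ball_boundedM fabs _; apply: (@ball_boundedP _ _ _ (1 + `|q.2|) 1).
    move=> x xr; rewrite /b indicE memNset // /ballX /= => xc.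
    move: xr; apply/negP; rewrite -leNgt -[wX x](subrK q.2).
    by rewrite (le_trans (ler_normD _ _)) // lerD2r.
  by move=> x _; rewrite /b indicE ger0_norm //; case: (x \in _).
have il := integrable_lap mf fabs th.
have ikb : mu.-integrable setT (EFin \o (fun x => k * (f x * b x))).
  by apply: eq_integrable (integrableZl measurableT k ib).
(* Adding the truncation error makes the integrand nonnegative on all of X, so its integral over the
   cube is at most its integral over X. *)
pose W x := f x * lapX h x + k * (f x * b x).
have iW : mu.-integrable setT (EFin \o W).
  by apply: eq_integrable (integrableD measurableT il ikb).
have WE x : W x = f x * (lapX h x + k * b x) by rewrite /W mulrDr mulrCA.
have W0 x : 0 <= W x.
  have /andP[f0 _] := fM x; rewrite WE mulr_ge0 // -lerBlDr sub0r.
  have [p _ <-] := piX_surj x.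
  by rewrite lapX_perkerX // perker_lap_ge.
have IW : \int[mu]_x W x <= B * (N) + k * J.
  rewrite /W RintegralD // RintegralZl // lerD2r.
  apply: le_trans (fle h th h0) _; rewrite /distr_of.
  apply: (@le_trans _ _ (\int[mu]_x (B * h x))).
    apply: le_Rintegral => //.
    - have tb := test_fun_ball_bounded th.
      apply: ball_bounded_integrable.
        apply: measurable_funM; last exact: test_fun_measurable.
        by apply: measurable_funM => //; exact: measurable_phiX.
      apply: ball_boundedM (_ : forall x, `|_| <= B) tb => x.
      by rewrite ger0_norm ?mulr_ge0 ?phiX_ge0 ?ler_piMr ?phiX_le1 // ltW.
    - by apply: eq_integrable (integrableZl measurableT B ih).
    move=> x _; apply: ler_wpM2r => //.
    by rewrite ler_piMr ?phiX_le1 // ltW.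
  by rewrite RintegralZl // ler_pM2l.
have mW : measurable_fun setT W by apply/measurable_EFinP; have /integrableP[] := iW.
have mic : measurable_fun [set: mplane2 R] (\1_(cellX L) : mplane2 R -> R).
  by apply: measurable_indic; exact: measurable_cellX.
have mWp : measurable_fun [set: mplane2 R] (fun p => W (piX L p) * \1_(cellX L) p).
  apply: measurable_funM mic.
  exact: measurableT_comp mW (@measurable_piX R L).
have mfp : measurable_fun [set: mplane2 R] (fun p => f (piX L p) * \1_(cellX L) p).
  apply: measurable_funM mic.
  exact: measurableT_comp mf (@measurable_piX R L).
have mc := @measurable_cellX R L.
have mq := measurable_cube q r.
pose a := r ^+ 4 / e4.
have a0 : 0 <= a by rewrite divr_ge0 ?exprn_ge0 // ltW.
have maW : measurable_fun [set: mplane2 R]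
    (fun p => a * (W (piX L p) * \1_(cellX L) p)).
  by apply: measurable_funM mWp; exact: measurable_cst.
apply: (@le_trans _ _ (\int[@lebesgue4 R]_p (a * (W (piX L p) * \1_(cellX L) p))%:E)%E).
  apply: (@le_trans _ _ (\int[@lebesgue4 R]_(p in cube q r)
      (a * (W (piX L p) * \1_(cellX L) p))%:E)%E); last first.
    apply: ge0_subset_integral => //; first exact/measurable_EFinP.
    by move=> p _; rewrite lee_fin (mulr_ge0 a0) // mulr_ge0.
  apply: ge0_le_integral => //.
  - by move=> p _; rewrite lee_fin mulr_ge0 //; have /andP[] := fM (piX L p).
  - by apply/measurable_EFinP; exact: measurable_funS mfp.
  - by apply/measurable_EFinP; exact: measurable_funS maW.
  move=> p pq; rewrite lee_fin mulrA ler_wpM2r //.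
  have /andP[f0 _] := fM (piX L p).
  have lo := perker_lap_near e0 rho0 rho1 rhoL erefl r0 rr eT pq.
  have bp : b (piX L p) = 1.
    rewrite /b indicE mem_set // /ballX /= wX_piX.
    have : `|p - q| <= r by exact/cubeE.
    rewrite prod_normE ge_max => /andP[_] /le_trans; apply.
    exact: ltW (lt_le_trans rr rho1).
  have : e4 * r ^- 4 <= lapX h (piX L p) + k * b (piX L p).
    by rewrite bp mulr1 lapX_perkerX // -lerBlDr.
  move=> /(ler_wpM2l a0); rewrite /a mulrA divfK ?gt_eqF // divff ?gt_eqF ?exprn_gt0 //.
  by move=> /(ler_wpM2l f0); rewrite mulr1 mulrCA -WE.
under eq_integral do rewrite EFinM.
rewrite ge0_integralZl_EFin //; last 2 first.
- by move=> p _; rewrite lee_fin mulr_ge0.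
- exact/measurable_EFinP.
(* The indicator keeps a single fundamental domain, so the integral over R^4 is exactly the one over
   X. *)
have -> : (\int[@lebesgue4 R]_p (W (piX L p) * \1_(cellX L) p)%:E = \int[mu]_x (W x)%:E)%E.
  rewrite ge0_integral_dvolX //; last exact/measurable_EFinP.
  rewrite [RHS]integral_mkcond; apply: eq_integral => p _.
  by rewrite patchE indicE; case: (p \in _); rewrite ?mulr1 ?mulr0.
rewrite -[X in (_ * X)%E]fineK; last exact: integrable_fin_num iW.
rewrite -EFinM lee_fin.
have J0 : 0 <= J.
  by apply: Rintegral_ge0 => x _; have /andP[f0 _] := fM x; rewrite mulr_ge0.
apply: le_trans (ler_wpM2l a0 IW) _.
have -> : (N + k) / (e4 * 16) * (B + J) * (2 * r) ^+ 4 =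
    a * ((N + k) * (B + J)).
  by rewrite /a; field; rewrite gt_eqF.
rewrite ler_wpM2l // mulrDl !mulrDr.
have := mulr_ge0 k0 (ltW B0).
have : 0 <= N * J by rewrite mulr_ge0.
rewrite [B * N]mulrC.
move: (N * B) (N * J) (k * B) (k * J) => *; lra.
Qed.

End LocalEstimate.

(** * The essential supremum bound *)

Section SupBound.
Context {R : realType} (L : lattice R).
Local Notation mu := (dvolX L).

Lemma ae_dvolX_le (g : quotX L -> R) D : measurable_fun setT g ->
  {ae @lebesgue4 R, forall p, g (piX L p) * \1_(cellX L) p <= D} ->
  {ae mu, forall x, g x <= D}.
Proof.
move=> mg [N [mN N0 gN]]; exists (g @^-1` `]D, +oo[); split.
- by rewrite -[X in measurable X]setTI; exact: mg.
- rewrite dvolXE; apply/eqP; rewrite -measure_le0 -N0; apply: le_measure.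
  + rewrite inE; apply: measurableI; last exact: measurable_cellX.
    have := @measurable_piX R L measurableT (g @^-1` `]D, +oo[).
    by rewrite setTI; apply; rewrite -[X in measurable X]setTI; exact: mg.
  + by rewrite inE.
  move=> p [/= ]; rewrite in_itv /= andbT => Dg pc; apply: gN => /=.
  by rewrite indicE mem_set // mulr1; apply/negP; rewrite -ltNge.
by move=> x /= /negP; rewrite -ltNge in_itv /= andbT.
Qed.

Variable delta : R.
Hypothesis delta0 : 0 < delta.

Lemma bounded_estimate : exists2 C : R -> R, (forall B, 0 < B -> 0 < C B) &
  forall (g : quotX L -> R) M B, measurable_fun setT g ->
    (forall x, 0 <= g x <= M) -> 0 < B ->
    distr_le (distr_lap g) (distr_of (fun x => B * phiX L delta x)) ->
    {ae mu, forall x, g x <= C B * (1 + \int[mu]_x (g x * phiX L delta x))}.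
Proof.
have [K1 K10 glob] := global_estimate L delta0.
have [K2 K20 [r0 r00 loc]] := local_estimate L delta0.
have K0 : 0 <= K2 * (1 + K1) by rewrite mulr_ge0 // addr_ge0.
(* The two estimates combine to [K2 * (B + K1 * (B + I))], which this constant times [1 + I]
   dominates; the final 1 gives strict positivity even if [K2 = 0]. *)
exists (fun B => K2 * (1 + K1) * (B + 1) + 1).
  by move=> B B0; rewrite ltr_wpDl // mulr_ge0 // addr_ge0 // ltW.
move=> g M B mg gM B0 gle; set I := \int[mu]_x _.
have I0 : 0 <= I.
  by apply: Rintegral_ge0 => x _; have /andP[a _] := gM x; rewrite mulr_ge0 ?phiX_ge0.
pose D := K2 * (B + K1 * (B + I)).
have D0 : 0 <= D by rewrite mulr_ge0 ?addr_ge0 ?mulr_ge0 ?addr_ge0 // ltW.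
have DC : D <= (K2 * (1 + K1) * (B + 1) + 1) * (1 + I).
  have -> : D = K2 * (1 + K1) * B + K2 * K1 * I by rewrite /D; ring.
  have -> : (K2 * (1 + K1) * (B + 1) + 1) * (1 + I) =
    K2 * (1 + K1) * B + K2 * K1 * I +
    (K2 * (1 + K1) + K2 * (1 + K1) * B * I + K2 * I + 1 + I) by ring.
  by rewrite lerDl !addr_ge0 // !mulr_ge0 ?addr_ge0 // ltW.
suff : {ae mu, forall x, g x <= D}.
  by apply: filterS => x /le_trans; apply.
apply: ae_dvolX_le => //; apply: (@ae_le_cube_averages _ _ _ r0) => //.
- apply: measurable_funM; last by apply: measurable_indic; exact: measurable_cellX.
  exact: measurableT_comp mg (@measurable_piX R L).
- by move=> p; have /andP[a _] := gM (piX L p); rewrite mulr_ge0.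
move=> q r rpos rr; apply: le_trans (loc g M B q r mg gM B0 gle rpos rr) _.
rewrite lee_fin ler_wpM2r ?exprn_ge0 ?mulr_ge0 ?(ltW rpos) //.
by rewrite ler_wpM2l // lerD2l; exact: glob gM B0 gle.
Qed.

End SupBound.

Theorem proposition3p4 (R : realType) (Gamma : lattice R)
    (delta : R) (hdelta : 0 < delta) :
  (\int[dvolX Gamma]_x (phiX Gamma delta x)%:E < +oo)%E /\
  exists C : R -> R,
    [/\ forall B : R, 0 < B -> 0 < C B,
        forall (f : quotX Gamma -> R) (B : R), 0 < B ->
          ess_bounded f -> {ae dvolX Gamma, forall x, 0 <= f x} ->
          distr_le (distr_lap f) (distr_of (fun x => B * phiX Gamma delta x)) ->
          (ess_sup (dvolX Gamma) (EFin \o f) <=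
             (C B)%:E *
             (1 + \int[dvolX Gamma]_x (f x * phiX Gamma delta x)%:E))%E
      & forall f : quotX Gamma -> R,
          ess_bounded f ->
          distr_le (distr_lap f) (fun=> 0) ->
          distr_eq (distr_lap f) (fun=> 0) ].
Proof.
split; first exact: integral_phiX_fin.
have [C C0 bound] := bounded_estimate Gamma hdelta.
exists C; split=> // [f B B0 [mf [M fM]] f0 fle|f]; last exact: distr_lap_sub0.
(* Integrals and the essential supremum ignore null sets, so [f] is replaced by a function with
   values in [0, N] everywhere, as [bounded_estimate] requires. *)
pose N := Num.max 0 M; have N0 : 0 <= N by rewrite le_max lexx.
pose g := clip 0 N f.
have mg : measurable_fun setT g by exact: measurable_clip.
have gN x : 0 <= g x <= N by exact: clip_itv.
have gabs x : `|g x| <= N by have /andP[a b] := gN x; rewrite ger0_norm.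
have fg : {ae dvolX Gamma, forall x, f x = g x}.
  apply: filterS2 fM f0 => x fMx f0x; rewrite /g clip_id //.
  by rewrite (le_trans (ler_norm _)) // (le_trans fMx) // le_max lexx orbT.
have gle : distr_le (distr_lap g) (distr_of (fun x => B * phiX Gamma delta x)).
  move=> h th h0; rewrite /distr_lap -(Rintegral_aeM mf mg _ fg).
    exact: fle.
  exact: lapX_measurable.
have gC := bound g N B mg gN B0 gle.
have mphi := @measurable_phiX R Gamma delta.
have -> : (\int[dvolX Gamma]_x (f x * phiX Gamma delta x)%:E =
    (\int[dvolX Gamma]_x (g x * phiX Gamma delta x))%:E)%E.
  rewrite /Rintegral fineK; last first.
    exact: integrable_fin_num (integrable_Mphi hdelta mg gabs).
  apply: ae_eq_integral => //.
  - by apply/measurable_EFinP; exact: measurable_funM.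
  - by apply/measurable_EFinP; exact: measurable_funM.
  by apply: filterS fg => x fgx _ /=; rewrite fgx.
apply/ess_supP; apply: filterS2 fg gC => x /= -> gx.
by rewrite -EFinD -EFinM lee_fin.
Qed.
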